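(* Let $K$ be an algebraically closed field of characteristic zero, assume that $B=16$, and let $m,n>1$ be coprime integers and $(P,Q)$ a standard $(m,n)$-pair in $L=K[x,y]$ that is a minimal pair, such that there are $\lambda_0,\lambda_1,\lambda_P,\lambda_Q\in K^\times$ for which, with $R_0:=x(xy^4-\lambda_0)^3$ and $R_1:=y(xy^2-\lambda_1)$, $$\mathrm{Dir}(P)=\mathrm{Dir}(Q)=\{(4,-1),(-2,1),(-1,0),(0,-1)\},$$ $$\ell_{4,-1}(P)=\lambda_PR_0^m,\quad \ell_{4,-1}(Q)=\lambda_QR_0^n,\quad \ell_{-2,1}(P)=\lambda_PR_1^{4m},\quad \ell_{-2,1}(Q)=\lambda_QR_1^{4n},$$ and such that the $(4,-1)$-homogeneous element $F\in L^{(1)}$ with $v_{4,-1}(F)=3$ and $[F,\ell_{4,-1}(P)]=\ell_{4,-1}(P)$ satisfies $\mathrm{en}_{4,-1}(F)=(3,9)$. Interchanging $P$ with $Q$ (and $m$ with $n$) if necessary, assume $m>n>1$. Then there exists $j\in\mathbb{N}$ such that $m=3j+1$ and $n=2j+1$. Furthermore, performing on $(P,Q)$ a finite series of operations of the two types described in the context, one obtains $P_6,Q_6\in L$ and $\mu_0,\mu_1,\mu_2,\mu_3\in K$ with $\mu_0\neq0$ such that $$[P_6,Q_6]=x^4y+\mu_0+\mu_1x+\mu_2x^2+\mu_3x^3,$$ $$\ell_{1,-1}(P_6)=x^3y+\mu_3x^2,\qquad \ell_{1,-1}(Q_6)=x^2y+\mu_3x,$$ $$\mathrm{Dir}(P_6)\cap\mathfrak{V}_{>0}=\mathrm{Dir}(Q_6)\cap\mathfrak{V}_{>0}=\{(j,1)\},$$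 $$\mathrm{st}_{j,1}(P_6)=(3,1),\quad \mathrm{st}_{j,1}(Q_6)=(2,1),\quad \mathrm{en}_{j,1}(P_6)=(0,m),\quad \mathrm{en}_{j,1}(Q_6)=(0,n).$$
   Context: $\mathbb{N}$ is the set of positive integers. $L=K[x,y]\subseteq L^{(1)}=K[x,x^{-1},y]$, $[P,Q]:=\partial_xP\,\partial_yQ-\partial_xQ\,\partial_yP$. Directions: $\mathfrak{V}=\{(\rho,\sigma)\in\mathbb{Z}^2:\gcd(\rho,\sigma)=1\}$, $\mathfrak{V}_{>0}=\{(\rho,\sigma)\in\mathfrak{V}:\rho+\sigma>0\}$. For $P=\sum a_{i,j}x^iy^j\in L^{(1)}\setminus\{0\}$: $\mathrm{Supp}(P)=\{(i,j):a_{i,j}\ne0\}$, $v_{\rho,\sigma}(i,j)=\rho i+\sigma j$, $v_{\rho,\sigma}(P)=\max v_{\rho,\sigma}$ on $\mathrm{Supp}(P)$, $\ell_{\rho,\sigma}(P)$ is the sum of the terms attaining the maximum; $P$ is $(\rho,\sigma)$-homogeneous if $P=\ell_{\rho,\sigma}(P)$; $\mathrm{Dir}(P)=\{(\rho,\sigma)\in\mathfrak{V}:\#\mathrm{Supp}(\ell_{\rho,\sigma}(P))>1\}$. With $(a_1,a_2)\times(b_1,b_2)=a_1b_2-a_2b_1$: if $\ell_{\rho,\sigma}(P)$ is a monomial, $\mathrm{st}_{\rho,\sigma}(P)=\mathrm{en}_{\rho,\sigma}(P)$ is its exponent; otherwise they are the endpoints of the segment spanned by $\mathrm{Supp}(\ell_{\rho,\sigma}(P))$,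 ordered so that $(\rho,\sigma)\times(\mathrm{en}_{\rho,\sigma}(P)-\mathrm{st}_{\rho,\sigma}(P))>0$. Standard $(m,n)$-pair ($m,n>1$ coprime): $P,Q\in L^{(1)}$ with $[P,Q]\in K^\times$, $\frac{v_{1,1}(P)}{v_{1,1}(Q)}=\frac{v_{1,0}(P)}{v_{1,0}(Q)}=\frac mn$, $v_{1,-1}(\mathrm{en}_{1,0}(P))<0$ and $v_{1,-1}(\mathrm{st}_{1,0}(P))<0$. The Jacobian Conjecture (JC) over $K$ says every pair $P,Q\in K[x,y]$ with $[P,Q]\in K^\times$ defines an automorphism of $K[x,y]$; a counterexample is a pair with $[P,Q]\in K^\times$ that does not. $B:=\infty$ if JC is true, otherwise $B:=\min\gcd(v_{1,1}(P),v_{1,1}(Q))$ over all counterexamples. A minimal pair is a counterexample $(P,Q)$ with $\gcd(v_{1,1}(P),v_{1,1}(Q))=B$. Operations allowed on a pair: (i) add constants of $K$ to the components, or multiply the components by nonzero constants of $K$; (ii) apply one and the same $K$-algebra automorphism of $L$ (when the current pair lies in $L$) or of $L^{(1)}$ to both components. *)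

(* Defs.v *)
From HB Require Import structures.
From Stdlib Require Import Relations.
From mathcomp Require Import all_boot all_order all_algebra.
From mathcomp Require Import boolp finmap ring.
From mathcomp.multinomials Require monalg.
From mathcomp.multinomials Require Import mpoly.

Set Implicit Arguments.
Unset Strict Implicit.
Unset Printing Implicit Defensive.

Import Order.TTheory GRing.Theory Num.Theory.
Local Open Scope ring_scope.

(* The Laurent ring L^(1) = K[x, x^-1, y] as the monoid algebra of the additive
   monoid Z x N.  The module structure is that of {malg K[int * nat]}; the ring
   structure is built here because the one in monalg requires a monoid without
   nontrivial units.  The alias keeps the two apart. *)
Definition laurent (K : fieldType) : Type := monalg.malg (int * nat)%type K.

Section LaurentRing.
Import monalg.
Variable K : fieldType.
Local Notation L1 := (laurent K).

HB.instance Definition _ := Choice.copy L1 {malg K[(int * nat)%type]}.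
HB.instance Definition _ := GRing.Lmodule.copy L1 {malg K[(int * nat)%type]}.

Implicit Types (P Q : L1) (a b : int * nat).

Definition lcoef a P : K := monalg.mcoeff a P.
Definition Supp P : {fset (int * nat)} := monalg.msupp P.
(* The term c x^i y^j for a = (i, j). *)
Definition monom (c : K) a : L1 := mkmalgU a c.

Definition lmul P Q : L1 :=
  \sum_(a <- Supp P) \sum_(b <- Supp Q) monom (lcoef a P * lcoef b Q) (a + b).

Lemma laurentP P Q : (forall a, lcoef a P = lcoef a Q) -> P = Q.
Proof. by move=> h; apply/malgP. Qed.

Lemma lcoefD a P Q : lcoef a (P + Q) = lcoef a P + lcoef a Q.
Proof. exact: monalg.mcoeffD. Qed.

Lemma lcoefZ a c P : lcoef a (c *: P) = c * lcoef a P.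
Proof. exact: monalg.mcoeffZ. Qed.

Lemma lcoef0 a : lcoef a 0 = 0.
Proof. exact: monalg.mcoeff0. Qed.

Lemma lcoef_monom a c b : lcoef b (monom c a) = c *+ (a == b).
Proof. exact: monalg.mcoeffU. Qed.

Lemma lcoef_sum a I (r : seq I) (F : I -> L1) :
  lcoef a (\sum_(i <- r) F i) = \sum_(i <- r) lcoef a (F i).
Proof. exact: (big_morph (lcoef a) (lcoefD a) (lcoef0 a)). Qed.

Lemma mem_Supp a P : (a \in Supp P) = (lcoef a P != 0).
Proof. by rewrite -monalg.mcoeff_neq0. Qed.

Lemma monom0 a : monom 0 a = 0.
Proof. exact: monalgU0. Qed.

Lemma monomD a c d : monom (c + d) a = monom c a + monom d a.
Proof. exact: monalgUD. Qed.

Lemma laurentEw (d : {fset (int * nat)}) P : (Supp P `<=` d)%fset ->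
  P = \sum_(a <- d) monom (lcoef a P) a.
Proof. exact: monalgEw. Qed.

Lemma laurentE P : P = \sum_(a <- Supp P) monom (lcoef a P) a.
Proof. exact: monalgE. Qed.

Lemma lmulw (d1 d2 : {fset (int * nat)}) P Q :
  (Supp P `<=` d1)%fset -> (Supp Q `<=` d2)%fset ->
  lmul P Q = \sum_(a <- d1) \sum_(b <- d2) monom (lcoef a P * lcoef b Q) (a + b).
Proof.
move=> le1 le2; rewrite /lmul (big_fset_incl _ le1) /=.
  apply/eq_bigr=> a _; apply/big_fset_incl => // b _.
  by rewrite mem_Supp negbK => /eqP->; rewrite mulr0 monom0.
move=> a _; rewrite mem_Supp negbK => /eqP a0.
by rewrite big1 // => b _; rewrite a0 mul0r monom0.
Qed.

Lemma lmulC : commutative lmul.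
Proof.
move=> P Q; rewrite /lmul exchange_big; apply: eq_bigr => a _.
by apply: eq_bigr => b _; rewrite mulrC addrC.
Qed.

Lemma lmulDl : left_distributive lmul +%R.
Proof.
move=> P Q T; set d := (Supp P `|` Supp Q `|` Supp (P + Q)%R)%fset.
have lP : (Supp P `<=` d)%fset by rewrite /d -fsetUA fsubsetUl.
have lQ : (Supp Q `<=` d)%fset by rewrite /d fsetUAC fsubsetUr.
have lS : (Supp (P + Q)%R `<=` d)%fset by rewrite /d fsubsetUr.
have lT := fsubset_refl (Supp T).
rewrite (lmulw lP lT) (lmulw lQ lT) (lmulw lS lT) -big_split /=.
apply: eq_bigr => a _; rewrite -big_split /=; apply: eq_bigr => b _.
by rewrite lcoefD mulrDl monomD.
Qed.

Lemma lmulDr : right_distributive lmul +%R.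
Proof. by move=> P Q T; rewrite lmulC lmulDl (lmulC Q) (lmulC T). Qed.

Lemma lmul0 : left_zero 0 lmul.
Proof. by move=> P; apply: (addrI (lmul 0 P)); rewrite -lmulDl !addr0. Qed.

Lemma lmulr0 : right_zero 0 lmul.
Proof. by move=> P; rewrite lmulC lmul0. Qed.

Lemma lmul_monom c d a b :
  lmul (monom c a) (monom d b) = monom (c * d) (a + b).
Proof.
rewrite (@lmulw [fset a]%fset [fset b]%fset); try exact: msuppU_le.
by rewrite !big_seq_fset1 !lcoef_monom !eqxx.
Qed.

Lemma lmul_suml I (r : seq I) (F : I -> L1) Q :
  lmul (\sum_(i <- r) F i) Q = \sum_(i <- r) lmul (F i) Q.
Proof.
exact: (big_morph (lmul^~ Q) (fun P T => lmulDl P T Q) (lmul0 Q)).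
Qed.

Lemma lmul_sumr I (r : seq I) (F : I -> L1) Q :
  lmul Q (\sum_(i <- r) F i) = \sum_(i <- r) lmul Q (F i).
Proof. exact: (big_morph (lmul Q) (lmulDr Q) (lmulr0 Q)). Qed.

Lemma lmulA : associative lmul.
Proof.
move=> P Q T; rewrite (laurentE P) !lmul_suml; apply: eq_bigr => a _.
rewrite (laurentE Q) lmul_suml !lmul_sumr lmul_suml; apply: eq_bigr => b _.
rewrite (laurentE T) !lmul_sumr; apply: eq_bigr => c _.
by rewrite !lmul_monom mulrA addrA.
Qed.

Lemma lmul1 : left_id (monom 1 0) lmul.
Proof.
move=> P; rewrite [in LHS](laurentE P) lmul_sumr [RHS]laurentE.
by apply: eq_bigr => a _; rewrite lmul_monom mul1r add0r.
Qed.

Lemma lone_neq0 : monom 1 0 != 0.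
Proof.
apply/eqP => /(congr1 (lcoef 0)) /eqP.
by rewrite lcoef0 lcoef_monom eqxx oner_eq0.
Qed.

HB.instance Definition _ := GRing.Zmodule_isComNzRing.Build L1
  lmulA lmulC lmul1 lmulDl lone_neq0.

Lemma monomZ c d a : c *: monom d a = monom (c * d) a.
Proof.
by apply: laurentP => b; rewrite lcoefZ !lcoef_monom mulrnAr.
Qed.

Lemma lscaleAl (c : K) P Q : c *: (P * Q) = (c *: P) * Q.
Proof.
have E T : c *: T = lmul (monom c 0) T.
  apply: laurentP => a; rewrite lcoefZ [in RHS](laurentE T) lmul_sumr.
  rewrite {1}(laurentE T) !lcoef_sum mulr_sumr; apply: eq_bigr => b _.
  by rewrite lmul_monom add0r !lcoef_monom mulrnAr.
by rewrite !E lmulA.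
Qed.

HB.instance Definition _ := GRing.Lmodule_isLalgebra.Build K L1 lscaleAl.
HB.instance Definition _ := GRing.Lalgebra_isComAlgebra.Build K L1.

Definition Lx : L1 := monom 1 (1, 0%N).
Definition Ly : L1 := monom 1 (0, 1%N).

Definition dx P : L1 :=
  \sum_(a <- Supp P) monom (lcoef a P * a.1%:~R) (a.1 - 1, a.2).
Definition dy P : L1 :=
  \sum_(a <- Supp P) monom (lcoef a P * a.2%:R) (a.1, a.2.-1).
Definition bracket P Q : L1 := dx P * dy Q - dy P * dx Q.

Definition nonzero_const P : Prop := exists2 c : K, c != 0 & P = c%:A.

End LaurentRing.

(* The inclusion of L = K[x, y] into L^(1), with 'X_0 = x and 'X_1 = y. *)
Definition emb (K : fieldType) : {mpoly K[2]} -> laurent K :=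
  mmap (in_alg (laurent K)) (fun i : 'I_2 => if i == ord0 then Lx K else Ly K).

Lemma seq_argmin (T : eqType) (f : T -> int) (s : seq T) :
  s != [::] -> exists2 a, a \in s & all (fun b => f a <= f b) s.
Proof.
elim: s => // x [|y s] IHs _; first by exists x; rewrite ?mem_head //= lexx.
have [//|a as_ /allP amin] := IHs.
have [xa|ax] := leP (f x) (f a).
  exists x; rewrite ?mem_head //; apply/allP=> b; rewrite in_cons.
  by case/predU1P=> [->//|/amin]; apply: le_trans.
exists a; first by rewrite in_cons as_ orbT.
by apply/allP=> b; rewrite in_cons => /predU1P[->|/amin//]; apply: ltW.
Qed.

Lemma head_filter (T : eqType) (x0 : T) (p : pred T) (s : seq T) :
  (exists2 a, a \in s & p a) ->
  (head x0 (filter p s) \in s) && p (head x0 (filter p s)).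
Proof.
case=> a as_ pa; have: a \in filter p s by rewrite mem_filter pa.
case E: (filter p s) => [//|b t] _ /=.
have: b \in filter p s by rewrite E mem_head.
by rewrite mem_filter andbC.
Qed.

Section Directions.
Variable K : fieldType.
Local Notation L1 := (laurent K).
Implicit Types (P Q : L1) (a b : int * nat) (d u v : int * int).

Definition int2 a : int * int := (a.1, a.2%:Z).

Definition dirs : pred (int * int) := fun d => coprimez d.1 d.2.
Definition dirs_gt0 : pred (int * int) := fun d => dirs d && (0 < d.1 + d.2).

Definition val_at d a : int := d.1 * a.1 + d.2 * a.2%:Z.

(* Junk value 0 at P = 0, where v is not defined. *)
Definition vdeg d P : int :=
  let s := [seq val_at d a | a <- Supp P] in
  \big[Order.max/head 0 s]_(z <- s) z.

Definition ell d P : L1 :=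
  \sum_(a <- Supp P | val_at d a == vdeg d P) monom (lcoef a P) a.

Definition homogeneous d P : Prop := P != 0 /\ P = ell d P.

Definition Dir P : pred (int * int) :=
  fun d => dirs d && (1 < #|` Supp (ell d P)|)%N.

Definition cross u v : int := u.1 * v.2 - u.2 * v.1.

(* Supp (ell d P) lies on a line along which cross d is an affine coordinate
   (d != 0), so the endpoints of the segment it spans are the points where
   cross d is least (the start) and greatest (the end); see st_en_spec below.
   Junk value (0, 0) at P = 0. *)
Definition st d P : int * nat :=
  let s := Supp (ell d P) : seq (int * nat) in
  head (0, 0%N)
    [seq a <- s | all (fun b => cross d (int2 a) <= cross d (int2 b)) s].
Definition en d P : int * nat :=
  let s := Supp (ell d P) : seq (int * nat) in
  head (0, 0%N)
    [seq a <- s | all (fun b => cross d (int2 b) <= cross d (int2 a)) s].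

Lemma lcoef_ell d P a :
  lcoef a (ell d P) = if val_at d a == vdeg d P then lcoef a P else 0.
Proof.
rewrite /ell big_mkcond lcoef_sum; have [aP|] := boolP (a \in Supp P).
  rewrite (big_fsetD1 a) //= big1_fset => [|b /fsetD1P[ba _] _].
    by rewrite addr0; case: ifP; rewrite ?lcoef0 // lcoef_monom eqxx.
  by case: ifP; rewrite ?lcoef0 // lcoef_monom (negPf ba).
rewrite mem_Supp negbK => aP; rewrite (eqP aP) if_same big1_fset // => b bP _.
case: ifP => _; rewrite ?lcoef0 // lcoef_monom; case: eqP => // ba.
by rewrite mem_Supp ba aP in bP.
Qed.

Lemma Supp_neq0 P : P != 0 -> (Supp P : seq (int * nat)) != [::].
Proof.
apply: contraNneq => P0; rewrite (laurentE P).
by case: (enum_fset _) P0 => // _; rewrite big_nil.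
Qed.

Lemma vdeg_spec d P : P != 0 ->
  (exists2 a, a \in Supp P & val_at d a = vdeg d P) /\
  (forall a, a \in Supp P -> val_at d a <= vdeg d P).
Proof.
move=> /Supp_neq0 /(seq_argmin (fun a => - val_at d a))[a aP /allP amax].
suff -> : vdeg d P = val_at d a.
  by split=> [|b /amax]; [exists a | rewrite lerN2].
apply/le_anti/andP; split; last first.
  rewrite /vdeg; move: (map_f (val_at d) aP); move: (head _ _) => z0.
  move: (map _ _) => s; elim: s => //= z s IHs.
  rewrite big_cons in_cons le_max => /predU1P[->|/IHs->]; first by rewrite lexx.
  by rewrite orbT.
have les z : z \in [seq val_at d b | b <- Supp P] -> z <= val_at d a.
  by move=> /mapP[b /amax]; rewrite lerN2 => ? ->.
rewrite /vdeg big_seq; apply: (big_ind (fun z => z <= val_at d a)) => // [|y z yle zle].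
  case E: (map _ _) les (map_f (val_at d) aP) => [//|z s] /= les _.
  by rewrite les ?mem_head.
by rewrite ge_max yle.
Qed.

Lemma mem_Supp_ell d P a :
  (a \in Supp (ell d P)) = (a \in Supp P) && (val_at d a == vdeg d P).
Proof.
by rewrite !mem_Supp lcoef_ell; case: (val_at _ _ == _); rewrite ?andbT ?andbF // eqxx.
Qed.

(* st and en are the endpoints of the segment spanned by Supp (ell d P), in the
   order prescribed by d. *)
Lemma st_en_spec d P : dirs d -> P != 0 ->
  let s := st d P in let e := en d P in
  [/\ s \in Supp (ell d P), e \in Supp (ell d P),
      forall a, a \in Supp (ell d P) -> exists2 t : rat, 0 <= t <= 1 &
        a.1%:~R = s.1%:~R + t * (e.1%:~R - s.1%:~R) /\
        a.2%:R = s.2%:R + t * (e.2%:R - s.2%:R)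
    & s = e \/ 0 < cross d (e.1 - s.1, e.2%:Z - s.2%:Z)].
Proof.
move=> dd nzP s e; have [[a0 a0P Ea0] _] := vdeg_spec d nzP.
have nz : (Supp (ell d P) : seq (int * nat)) != [::].
  have: a0 \in Supp (ell d P) by rewrite mem_Supp_ell a0P Ea0 eqxx.
  by rewrite -[_ \in _]/(a0 \in enum_fset _); apply: contraTneq => ->.
have /andP[sP /allP smin] : (s \in Supp (ell d P)) &&
    all (fun b => cross d (int2 s) <= cross d (int2 b)) (Supp (ell d P)).
  exact: head_filter (seq_argmin (fun a => cross d (int2 a)) nz).
have /andP[eP /allP emax] : (e \in Supp (ell d P)) &&
    all (fun b => cross d (int2 b) <= cross d (int2 e)) (Supp (ell d P)).
  apply: (@head_filter _ _
    (fun a => all (fun b => cross d (int2 b) <= cross d (int2 a)) _)).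
  have [a aP amin] := seq_argmin (fun a => - cross d (int2 a)) nz.
  by exists a => //; apply: sub_all amin => b; rewrite lerN2.
have N0 : d.1 * d.1 + d.2 * d.2 != 0.
  rewrite paddr_eq0 -?expr2 ?sqr_ge0 // !expf_eq0 /=.
  apply: contraTN dd => /andP[/eqP d1 /eqP d2].
  by rewrite /dirs d1 d2.
have line a : a \in Supp (ell d P) ->
    ((d.1 * d.1 + d.2 * d.2) * (a.1 - s.1)
       = - d.2 * (cross d (int2 a) - cross d (int2 s))) /\
    ((d.1 * d.1 + d.2 * d.2) * (a.2%:Z - s.2%:Z)
       = d.1 * (cross d (int2 a) - cross d (int2 s))).
  move: sP; rewrite !mem_Supp_ell => /andP[_ /eqP sv] /andP[_ /eqP av].
  have : val_at d a - val_at d s = 0 by rewrite av sv subrr.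
  rewrite /cross /val_at /int2 /= => v0; split; apply/eqP; rewrite -subr_eq0.
    apply/eqP; transitivity (d.1 * (d.1 * a.1 + d.2 * a.2%:Z -
      (d.1 * s.1 + d.2 * s.2%:Z))); [by ring | by rewrite v0 mulr0].
  apply/eqP; transitivity (d.2 * (d.1 * a.1 + d.2 * a.2%:Z -
    (d.1 * s.1 + d.2 * s.2%:Z))); [by ring | by rewrite v0 mulr0].
set D := cross d (int2 e) - cross d (int2 s).
have crossE : cross d (e.1 - s.1, e.2%:Z - s.2%:Z) = D.
  by rewrite /D /cross /int2 /=; ring.
have D_ge0 : 0 <= D by rewrite subr_ge0; apply: smin.
have [D0|D0] := eqVneq D 0.
  have se a : a \in Supp (ell d P) -> a = s.
    move=> aP; have [l1 l2] := line a aP.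
    have c0 : cross d (int2 a) - cross d (int2 s) = 0.
      apply/le_anti; rewrite subr_ge0 smin // andbT -D0 lerD2r.
      exact: emax.
    move: l1 l2; rewrite c0 !mulr0 => /eqP + /eqP.
    rewrite !mulf_eq0 !(negPf N0) /= !subr_eq0 => /eqP a1 /eqP [a2].
    by case: (a) (s) a1 a2 => [? ?] [? ?] /= -> ->.
  split=> //; last by left; rewrite (se e).
  move=> a /se->; exists 0; rewrite ?lexx ?ler01 //.
  by rewrite !mul0r !addr0.
have D_gt0 : 0 < D by rewrite lt_neqAle eq_sym D0.
split=> //; last by right; rewrite crossE.
move=> a aP; pose c := cross d (int2 a) - cross d (int2 s).
have DQ : (D%:~R : rat) != 0 by rewrite intr_eq0.
have NQ : ((d.1 * d.1 + d.2 * d.2)%:~R : rat) != 0 by rewrite intr_eq0.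
exists (c%:~R / D%:~R).
  apply/andP; split.
    by rewrite divr_ge0 // ler0z // subr_ge0 smin.
  by rewrite ler_pdivrMr ?ltr0z // mul1r ler_int lerD2r emax.
have [a1 a2] := line a aP; have [e1 e2] := line e eP.
have {}line (x y w : int) : (d.1 * d.1 + d.2 * d.2) * x = w * c ->
    (d.1 * d.1 + d.2 * d.2) * y = w * D ->
    x%:~R = c%:~R / D%:~R * y%:~R :> rat.
  move=> /(congr1 (fun z : int => z%:~R : rat)) + /(congr1 (fun z : int => z%:~R : rat)).
  rewrite !intrM => Ex Ey; apply: (mulfI NQ).
  by rewrite Ex mulrCA Ey mulrCA divfK.
split; apply/eqP; rewrite addrC -subr_eq; apply/eqP.
  by rewrite -!intrB; apply: line a1 e1.
by have := line _ _ _ a2 e2; rewrite !intrB.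
Qed.

End Directions.

Section Pairs.
Variable K : fieldType.
Implicit Types (P Q : laurent K) (p q : {mpoly K[2]}).

Definition standard_pair (m n : nat) P Q : Prop :=
  [/\ (1 < m)%N, (1 < n)%N & coprime m n] /\
  [/\ nonzero_const (bracket P Q),
      (vdeg (1, 1) P)%:Q / (vdeg (1, 1) Q)%:Q = m%:Q / n%:Q,
      (vdeg (1, 0) P)%:Q / (vdeg (1, 0) Q)%:Q = m%:Q / n%:Q,
      val_at (1, -1) (en (1, 0) P) < 0 & val_at (1, -1) (st (1, 0) P) < 0].

Definition jacobian_pair p q : Prop := nonzero_const (bracket (emb p) (emb q)).

Definition defines_automorphism p q : Prop :=
  exists phi : {lrmorphism {mpoly K[2]} -> {mpoly K[2]}},
    [/\ bijective phi, phi 'X_ord0 = p & phi 'X_ord_max = q].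

Definition counterexample p q : Prop :=
  jacobian_pair p q /\ ~ defines_automorphism p q.

(* v_{1,1} is nonnegative on nonzero elements of L, and both components of a
   counterexample are nonzero. *)
Definition degree_gcd p q : nat :=
  gcdn `|vdeg (1, 1) (emb p)| `|vdeg (1, 1) (emb q)|.

End Pairs.

Definition JC (K : fieldType) : Prop :=
  forall p q : {mpoly K[2]}, jacobian_pair p q -> defines_automorphism p q.

Definition counterexample_gcd (K : fieldType) : pred nat := fun g =>
  `[< exists p q : {mpoly K[2]}, counterexample p q /\ degree_gcd p q = g >].

(* The invariant B of K, with None for infinity. *)
Definition JCbound (K : fieldType) : option nat :=
  if pselect (exists g, counterexample_gcd K g) is left h
  then Some (ex_minn h) else None.

Lemma JCbound_infty (K : fieldType) : JCbound K = None <-> JC K.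
Proof.
rewrite /JCbound; case: pselect => [h|h]; split=> //.
  move=> jc; exfalso; case: h => g /asboolP[p [q [[Jpq npq] _]]].
  by apply: npq; apply: jc.
move=> _ p q Jpq; apply: contrapT => npq; apply: h.
by exists (degree_gcd p q); apply/asboolP; exists p, q.
Qed.

Definition minimal_pair (K : fieldType) (p q : {mpoly K[2]}) : Prop :=
  counterexample p q /\ JCbound K = Some (degree_gcd p q).

Inductive operation (K : fieldType) :
    laurent K * laurent K -> laurent K * laurent K -> Prop :=
| Op_add (c d : K) P Q : operation (P, Q) (P + c%:A, Q + d%:A)
| Op_scale (c d : K) P Q :
    c != 0 -> d != 0 -> operation (P, Q) (c *: P, d *: Q)
| Op_autL (phi : {lrmorphism {mpoly K[2]} -> {mpoly K[2]}}) p q :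
    bijective phi ->
    operation (emb p, emb q) (emb (phi p), emb (phi q))
| Op_autL1 (phi : {lrmorphism laurent K -> laurent K}) P Q :
    bijective phi -> operation (P, Q) (phi P, phi Q).

Definition operations (K : fieldType) :
    laurent K * laurent K -> laurent K * laurent K -> Prop :=
  clos_refl_trans _ (@operation K).

(* Main.v *)
(* The argument is local, on Newton polygons.  After exchanging x and y, the pair
   is sheared by y -> y + q(x) so as to move the corners of its Newton polygons
   down a prescribed ray.  At every direction met on the way, the bracket of the
   leading forms p, q either vanishes, and then p and q are proportional to
   powers of one polynomial r, or is known.  Subtracting powers as in the
   Euclidean algorithm turns the vanishing case into the Wronskian equation
   v r t' - w r' t = e with v r e' = w' r' e, whose solutions force r to have a
   single root; that root is removed by the next shear.  The involution x -> 1/x,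
   y -> x^3 y brings the pair back to K[x, y] when the edge of slope -3 is
   reached.  It multiplies brackets by -x, so its second use turns a
   bracket proportional to y - x / lambda_0 into one with leading term x^4 y.  In
   the direction proportional to (m + n - 2, 5) the leading forms then have
   bracket proportional to x^4 y, and comparing exponents gives m = 3j + 1 and
   n = 2j + 1. *)
From HB Require Import structures.
Require Import Defs.
From mathcomp Require Import all_boot all_order all_algebra fingroup perm finmap.
From mathcomp.multinomials Require Import mpoly.
From mathcomp Require Import cyclic cyclotomic separable zify ring.
From Stdlib Require Import Relations.
Set Implicit Arguments.
Unset Strict Implicit.
Unset Printing Implicit Defensive.
Import Order.TTheory GRing.Theory Num.Theory.
Local Open Scope ring_scope.

(** * Wronskian equations for univariate polynomials *)

Section Wronskian.
Variables (K : fieldType) (K0 : [pchar K] =i pred0).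
Implicit Types (p q r t e f g : {poly K}) (a b v tau eps : int).

Lemma natK_eq0 n : (n%:R == 0 :> K) = (n == 0%N).
Proof. exact: (pcharf0P K).1. Qed.

Lemma intK_eq0 a : (a%:~R == 0 :> K) = (a == 0).
Proof.
by case: a => n; rewrite ?NegzE ?rmorphN ?oppr_eq0 /= -pmulrn natK_eq0.
Qed.

Definition wronsk a b r t : {poly K} :=
  a%:~R *: (r * t^`()) - b%:~R *: (r^`() * t).

Lemma coef_top p q m n : (size p <= m.+1)%N -> (size q <= n.+1)%N ->
  (p * q)`_(m + n) = p`_m * q`_n.
Proof.
move=> sp sq; have hm : (m < (m + n).+1)%N by rewrite ltnS leq_addr.
rewrite coefM (bigD1 (Ordinal hm)) //= addKn big1 ?addr0 // => i im.
have [lt_im|le_mi] := ltnP i m.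
  by rewrite [q`_ _]nth_default ?mulr0 // (leq_trans sq) //; lia.
rewrite [p`_ _]nth_default ?mul0r // (leq_trans sp) // ltn_neqAle le_mi andbT.
by rewrite eq_sym.
Qed.

Lemma coef_Xderiv p n : ('X * p^`())%R`_n = p`_n *+ n.
Proof. by case: n => [|n]; rewrite coefXM //= coef_deriv. Qed.

Lemma size_Xderiv p : (size ('X * p^`())%R <= size p)%N.
Proof. by apply/leq_sizeP=> j hj; rewrite coef_Xderiv nth_default ?mul0rn. Qed.

Lemma Xwronsk a b r t :
  'X * wronsk a b r t
  = a%:~R *: (r * ('X * t^`())) - b%:~R *: (('X * r^`()) * t).
Proof. by rewrite /wronsk mulrBr -!scalerAr (mulrCA 'X) !mulrA. Qed.

Lemma wronsk_top a b r t m n : (size r <= m.+1)%N -> (size t <= n.+1)%N ->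
  ('X * wronsk a b r t)%R`_(m + n)
  = (a * n%:Z - b * m%:Z)%:~R * (r`_m * t`_n).
Proof.
move=> sr st; rewrite Xwronsk coefB !coefZ !coef_top ?(leq_trans (size_Xderiv _)) //.
rewrite !coef_Xderiv -(mulr_natr t`_n) -(mulr_natr r`_m) intrB !intrM -!pmulrn.
ring.
Qed.

Lemma wronsk_size a b r t m n : (size r <= m.+1)%N -> (size t <= n.+1)%N ->
  (size (wronsk a b r t) <= m + n)%N.
Proof.
move=> sr st; have [->|W0] := eqVneq (wronsk a b r t) 0; first by rewrite size_poly0.
rewrite -ltnS -(size_mulX W0) mulrC Xwronsk.
have sM p q : (size p <= m.+1)%N -> (size q <= n.+1)%N ->
    (size (p * q)%R <= (m + n).+1)%N.
  by move=> sp sq; apply: leq_trans (size_polyMleq _ _) _; lia.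
apply: leq_trans (size_polyD _ _) _; rewrite size_polyN geq_max.
by rewrite !(leq_trans (size_scale_leq _ _)) ?sM // (leq_trans (size_Xderiv _)).
Qed.

Lemma sizeS p : p != 0 -> size p = (size p).-1.+1.
Proof. by rewrite -size_poly_gt0 => /prednK. Qed.

Lemma wronsk_deg_eq a b r t : r != 0 -> t != 0 ->
  a * (size t).-1%:Z != b * (size r).-1%:Z ->
  size (wronsk a b r t) = ((size r).-1 + (size t).-1)%N.
Proof.
move=> r0 t0 ne; have sr := sizeS r0; have st := sizeS t0.
apply/eqP; rewrite eqn_leq wronsk_size -?sr -?st // leqNgt -ltnS; apply/negP=> lt.
have := @wronsk_top a b r t _ _ (eq_leq sr) (eq_leq st).
rewrite nth_default; last first.
  rewrite (leq_trans (size_polyMleq _ _)) // size_polyX; lia.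
move/esym/eqP; rewrite !mulf_eq0 intK_eq0 subr_eq0 (negPf ne) /=.
by rewrite -!/(lead_coef _) !lead_coef_eq0 (negPf r0) (negPf t0).
Qed.

Lemma wronsk_deg_lt a b r t : r != 0 -> t != 0 -> wronsk a b r t != 0 ->
  a * (size t).-1%:Z = b * (size r).-1%:Z ->
  (size (wronsk a b r t) < (size r).-1 + (size t).-1)%N.
Proof.
move=> r0 t0 W0 eqv; have sr := sizeS r0; have st := sizeS t0.
rewrite ltn_neqAle wronsk_size -?sr -?st // andbT; apply/negP => /eqP sz.
have := @wronsk_top a b r t _ _ (eq_leq sr) (eq_leq st).
rewrite eqv subrr mul0r -sz => /eqP.
rewrite -[size _]/(size _).+1.-1 -(size_mulX W0) mulrC -/(lead_coef _).
by rewrite lead_coef_eq0 mulf_eq0 polyX_eq0 (negPf W0).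
Qed.

Lemma wronsk0_deg a b r t : r != 0 -> t != 0 -> wronsk a b r t = 0 ->
  a * (size t).-1%:Z = b * (size r).-1%:Z.
Proof.
move=> r0 t0 W0; apply/eqP; apply: contraTT isT => ne.
have sr := sizeS r0; have st := sizeS t0.
have := @wronsk_top a b r t _ _ (eq_leq sr) (eq_leq st).
rewrite W0 mulr0 coef0 => /esym/eqP; rewrite !mulf_eq0 intK_eq0 subr_eq0 (negPf ne) /=.
by rewrite -!/(lead_coef _) !lead_coef_eq0 (negPf r0) (negPf t0).
Qed.

Lemma wronsk11_const f g : g != 0 -> wronsk 1 1 g f = 0 -> exists c, f = c *: g.
Proof.
move=> g0 W; have sz h : h != 0 -> wronsk 1 1 g h = 0 -> size h = size g.
  move=> h0 Wh; rewrite (sizeS h0) (sizeS g0); congr _.+1.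
  by have := wronsk0_deg g0 h0 Wh; rewrite !mul1r => -[].
have [->|f0] := eqVneq f 0; first by exists 0; rewrite scale0r.
pose c := lead_coef f / lead_coef g; exists c; apply/eqP; rewrite -subr_eq0.
apply: contraTT isT => h0; have sfg := sz _ f0 W.
have lt : (size (f - c *: g)%R < size g)%N.
  rewrite [X in (_ < X)%N](sizeS g0) ltnS; apply/leq_sizeP => j le_j.
  rewrite coefB coefZ; have [/esym lt_j|ne_j] := eqVneq (size g).-1 j.
    rewrite lt_j -/(lead_coef g) -{1}sfg -/(lead_coef f) divfK ?subrr //.
    by rewrite lead_coef_eq0.
  have le2 : (size g <= j)%N by rewrite (sizeS g0) ltn_neqAle ne_j.
  by rewrite !nth_default ?mulr0 ?subr0 // sfg.
have := sz _ h0; rewrite -/(lead_coef _) => Wh; move: lt; rewrite Wh ?ltnn //.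
move: W; rewrite /wronsk !scale1r derivB derivZ => /eqP; rewrite subr_eq0 => /eqP W.
by rewrite !mulrBr W -scalerAr -!scalerAr [g * _]mulrC subrr.
Qed.

Lemma mup_dec p (x : K) : p != 0 ->
  exists2 q, q.[x] != 0 & p = ('X - x%:P) ^+ mup x p * q.
Proof.
move=> p0; have [m [q]] := multiplicity_XsubC p x; rewrite p0 /= => nq pE.
exists q; first by rewrite -rootE.
suff -> : mup x p = m by rewrite mulrC.
by rewrite pE mupMr // mup_XsubCX eqxx.
Qed.

Lemma XsubC_deriv_dec p x : p != 0 -> exists2 q, q.[x] != 0 &
  p = ('X - x%:P) ^+ mup x p * q /\
  ('X - x%:P) * p^`() =
    ('X - x%:P) ^+ mup x p * ((mup x p)%:R *: q + ('X - x%:P) * q^`()).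
Proof.
move=> p0; have [q qx {1 3}->] := mup_dec x p0; exists q => //; split=> //.
move: (mup x p) => k; rewrite derivM deriv_exp derivXsubC mul1r mulrDr.
rewrite mulrDr scaler_nat; congr (_ + _); last by rewrite mulrCA.
case: k => [|k]; first by rewrite !mulr0n mul0r !mulr0.
by rewrite mulrnAl !mulrnAr mulrA -exprS.
Qed.

Lemma wronsk_mup_dec a b r t x : r != 0 -> t != 0 ->
  exists2 s, ('X - x%:P) * wronsk a b r t
             = ('X - x%:P) ^+ (mup x r + mup x t) * s
  & root s x = (a * (mup x t)%:Z == b * (mup x r)%:Z).
Proof.
move=> r0 t0; have [r1 r1x [rE drE]] := XsubC_deriv_dec x r0.
have [t1 t1x [tE dtE]] := XsubC_deriv_dec x t0.
pose s := a%:~R *: (r1 * ((mup x t)%:R *: t1 + ('X - x%:P) * t1^`()))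
  - b%:~R *: (((mup x r)%:R *: r1 + ('X - x%:P) * r1^`()) * t1).
exists s.
  rewrite /wronsk mulrBr -!scalerAr (mulrCA _ r) dtE (mulrA _ r^`()) drE.
  rewrite {1}rE {3}tE exprD /s mulrBr -!scalerAr; congr (_ *: _ - _ *: _).
    by rewrite mulrACA.
  by rewrite mulrACA.
rewrite rootE /s !(hornerXsubC, hornerD, hornerN, hornerZ, hornerM) subrr.
rewrite !mul0r !addr0.
rewrite (_ : _ - _ =
   (a * (mup x t)%:Z - b * (mup x r)%:Z)%:~R * (r1.[x] * t1.[x])); last first.
  by rewrite intrB !intrM -!pmulrn; ring.
by rewrite !mulf_eq0 (negPf r1x) (negPf t1x) !orbF intK_eq0 subr_eq0.
Qed.

Lemma wronsk0_mup a b r t x : r != 0 -> t != 0 -> wronsk a b r t = 0 ->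
  a * (mup x t)%:Z = b * (mup x r)%:Z.
Proof.
move=> r0 t0 W0; apply/eqP; have [s + <-] := wronsk_mup_dec a b x r0 t0.
rewrite W0 mulr0 => /esym/eqP; rewrite mulf_eq0 expf_eq0 polyXsubC_eq0 andbF /=.
by move/eqP->; rewrite root0.
Qed.

Lemma mup_wronsk a b r t x : r != 0 -> t != 0 -> wronsk a b r t != 0 ->
  if a * (mup x t)%:Z == b * (mup x r)%:Z
  then (mup x r + mup x t <= mup x (wronsk a b r t))%N
  else (mup x r + mup x t == (mup x (wronsk a b r t)).+1)%N.
Proof.
move=> r0 t0 W0; have [s sE <-] := wronsk_mup_dec a b x r0 t0.
have Xx0 : 'X - x%:P != 0 by rewrite polyXsubC_eq0.
have s0 : s != 0.
  by apply: contraNneq W0 => s0; move/eqP: sE; rewrite s0 mulr0 mulf_eq0 (negPf Xx0).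
have := congr1 (mup x) sE; rewrite !mupM ?expf_neq0 // mup_XsubCX eqxx.
rewrite (@mup_XsubCX _ 1) eqxx add1n => E; case: ifP => [rs|/negbT/mupNroot s1].
  have : (0 < mup x s)%N by rewrite -XsubC_dvd // dvdp_XsubCl.
  lia.
by rewrite E s1 addn0.
Qed.

End Wronskian.

Section WronskAlgebra.
Variable K : fieldType.
Implicit Types (p q r t e f g : {poly K}) (a b v tau eps : int).

Lemma wronskB a b r t f : wronsk a b r (t - f) = wronsk a b r t - wronsk a b r f.
Proof. by rewrite /wronsk derivB !mulrBr !scalerBr; ring. Qed.

Lemma wronskZ a b r (c : K) t : wronsk a b r (c *: t) = c *: wronsk a b r t.
Proof.
by rewrite /wronsk derivZ -!scalerAr !scalerBr !scalerA ![c * _]mulrC.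
Qed.

Lemma wronskMc a b c r f g : wronsk a (b + c) r (f * g) =
  g * wronsk a b r f + f * wronsk a c r g.
Proof. rewrite /wronsk derivM intrD -!mul_polyC polyCD; ring. Qed.

Lemma wronskM a b c r f g : wronsk a b r f = 0 -> wronsk a c r g = 0 ->
  wronsk a (b + c) r (f * g) = 0.
Proof. by rewrite wronskMc => -> ->; rewrite !mulr0 addr0. Qed.

Lemma wronsk_self a r : wronsk a a r r = 0.
Proof. by rewrite /wronsk mulrC subrr. Qed.

Lemma wronskX a b r f k : wronsk a b r f = 0 -> wronsk a (b * k%:Z) r (f ^+ k) = 0.
Proof.
move=> W; elim: k => [|k IHk].
  by rewrite mulr0 expr0 /wronsk derivC mulr0 scaler0 scale0r subrr.
by rewrite exprS intS mulrDr mulr1; apply: wronskM.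
Qed.

Lemma wronskM_exp a b c r e k : wronsk a b r e = 0 -> c = b + k%:Z * a ->
  wronsk a c r (e * r ^+ k) = 0.
Proof.
by move=> W ->; rewrite [_ * a]mulrC; apply: wronskM; rewrite ?wronskX ?wronsk_self.
Qed.

Lemma wronsk_divl a b c r f g : f != 0 -> wronsk a b r f = 0 ->
  wronsk a (b + c) r (f * g) = 0 -> wronsk a c r g = 0.
Proof.
rewrite wronskMc => f0 ->; rewrite mulr0 add0r => /eqP.
by rewrite mulf_eq0 (negPf f0) => /eqP.
Qed.

Lemma wronsk_expl a b r f (c : K) m : (0 < m)%N ->
  wronsk (m%:Z * a) b (c *: r ^+ m) f = (m%:R * c) *: (r ^+ m.-1 * wronsk a b r f).
Proof.
case: m => // m _; rewrite /wronsk derivZ deriv_exp intrM -pmulrn /= exprS.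
rewrite -!scaler_nat -!mul_polyC !polyCM; ring.
Qed.

End WronskAlgebra.

Section ClosedField.
Variables (K : closedFieldType) (K0 : [pchar K] =i pred0).
Implicit Types (p q r t e f g : {poly K}) (a b v tau eps : int).

Lemma dvdp_mup p q : p != 0 -> q != 0 ->
  (forall x, (mup x p <= mup x q)%N) -> p %| q.
Proof.
have [s] := closed_field_poly_normal p; set c := lead_coef p => pE p0 q0 le_mup.
have c0 : c != 0 by rewrite lead_coef_eq0.
rewrite pE dvdpZl //; have {}le_mup x : (count_mem x s <= mup x q)%N.
  apply: leq_trans (le_mup x); rewrite [in X in (_ <= X)%N]pE -mul_polyC mupMr.
    by rewrite mu_prod_XsubC.
  by rewrite rootC.
elim: s q q0 le_mup {pE} => [|z s IHs] q q0 le_mup; first by rewrite big_nil dvd1p.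
have /dvdpP[q' qE] : 'X - z%:P %| q.
  by rewrite XsubC_dvd // (leq_trans _ (le_mup z)) //= eqxx.
have q'0 : q' != 0 by apply: contraNneq q0 => q'0; rewrite qE q'0 mul0r.
rewrite big_cons qE mulrC dvdp_mul //; apply: IHs => // x.
have := le_mup x; rewrite qE mupM ?polyXsubC_eq0 // (@mup_XsubCX _ 1) /=.
by case: eqP; lia.
Qed.

(* An exponent [k] with [tau - eps = k v] corresponds to the solution
   [e * r ^+ k] of the homogeneous equation; subtracting a multiple of it
   from [t] removes the only resonance at infinity. *)
Lemma wronsk_one_root v tau eps r t e : 0 < v ->
  r != 0 -> e != 0 -> wronsk v tau r t = e -> wronsk v eps r e = 0 ->
  (forall x (z : int), root r x -> v * z = (tau - eps) * (mup x r)%:Z ->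
     - (mup x r)%:Z < z) ->
  (forall z : int, 2 - (size r).-1%:Z <= z -> v * z = (tau - eps) * (size r).-1%:Z ->
     exists k : nat, tau - eps = k%:Z * v) ->
  forall x y, root r x -> root r y -> x = y.
Proof.
move=> v0 r0 e0 We W0 Hfin Hinf x y rx ry; apply/eqP; apply: contraTT isT => xy.
have vN0 : v != 0 by rewrite gt_eqF.
have t_neq0 u : wronsk v tau r u = e -> u != 0.
  move=> Wu; apply: contraNneq e0 => u0; rewrite -Wu u0 /wronsk.
  by rewrite deriv0 !mulr0 !scaler0 subrr.
have dege := wronsk0_deg K0 r0 e0 W0.
have {t We} [t We ne] : exists2 t, wronsk v tau r t = e &
    v * (size t).-1%:Z != tau * (size r).-1%:Z.
  have [eqt|] := eqVneq (v * (size t).-1%:Z) (tau * (size r).-1%:Z); last by exists t.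
  have t0 := t_neq0 _ We.
  have := wronsk_deg_lt r0 t0 _ eqt; rewrite We => /(_ e0) lt_e.
  have [||k tauE] := Hinf ((size t).-1%:Z - (size e).-1%:Z).
  - rewrite lerBrDr addrAC lerBlDr; move: lt_e; rewrite {1}(sizeS e0).
    by move: (size e).-1 (size r).-1 (size t).-1 => A B C; lia.
  - by rewrite mulrBr mulrBl eqt dege.
  have rk0 : r ^+ k != 0 by rewrite expf_neq0.
  have er0 : e * r ^+ k != 0 by rewrite mulf_neq0.
  pose c := lead_coef t / lead_coef (e * r ^+ k).
  have W't : wronsk v tau r (t - c *: (e * r ^+ k)) = e.
    rewrite wronskB wronskZ (wronskM_exp W0) ?scaler0 ?subr0 //.
    by rewrite -tauE addrC subrK.
  exists (t - c *: (e * r ^+ k)) => //.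
  have t'0 := t_neq0 _ W't.
  have sz : size (e * r ^+ k) = size t.
    have dkE : (size (r ^+ k)%R).-1 = ((size r).-1 * k)%N := size_exp r k.
    have szM := size_mul e0 rk0; rewrite (sizeS e0) (sizeS rk0) dkE in szM.
    rewrite szM (sizeS t0); move/eqP: tauE; rewrite subr_eq => /eqP tauE.
    suff : v * ((size e).-1 + (size r).-1 * k)%N%:Z = v * (size t).-1%:Z.
      by move/(mulfI vN0) => -[<-]; rewrite addSn addnS.
    by rewrite PoszD PoszM mulrDr dege eqt tauE; ring.
  have lt : (size (t - c *: (e * r ^+ k))%R < size t)%N.
    rewrite [X in (_ < X)%N](sizeS t0) ltnS; apply/leq_sizeP => j le_j.
    rewrite coefB coefZ; have [/esym lt_j|ne_j] := eqVneq (size t).-1 j.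
      rewrite lt_j -{2}sz -!/(lead_coef _) divfK ?subrr //.
      by rewrite lead_coef_eq0.
    have le2 : (size t <= j)%N by rewrite (sizeS t0) ltn_neqAle ne_j.
    by rewrite !nth_default ?mulr0 ?subr0 // sz.
  rewrite -eqt (inj_eq (mulfI vN0)) eqz_nat neq_ltn.
  by rewrite -ltnS -(sizeS t'0) -(sizeS t0) lt.
have t0 := t_neq0 _ We.
have degt := wronsk_deg_eq K0 r0 t0 ne; rewrite We in degt.
have Xx0 z : 'X - z%:P != 0 :> {poly K} by rewrite polyXsubC_eq0.
have dvd : e * (('X - x%:P) * ('X - y%:P)) %| t * r.
  apply: dvdp_mup; rewrite ?mulf_neq0 // => z.
  rewrite !mupM ?mulf_neq0 // !(@mup_XsubCX _ 1).
  have := wronsk0_mup K0 z r0 e0 W0; have := @mup_wronsk _ K0 v tau _ _ z r0 t0.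
  rewrite We => /(_ e0); have [rz|nrz] := boolP (root r z).
    case: ifP => [/eqP eqv le_k eqe|_ /eqP eqk _].
      have := Hfin z ((mup z t)%:Z - (mup z e)%:Z) rz.
      rewrite mulrBr mulrBl eqv eqe => /(_ erefl); lia.
    have [xz|_] := eqVneq x z; have [yz|_] := eqVneq y z; move/eqP: eqk; try lia.
    by rewrite xz yz eqxx in xy.
  rewrite (mupNroot nrz) !mulr0 => _ /eqP; rewrite mulf_eq0 (negPf vN0) /=.
  rewrite eqz_nat => /eqP->.
  have [xz|_] := eqVneq x z; first by rewrite -xz rx in nrz.
  by have [yz|_] := eqVneq y z; first by rewrite -yz ry in nrz.
have /dvdp_leq := dvd; rewrite mulf_neq0 // => /(_ isT).
rewrite !size_mul ?mulf_neq0 // !size_XsubC degt.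
by rewrite {2}(sizeS t0) {2}(sizeS r0); move: (size r).-1 (size t).-1 => A B /=; lia.
Qed.

End ClosedField.

Section CommonPower.
Variables (K : fieldType) (K0 : [pchar K] =i pred0).
Implicit Types (p q r t e f g : {poly K}) (a b : int) (m n k : nat).

Lemma wronsk_ratio a b p f g : a != 0 -> p != 0 -> g != 0 ->
  wronsk a b p f = 0 -> wronsk a b p g = 0 -> exists c, f = c *: g.
Proof.
move=> a0 p0 g0 Wf Wg; apply: (wronsk11_const K0 g0).
have aK0 : (a%:~R)%:P != 0 :> {poly K} by rewrite polyC_eq0 intK_eq0.
apply: (mulfI (mulf_neq0 aK0 p0)); rewrite mulr0.
transitivity (g * wronsk a b p f - f * wronsk a b p g).
  by rewrite /wronsk -!mul_polyC; ring.
by rewrite Wf Wg !mulr0 subrr.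
Qed.

Lemma wronsk_power (a : nat) tau p t (N1 N2 : nat) : (0 < a)%N ->
  p != 0 -> wronsk a%:Z tau p t = 0 -> N2%:Z = N1%:Z + tau ->
  exists c, t ^+ a * p ^+ N1 = c *: p ^+ N2.
Proof.
move=> a0 p0 W NE; apply: (@wronsk_ratio a%:Z (a%:Z * N2%:Z) p) => //.
- by rewrite eqz_nat -lt0n.
- by rewrite expf_neq0.
- rewrite NE mulrDr addrC [a%:Z * tau]mulrC.
  by apply: wronskM; apply: wronskX; rewrite ?wronsk_self.
- by apply: wronskX; rewrite wronsk_self.
Qed.

Lemma common_power m n p q : (0 < m)%N -> (0 < n)%N -> coprime m n ->
  p != 0 -> q != 0 -> wronsk m%:Z n%:Z p q = 0 ->
  exists r (c d : K), [/\ c != 0, d != 0, p = c *: r ^+ m & q = d *: r ^+ n].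
Proof.
move=> m0 n0 cop p0 q0 W.
have [c] := @wronsk_power m n%:Z p q 0 n m0 p0 W (esym (add0r _)).
rewrite expr0 mulr1 => qm.
have c0 : c != 0.
  apply: contraNneq q0 => c0; have := expf_eq0 q m.
  by rewrite m0 qm c0 scale0r eqxx /= => /esym.
have [[u w] /= uw] : exists u, (u.1 * n - u.2 * m = 1)%N.
  by apply/coprimeP; rewrite // coprime_sym.
have {}uw : (n * u = (w * m).+1)%N by lia.
have key : p * (p ^+ w) ^+ m = c^-1 ^+ u *: (q ^+ u) ^+ m.
  rewrite -exprM -exprS -uw exprM; have -> : p ^+ n = c^-1 *: q ^+ m.
    by rewrite qm scalerA mulVf ?scale1r.
  by rewrite exprZn -!exprM mulnC.
have ck : c^-1 ^+ u != 0 by rewrite expf_neq0 ?invr_eq0.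
have /dvdpP[r rE] : p ^+ w %| q ^+ u.
  rewrite -(dvdp_pexp2r _ _ m0); apply/dvdpP; exists (c ^+ u *: p).
  by rewrite -scalerAl key scalerA -exprMn divff ?expr1n ?scale1r.
exists r, (c^-1 ^+ u).
have pE : p = c^-1 ^+ u *: r ^+ m.
  have pw0 : (p ^+ w) ^+ m != 0 by rewrite !expf_neq0.
  by apply: (mulIf pw0); rewrite key rE exprMn -scalerAl.
have r0 : r != 0.
  by apply: contraNneq p0 => r0; rewrite pE r0 expr0n gtn_eqF // scaler0.
have dvd1 : (q ^+ m %= (r ^+ n) ^+ m).
  rewrite qm pE exprZn scalerA -!exprM [(n * m)%N]mulnC; apply: eqp_scale.
  by rewrite mulf_neq0 ?expf_neq0 // invr_eq0.
have /eqpP[[d1 d2] /= /andP[d10 d20] dE] : q %= r ^+ n.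
  by rewrite /eqp -(dvdp_pexp2r q _ m0) -(dvdp_pexp2r (r ^+ n) _ m0).
exists (d1^-1 * d2); split; rewrite ?mulf_neq0 ?invr_eq0 //.
by rewrite -scalerA -dE scalerA mulVf ?scale1r.
Qed.

Lemma coef_comp_scaleX p (z : K) i : (p \Po (z *: 'X))`_i = p`_i * z ^+ i.
Proof.
rewrite coef_comp_poly; under eq_bigr => j _ do rewrite exprZn coefZ coefXn.
have [lt_i|le_i] := ltnP i (size p).
  rewrite (bigD1 (Ordinal lt_i)) //= eqxx mulr1 big1 ?addr0 // => j.
  by rewrite -val_eqE /= eq_sym => /negPf->; rewrite !mulr0.
rewrite nth_default // mul0r big1 // => j _.
by rewrite gtn_eqF ?mulr0 // (leq_trans (ltn_ord j)).
Qed.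

Lemma common_power_pattern m n k rho (z : K) r (c d : K) : (0 < m)%N -> (0 < n)%N ->
  coprime m n -> c != 0 -> d != 0 -> r != 0 -> rho.-primitive_root z ->
  (forall i, (c *: r ^+ m)`_i != 0 -> i = k * m %[mod rho]) ->
  (forall i, (d *: r ^+ n)`_i != 0 -> i = k * n %[mod rho]) ->
  forall i, r`_i != 0 -> i = k %[mod rho].
Proof.
move=> m0 n0 cop c0 d0 r0 zP pm pn.
have z0 : z != 0.
  apply: contraTneq (oner_neq0 K) => z0; rewrite -(prim_expr_order zP) z0.
  by rewrite expr0n gtn_eqF ?(prim_order_gt0 zP) // eqxx.
have pat f l : (forall i, f`_i != 0 -> i = l %[mod rho]) ->
    f \Po (z *: 'X) = z ^+ l *: f.
  move=> pf; apply/polyP=> i; rewrite coef_comp_scaleX coefZ mulrC.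
  have [->|/pf il] := eqVneq (f`_i) 0; first by rewrite !mulr0.
  by congr (_ * _); apply/eqP; rewrite (eq_prim_root_expr zP) il.
have unZ (x : K) l f : x != 0 -> (x *: f) \Po (z *: 'X) = z ^+ l *: (x *: f) ->
    f \Po (z *: 'X) = z ^+ l *: f.
  move=> x0; rewrite comp_polyZ [z ^+ l *: _]scalerA [z ^+ l * x]mulrC -scalerA.
  by apply: scalerI.
move: (unZ _ _ _ c0 (pat _ _ pm)) (unZ _ _ _ d0 (pat _ _ pn)).
rewrite !rmorphXn /=; set r' := r \Po _ => rm rn.
have [[u w] /= uw] : exists u, (u.1 * n - u.2 * m = 1)%N.
  by apply/coprimeP; rewrite // coprime_sym.
have {}uw : (n * u = (m * w).+1)%N by lia.
have : r' ^+ (n * u) = r' * r' ^+ (m * w) by rewrite uw exprS.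
rewrite !exprM rm rn !exprZn -!exprM uw exprS => E.
have r'E : r' = z ^+ k *: r.
  have nz : z ^+ (k * m * w) *: r ^+ (m * w) != 0.
    by rewrite scaler_eq0 negb_or !expf_neq0.
  apply: (mulIf nz); rewrite -E -scalerAl -scalerAr scalerA -exprD.
  by congr (z ^+ _ *: _); rewrite -!mulnA uw mulnS.
move=> i ri; apply/eqP; rewrite -(eq_prim_root_expr zP); apply/eqP.
by apply: (mulfI ri); rewrite -coef_comp_scaleX -/r' r'E coefZ mulrC.
Qed.

End CommonPower.

Section PrimRoot.
Variables (K : closedFieldType) (K0 : [pchar K] =i pred0).

Lemma prim_root_exists n : (0 < n)%N -> exists z : K, n.-primitive_root z.
Proof.
pose p : {poly K} := 'X^n - 1; have [r Dp] := closed_field_poly_normal p.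
move=> n_gt0; rewrite (monicP _) ?monicXnsubC // scale1r in Dp.
have rn1: all n.-unity_root r by apply/allP=> z; rewrite -root_prod_XsubC -Dp.
have sz_r: (n < (size r).+1)%N.
  by rewrite -(size_prod_XsubC r id) -Dp size_XnsubC.
have [|z] := hasP (has_prim_root n_gt0 rn1 _ sz_r); last by exists z.
by rewrite -separable_prod_XsubC -Dp separable_Xn_sub_1 // natK_eq0 -?lt0n.
Qed.

End PrimRoot.

Section Corners.
Variables (K : closedFieldType) (K0 : [pchar K] =i pred0).
Implicit Types (p q r t e f g : {poly K}) (v tau eps : int) (m n k : nat).

Lemma wronsk_reduce m v tau eps r (c ka : K) t e : (0 < m)%N ->
  c != 0 -> ka != 0 -> r != 0 -> e != 0 ->
  wronsk (m%:Z * v) tau (c *: r ^+ m) t = ka *: e ->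
  wronsk (m%:Z * v) eps (c *: r ^+ m) e = 0 ->
  exists2 e1, e1 != 0 & wronsk v tau r t = e1 /\
    wronsk v (eps - m.-1%:Z * v) r e1 = 0.
Proof.
move=> m0 c0 ka0 r0 e0; rewrite !wronsk_expl //; set e1 := wronsk v tau r t.
have mc0 : m%:R * c != 0 by rewrite mulf_neq0 // (natK_eq0 K0) -lt0n.
move=> We /eqP; rewrite scaler_eq0 (negPf mc0) mulf_eq0 expf_eq0 (negPf r0) andbF /=.
move=> /eqP W0; exists e1.
  by apply: contraNneq e0 => E; move/eqP: We;
     rewrite E mulr0 scaler0 eq_sym scaler_eq0 (negPf ka0).
split=> //; have rm0 : r ^+ m.-1 != 0 by rewrite expf_neq0.
apply: (@wronsk_divl _ v (v * m.-1%:Z) _ r (r ^+ m.-1)) => //.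
  by apply: wronskX; rewrite wronsk_self.
rewrite mulrC addrC subrK; have <- : ka / (m%:R * c) *: e = r ^+ m.-1 * e1.
  by rewrite mulrC -scalerA -We scalerA mulVf ?scale1r.
by rewrite wronskZ W0 scaler0.
Qed.

Lemma unique_root_mup r : (1 < size r)%N ->
  (forall x y, root r x -> root r y -> x = y) ->
  exists x, mup x r = (size r).-1.
Proof.
have [s] := closed_field_poly_normal r; set c := lead_coef r => rE sr uniq.
have c0 : c != 0 by rewrite lead_coef_eq0 -size_poly_gt0; apply: ltn_trans sr.
have szr : size r = (size s).+1 by rewrite rE size_scale // size_prod_XsubC.
have rt z : (z \in s) -> root r z by rewrite rE rootZ // root_prod_XsubC.
case: s rE szr rt => [|x s] rE szr rt; first by rewrite szr in sr.
exists x; rewrite szr rE -mul_polyC mupMr ?rootC // mu_prod_XsubC.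
apply/eqP; rewrite -all_count; apply/allP=> z zs /=.
by apply/eqP; apply: uniq; apply: rt; rewrite // mem_head.
Qed.

Lemma full_mup r x : r != 0 -> mup x r = (size r).-1 ->
  r = lead_coef r *: ('X - x%:P) ^+ (size r).-1.
Proof.
move=> r0 mx; have [q qx rE] := mup_dec x r0.
have q0 : q != 0 by apply: contraNneq qx => ->; rewrite horner0.
have /size_poly1P[c c0 qE] : size q == 1%N.
  move: (congr1 (fun p : {poly K} => size p) rE) => /=; rewrite mx.
  rewrite size_mul ?expf_neq0 ?polyXsubC_eq0 // size_exp_XsubC addSn /=.
  move: (sizeS r0) (sizeS q0) => -> ->; move: (size _).-1 (size _).-1 => A B /eqP.
  by rewrite addnS eqSS; lia.
rewrite -mx {1}rE qE mulrC mul_polyC; congr (_ *: _).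
by rewrite rE qE lead_coefM lead_coefC lead_coef_exp lead_coefXsubC expr1n mul1r.
Qed.

Lemma full_mup_pattern d rho r x : (1 < rho)%N -> size r = d.+1 ->
  mup x r = d -> (forall i, r`_i != 0 -> i = d %[mod rho]) ->
  forall i, (i < d)%N -> r`_i = 0.
Proof.
case: d => [|d] // rho1 sr mx pat i lt_i.
have r0 : r != 0 by rewrite -size_poly_gt0 sr.
have rE := full_mup r0; rewrite sr in rE; move/(_ _ mx): rE => /= rE.
have l0 : lead_coef r != 0 by rewrite lead_coef_eq0.
have cE : (('X - x%:P) ^+ d.+1)`_d = - (x *+ d.+1).
  have := @coefPn_prod_XsubC _ (nseq d.+1 x); rewrite size_nseq => /(_ isT).
  by rewrite !big_nseq iter_mulr mulr1 iter_addr addr0.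
have : r`_d == 0.
  apply: contraT => /pat /eqP; rewrite -addn1 -[X in X == _ %[mod _]]addn0.
  by rewrite eqn_modDl mod0n modn_small.
rewrite rE coefZ cE mulf_eq0 (negPf l0) oppr_eq0 /= -mulr_natr mulf_eq0 (natK_eq0 K0) orbF.
by move/eqP=> x0; rewrite rE x0 subr0 coefZ coefXn ltn_eqF ?mulr0.
Qed.

Lemma modn_gap d i rho : (i < d)%N -> i = d %[mod rho] -> (rho <= d - i)%N.
Proof.
move=> lt_i /eqP; rewrite eq_sym eqn_mod_dvd ?(ltnW lt_i) //.
by apply: dvdn_leq; rewrite subn_gt0.
Qed.

Lemma quartic_corner (rho : nat) (s : int) tau eps r t e :
  0 < s -> s < rho%:Z -> coprimez rho%:Z s -> size r = 5%N ->
  (forall i, r`_i != 0 -> i = 4 %[mod rho]) -> e != 0 ->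
  wronsk (4 * (rho%:Z - s)) tau r t = e ->
  wronsk (4 * (rho%:Z - s)) eps r e = 0 ->
  tau - eps = 3 * s - 5 * rho%:Z ->
  forall i, (i < 4)%N -> r`_i = 0.
Proof.
move=> s0 s_rho cop sr pat e0 We W0 w i0 lt_i0.
have r0 : r != 0 by rewrite -size_poly_gt0 sr.
have rho1 : (1 < rho)%N by lia.
apply/eqP; apply: contraT => ri0.
have rho4 : (rho <= 4)%N by have := modn_gap lt_i0 (pat _ ri0); lia.
have nfull x : (mup x r < 4)%N.
  have le4 : (mup x r <= 4)%N.
    rewrite leqNgt; apply/negP; rewrite mup_geq // => /(dvdp_leq r0).
    by rewrite size_exp_XsubC sr.
  rewrite ltn_neqAle le4 andbT; apply: contraNneq ri0 => mx.
  by rewrite (full_mup_pattern rho1 sr mx pat).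
have [x mx] : exists x, mup x r = (size r).-1; last first.
  by have := nfull x; rewrite mx sr.
apply: unique_root_mup; first by rewrite sr.
apply: (wronsk_one_root K0 _ r0 e0 We W0); first by lia.
  move=> x z rx; rewrite w; have := nfull x; have : (0 < mup x r)%N.
    by rewrite -XsubC_dvd // dvdp_XsubCl.
  have rho3 : rho = 3 -> mup x r != 2%N.
    move=> E; apply/negP=> /eqP m2; subst rho.
    have r2 : r`_2 = 0 by apply/eqP; apply: contraT => /pat.
    have r3 : r`_3 = 0 by apply/eqP; apply: contraT => /pat.
    have r00 : r`_0 = 0 by apply/eqP; apply: contraT => /pat.
    have rE : r = r`_4 *: 'X^4 + r`_1 *: 'X.
      apply/polyP=> i; rewrite coefD !coefZ coefXn coefX.
      case: i => [|[|[|[|[|i]]]]]; rewrite /= ?mulr0 ?mulr1 ?addr0 ?add0r //.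
      by rewrite nth_default // sr.
    have r1 : r`_1 != 0.
      by case: i0 lt_i0 ri0 => [|[|[|[|i]]]] //; rewrite ?r2 ?r3 ?r00 eqxx.
    have r4 : r`_4 != 0 by have := r0; rewrite -lead_coef_eq0 lead_coefE sr.
    have /dvdpP[q qE] : ('X - x%:P) ^+ 2 %| r by rewrite -mup_geq // m2.
    have d0 : r^`().[x] = 0.
      
      rewrite qE derivM deriv_exp derivXsubC mul1r /= expr1.
      rewrite !(hornerXsubC, hornerD, hornerM, hornerMn, horner_exp) subrr.
      by rewrite !(mulr0, addr0).
    move: d0 (rx); rewrite rootE {1 2}rE derivD !derivZ derivXn derivX.
    rewrite !(hornerD, hornerZ, hornerMn, hornerXn, hornerX, hornerC) mulr1.
    move=> d0 /eqP rx0.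
    have x4 : r`_4 * x ^+ 4 *+ 3 = 0.
      transitivity (x * (r`_4 * (x ^+ 3 *+ 4) + r`_1) - (r`_4 * x ^+ 4 + r`_1 * x)).
        ring.
      by rewrite d0 rx0 mulr0 subr0.
    move/eqP: x4; rewrite -mulr_natr mulf_eq0 (natK_eq0 K0) orbF mulf_eq0 (negPf r4) expf_eq0 /=.
    move/eqP=> x0; move: d0; rewrite x0 expr0n /= !(mul0rn, mulr0, mul0r, add0r) => /eqP.
    by rewrite (negPf r1).
  move: (mup x r) rho3 => k; have : rho = 2 \/ rho = 3 \/ rho = 4 by lia.
  case=> [|[|]] E; subst rho => rho3 k0 k4 vz.
  - have s1 : s = 1 by lia.
    by subst s; lia.
  - have {}rho3 := rho3 erefl.
    have [|] : s = 1 \/ s = 2 by lia.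
      by move=> ?; subst s; lia.
    by move=> ?; subst s; lia.
  - have [|[|]] : s = 1 \/ s = 2 \/ s = 3 by lia.
    + by move=> ?; subst s; lia.
    + by move=> ?; subst s.
    + by move=> ?; subst s; lia.
move=> z; rewrite w sr /= => z2 vz; exfalso.
have : (rho%:Z - s) * z = 3 * s - 5 * rho%:Z by lia.
by nia.
Qed.

Lemma cubic_corner (rho : nat) (s : int) tau eps r t e :
  0 <= s -> s < rho%:Z -> coprimez rho%:Z s -> size r = 4%N ->
  (forall i, r`_i != 0 -> i = 3 %[mod rho]) -> e != 0 ->
  wronsk (rho%:Z + 3 * s) tau r t = e ->
  wronsk (rho%:Z + 3 * s) eps r e = 0 ->
  tau - eps = rho%:Z - 2 * s ->
  exists2 x, r = lead_coef r *: ('X - x%:P) ^+ 3 & (1 < rho)%N -> x = 0.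
Proof.
move=> s0 s_rho cop sr pat e0 We W0 w.
have r0 : r != 0 by rewrite -size_poly_gt0 sr.
have [x mx] : exists x, mup x r = (size r).-1; last first.
  exists x; first by have := full_mup r0 mx; rewrite sr.
  have rE := full_mup r0 mx; rewrite sr in mx rE.
  move=> rho1; have := full_mup_pattern rho1 sr mx pat (ltn0Sn 2).
  rewrite rE coefZ -horner_coef0 horner_exp hornerXsubC => /eqP.
  by rewrite mulf_eq0 lead_coef_eq0 (negPf r0) expf_eq0 /= sub0r oppr_eq0 => /eqP.
have [i0 ri0|noi] := pickP (fun i : 'I_3 => r`_i != 0); last first.
  exists 0; rewrite sr; have -> : r = lead_coef r *: 'X^3.
    apply/polyP=> i; rewrite coefZ coefXn; have [lt_i|] := ltnP i 3.
      rewrite ltn_eqF // mulr0; apply/eqP; have := noi (Ordinal lt_i).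
      by move/negbT; rewrite negbK.
    rewrite leq_eqVlt => /predU1P[<-|lt_i]; first by rewrite mulr1 lead_coefE sr.
    by rewrite gtn_eqF // mulr0 nth_default // sr.
  by rewrite -mul_polyC mupMr ?rootC ?lead_coef_eq0 // -['X]subr0 mup_XsubCX eqxx.
have rho3 : (rho <= 3)%N by have := modn_gap (ltn_ord i0) (pat _ ri0); lia.
apply: unique_root_mup; first by rewrite sr.
apply: (wronsk_one_root K0 _ r0 e0 We W0); first by lia.
  move=> x z rx; rewrite w; have : (0 < mup x r)%N.
    by rewrite -XsubC_dvd // dvdp_XsubCl.
  move: (mup x r) => k k0; nia.
move=> z; rewrite w sr /= => z2 vz.
have : rho = 1 \/ rho = 2 \/ rho = 3 by lia.
case=> [|[|]] E; subst rho.
- have s1 : s = 0 by lia.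
  by subst s; exists 1%N.
- have [|] : s = 0 \/ s = 1 by lia.
    by move=> ?; subst s.
  by move=> ?; subst s; exists 0%N.
- have [|[|]] : s = 0 \/ s = 1 \/ s = 2 by lia.
  + by move=> ?; subst s.
  + by move=> ?; subst s; lia.
  + by move=> ?; subst s; lia.
Qed.

End Corners.

(** * Laurent polynomials and Newton polygons *)

(* The Laurent ring is handled through this interface: on [laurent K] itself
   a failing unification unfolds the monoid-algebra operations and is too slow. *)
Record laurentAlg (K : fieldType) := LaurentAlg {
  lalg :> comAlgType K;
  mon : int * nat -> lalg;
  coef : int * nat -> lalg -> K;
  supp : lalg -> seq (int * nat);
  monD : forall a b, mon a * mon b = mon (a + b);
  mon0 : mon 0 = 1;
  cfP : forall c P Q a, coef a (c *: P + Q) = c * coef a P + coef a Q;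
  cf_mon : forall a b, coef b (mon a) = (a == b)%:R;
  supp_uniq : forall P, uniq (supp P);
  mem_supp : forall P a, (a \in supp P) = (coef a P != 0);
  supp_sum : forall P, P = \sum_(a <- supp P) coef a P *: mon a }.

Section LinearExtension.
Variables (K : fieldType) (A : laurentAlg K) (V : lmodType K).
Implicit Types (P Q : A) (a b : int * nat) (f : int * nat -> V).

Lemma cf0 a : coef a (0 : A) = 0.
Proof. by have := cfP (-1) (0 : A) 0 a; rewrite scaler0 addr0 mulN1r addNr. Qed.

Lemma cfD a P Q : coef a (P + Q) = coef a P + coef a Q.
Proof. by have := cfP 1 P Q a; rewrite scale1r mul1r. Qed.

Lemma cfZ a c P : coef a (c *: P) = c * coef a P.
Proof. by have := cfP c P 0 a; rewrite cf0 !addr0. Qed.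

Lemma cfB a P Q : coef a (P - Q) = coef a P - coef a Q.
Proof. by rewrite cfD -scaleN1r cfZ mulN1r. Qed.

Lemma cf_sum a I (r : seq I) (F : I -> A) :
  coef a (\sum_(i <- r) F i) = \sum_(i <- r) coef a (F i).
Proof. exact: (big_morph (coef a) (cfD a) (cf0 a)). Qed.

Definition lext f P : V := \sum_(a <- supp P) coef a P *: f a.

Lemma lextw f (d : seq (int * nat)) P : uniq d -> {subset supp P <= d} ->
  lext f P = \sum_(a <- d) coef a P *: f a.
Proof.
move=> Ud sub; rewrite [RHS](bigID (fun a => a \in supp P)) /= addrC big1 ?add0r.
  rewrite -big_filter; apply: perm_big; apply: uniq_perm.
  - exact: supp_uniq.
  - exact: filter_uniq.
  - by move=> a; rewrite mem_filter; case: (boolP (a \in supp P)) => // /sub->.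
by move=> a; rewrite mem_supp negbK => /eqP->; rewrite scale0r.
Qed.

Lemma lext_is_linear f : linear (lext f).
Proof.
move=> c P Q; set d := undup (supp P ++ supp Q ++ supp (c *: P + Q)).
have Ud : uniq d := undup_uniq _.
have sub : [/\ {subset supp P <= d}, {subset supp Q <= d}
    & {subset supp (c *: P + Q) <= d}].
  by split=> a aP; rewrite mem_undup !mem_cat aP ?orbT.
case: sub => sP sQ sS; rewrite (lextw f Ud sP) (lextw f Ud sQ) (lextw f Ud sS).
rewrite scaler_sumr -big_split /=.
by apply: eq_bigr => a _; rewrite cfP scalerDl scalerA.
Qed.
HB.instance Definition _ f := GRing.isLinear.Build K A V *:%R (lext f) (lext_is_linear f).

Lemma lext_mon f a : lext f (mon A a) = f a.
Proof.
rewrite (@lextw f [:: a]) // => [|b].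
  by rewrite big_seq1 cf_mon eqxx scale1r.
by rewrite mem_supp cf_mon inE [b == a]eq_sym; case: (a == b); rewrite ?eqxx.
Qed.

Lemma linear_lext (g : {linear A -> V}) P : g P = lext (fun a => g (mon A a)) P.
Proof.
by rewrite {1}[P]supp_sum linear_sum; apply: eq_bigr => a _; rewrite linearZ.
Qed.

Lemma eq_lext f g P : (forall a, coef a P != 0 -> f a = g a) -> lext f P = lext g P.
Proof.
by move=> fg; apply: eq_big_seq => a aP; rewrite fg // -mem_supp.
Qed.

Lemma linear_eq_mon (g h : {linear A -> V}) :
  (forall a, g (mon A a) = h (mon A a)) -> g =1 h.
Proof. by move=> gh P; rewrite linear_lext [RHS]linear_lext; apply: eq_lext. Qed.

End LinearExtension.

Section Bracket.
Variables (K : fieldType) (A : laurentAlg K).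
Implicit Types (P Q T : A) (a b : int * nat).
Local Notation mon := (mon A).

Lemma lextM (B : comAlgType K) (f : int * nat -> B) P Q :
  (forall a b, f (a + b) = f a * f b) -> lext f (P * Q) = lext f P * lext f Q.
Proof.
move=> fD; rewrite {1}[P]supp_sum {1}[Q]supp_sum !mulr_suml linear_sum /=.
apply: eq_bigr => a _; rewrite !mulr_sumr linear_sum /=; apply: eq_bigr => b _.
rewrite -!scalerAl -!scalerAr !linearZ /= monD lext_mon fD.
by rewrite !scalerA mulrC.
Qed.

Lemma mulE P Q : P * Q =
  \sum_(a <- supp P) \sum_(b <- supp Q) (coef a P * coef b Q) *: mon (a + b).
Proof.
rewrite {1}[P]supp_sum {1}[Q]supp_sum !mulr_suml.
apply: eq_bigr => a _; rewrite !mulr_sumr; apply: eq_bigr => b _.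
by rewrite -scalerAl -scalerAr scalerA monD.
Qed.

Definition ldx : A -> A := lext (fun a => a.1%:~R *: mon (a.1 - 1, a.2)).
Definition ldy : A -> A := lext (fun a => a.2%:R *: mon (a.1, a.2.-1)).
HB.instance Definition _ := GRing.Linear.on ldx.
HB.instance Definition _ := GRing.Linear.on ldy.

Definition derivation (D : A -> A) := forall P Q, D (P * Q) = D P * Q + P * D Q.

Lemma derivation_mon (D : {linear A -> A}) :
  (forall a b, D (mon a * mon b) = D (mon a) * mon b + mon a * D (mon b)) ->
  derivation D.
Proof.
move=> DM P Q; rewrite [P]supp_sum mulr_suml !linear_sum /= !mulr_suml -big_split.
apply: eq_bigr => a _; rewrite [Q]supp_sum mulr_sumr !linear_sum /= !mulr_sumr.
rewrite -big_split; apply: eq_bigr => b _ /=; move: (coef a _) (coef b _) => c d.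
rewrite -!scalerAl -!scalerAr !linearZ /= DM -!scalerAl !scalerDr.
by rewrite -!scalerAr !scalerA [d * c]mulrC.
Qed.

Lemma ldx_mon a : ldx (mon a) = a.1%:~R *: mon (a.1 - 1, a.2).
Proof. exact: lext_mon. Qed.

Lemma ldy_mon a : ldy (mon a) = a.2%:R *: mon (a.1, a.2.-1).
Proof. exact: lext_mon. Qed.

Lemma ldx_derivation : derivation ldx.
Proof.
apply: derivation_mon => -[i j] [i' j'] /=.
rewrite monD !ldx_mon -scalerAl -scalerAr !monD /=.
have -> : ((i - 1, j) + (i', j') : int * nat) = (i + i' - 1, (j + j')%N).
  by congr pair; rewrite /=; ring.
have -> : ((i, j) + (i' - 1, j') : int * nat) = (i + i' - 1, (j + j')%N).
  by congr pair; rewrite /=; ring.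
by rewrite intrD scalerDl.
Qed.

Lemma ldy_derivation : derivation ldy.
Proof.
apply: derivation_mon => -[i j] [i' j'] /=.
rewrite monD !ldy_mon -scalerAl -scalerAr !monD /= natrD scalerDl.
congr (_ + _).
  by case: j => [|j] /=; rewrite ?scale0r //; congr (_ *: mon (_, _)).
case: j' => [|j'] /=; rewrite ?scale0r //; congr (_ *: mon (_, _)).
exact: (congr1 predn (addnS j j')).
Qed.

Lemma derivationX (D : A -> A) : derivation D -> forall P n,
  D (P ^+ n) = n%:R * (D P * P ^+ n.-1).
Proof.
move=> DM P.
have D1 : D 1 = 0.
  have := DM 1 1; rewrite !mulr1 mul1r => D11.
  by apply: (addrI (D 1)); rewrite addr0 -D11.
elim=> [|n IHn]; first by rewrite expr0 D1 mul0r.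
rewrite exprS DM IHn; case: n {IHn} => [|n].
  by rewrite mul0r mulr0 addr0 mul1r.
by rewrite /= exprS -[n.+2]addn1 natrD; ring.
Qed.

Definition lbr P Q : A := ldx P * ldy Q - ldy P * ldx Q.

Lemma lbrC P Q : lbr P Q = - lbr Q P.
Proof. by rewrite /lbr; ring. Qed.

Lemma lbr_linear P : linear (lbr P).
Proof.
move=> c Q T; rewrite /lbr.
have -> : ldx (c *: Q + T) = c *: ldx Q + ldx T by exact: linearP.
have -> : ldy (c *: Q + T) = c *: ldy Q + ldy T by exact: linearP.
by rewrite !mulrDr -!scalerAr scalerBr opprD addrACA.
Qed.
HB.instance Definition _ P := GRing.isLinear.Build K A A *:%R (lbr P) (lbr_linear P).

Lemma lbrZl P c Q : lbr (c *: P) Q = c *: lbr P Q.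
Proof. by rewrite lbrC linearZ /= -scalerN -lbrC. Qed.

Lemma lbrM P Q T : lbr P (Q * T) = lbr P Q * T + Q * lbr P T.
Proof.
rewrite /lbr ldx_derivation ldy_derivation.
by move: (ldx P) (ldy P) (ldx Q) (ldy Q) (ldx T) (ldy T) => *; ring.
Qed.

Lemma lbrXr P Q n : lbr P (Q ^+ n) = n%:R * (Q ^+ n.-1 * lbr P Q).
Proof.
rewrite /lbr (derivationX ldx_derivation) (derivationX ldy_derivation).
by move: (ldx P) (ldy P) (ldx Q) (ldy Q) => *; ring.
Qed.

Lemma lbrPP P : lbr P P = 0.
Proof. by rewrite /lbr mulrC subrr. Qed.

Definition bmon a b : A :=
  (a.1 * b.2%:Z - a.2%:Z * b.1)%:~R *: mon (a.1 + b.1 - 1, (a.2 + b.2).-1).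

Lemma lbr_mon a b : lbr (mon a) (mon b) = bmon a b.
Proof.
case: a b => [i j] [i' j']; rewrite /lbr !ldx_mon !ldy_mon /=.
rewrite -!scalerAl -!scalerAr !scalerA !monD /=.
have -> : (i%:~R * j'%:R) *: mon ((i - 1, j) + (i', j'.-1) : int * nat)
    = (i%:~R * j'%:R) *: mon (i + i' - 1, (j + j').-1).
  case: j' => [|j']; first by rewrite mulr0 !scale0r.
  by rewrite addnS; congr (_ *: mon (_, _)); rewrite /=; ring.
have -> : (j%:R * i'%:~R) *: mon ((i, j.-1) + (i' - 1, j') : int * nat)
    = (j%:R * i'%:~R) *: mon (i + i' - 1, (j + j').-1).
  case: j => [|j]; first by rewrite mul0r !scale0r.
  by rewrite addSn; congr (_ *: mon (_, _)); rewrite /=; ring.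
by rewrite /bmon /= intrB !intrM -!pmulrn scalerBl.
Qed.

Lemma lbrE P Q : lbr P Q =
  \sum_(a <- supp P) \sum_(b <- supp Q) (coef a P * coef b Q) *: bmon a b.
Proof.
rewrite {1}[P]supp_sum {1}[Q]supp_sum /lbr !linear_sum /= !mulr_suml.
rewrite -sumrB; apply: eq_bigr => a _; rewrite !mulr_sumr -sumrB.
apply: eq_bigr => b _; rewrite -lbr_mon /lbr scalerBr !linearZ /=.
rewrite -!scalerAl -!scalerAr !scalerA.
by rewrite scalerN.
Qed.

End Bracket.

Section Grading.
Variables (K : fieldType) (A : laurentAlg K).
Implicit Types (P Q T : A) (a b : int * nat) (d : int * int) (k l : int).
Local Notation mon := (mon A).

Definition bnd d k P := forall a, coef a P != 0 -> val_at d a <= k.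

(* The part of [P] of [d]-degree [k], dehomogenized by [x := 1]. *)
Definition hc d k : A -> {poly K} :=
  lext (fun a => if val_at d a == k then 'X^(a.2) else 0).
HB.instance Definition _ d k := GRing.Linear.on (hc d k).

Lemma val_atD d a b : val_at d (a + b) = val_at d a + val_at d b.
Proof. by case: a b => [i j] [i' j']; rewrite /val_at /= PoszD; ring. Qed.

Lemma bndW d k l P : k <= l -> bnd d k P -> bnd d l P.
Proof. by move=> kl bP a /bP/le_trans->. Qed.

Lemma bnd0 d k : bnd d k 0.
Proof. by move=> a; rewrite cf0 eqxx. Qed.

Lemma bndD d k P Q : bnd d k P -> bnd d k Q -> bnd d k (P + Q).
Proof.
move=> bP bQ a; rewrite cfD; have [a0|/bP//] := eqVneq (coef a P) 0.
by rewrite a0 add0r => /bQ.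
Qed.

Lemma bndZ d k c P : bnd d k P -> bnd d k (c *: P).
Proof. by move=> bP a; rewrite cfZ mulf_eq0 negb_or => /andP[_ /bP]. Qed.

Lemma bndB d k P Q : bnd d k P -> bnd d k Q -> bnd d k (P - Q).
Proof. by move=> bP bQ; rewrite -scaleN1r; apply/bndD/bndZ. Qed.

Lemma bnd_mon d k a : val_at d a <= k -> bnd d k (mon a).
Proof.
by move=> ak b; rewrite cf_mon; case: (eqVneq a b) => [<-|]; rewrite ?eqxx.
Qed.

Lemma bnd_sum d k (I : eqType) (r : seq I) (F : I -> A) :
  (forall i, i \in r -> bnd d k (F i)) -> bnd d k (\sum_(i <- r) F i).
Proof.
move=> bF; rewrite big_seq; apply: big_ind => //; first exact: bnd0.
exact: bndD.
Qed.

Lemma bnd_lext d k (f : int * nat -> A) P :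
  (forall a, coef a P != 0 -> bnd d k (f a)) -> bnd d k (lext f P).
Proof.
by move=> bf; apply: bnd_sum => a; rewrite mem_supp => aP; apply/bndZ/bf.
Qed.

Lemma bndM d k l P Q : bnd d k P -> bnd d l Q -> bnd d (k + l) (P * Q).
Proof.
move=> bP bQ; rewrite mulE; apply: bnd_sum => a; rewrite mem_supp => /bP aP.
apply: bnd_sum => b; rewrite mem_supp => /bQ bQ'; apply: bndZ; apply: bnd_mon.
by rewrite val_atD lerD.
Qed.

Lemma bnd1 d : bnd d 0 1.
Proof. by rewrite -(mon0 A); apply: bnd_mon; rewrite /val_at /= !mulr0. Qed.

Lemma bndX d k P n : bnd d k P -> bnd d (n%:Z * k) (P ^+ n).
Proof.
move=> bP; elim: n => [|n IHn]; first by rewrite mul0r expr0; apply: bnd1.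
by rewrite exprS intS mulrDl mul1r; apply: bndM.
Qed.

Lemma bnd_lbr d k l P Q : bnd d k P -> bnd d l Q ->
  bnd d (k + l - d.1 - d.2) (lbr P Q).
Proof.
move=> bP bQ; rewrite lbrE; apply: bnd_sum => a; rewrite mem_supp => /bP aP.
apply: bnd_sum => b; rewrite mem_supp => /bQ bQ'; apply: bndZ.
case: a b aP bQ' => [i j] [i' j']; rewrite /bmon /val_at /= => aP bQ'.
have [/eqP|jj] := posnP (j + j').
  by rewrite addn_eq0 => /andP[/eqP-> /eqP->]; rewrite mulr0 mul0r subr0 scale0r; apply: bnd0.
apply: bndZ; apply: bnd_mon; rewrite /val_at /=.
have -> : (j + j').-1%:Z = j%:Z + j'%:Z - 1 by lia.
nia.
Qed.

Lemma hc_mon d k a : hc d k (mon a) = if val_at d a == k then 'X^(a.2) else 0.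
Proof. exact: lext_mon. Qed.

Lemma hc_out d k l P : bnd d k P -> k < l -> hc d l P = 0.
Proof.
move=> bP kl; rewrite /hc /lext big_seq big1 // => a; rewrite mem_supp => /bP ak.
by rewrite lt_eqF ?scaler0 // (le_lt_trans ak).
Qed.

Lemma hcM d k l P Q : bnd d k P -> bnd d l Q ->
  hc d (k + l) (P * Q) = hc d k P * hc d l Q.
Proof.
move=> bP bQ; rewrite mulE linear_sum /= [hc d k P]/lext mulr_suml.
apply: eq_big_seq => a; rewrite mem_supp => /bP aP.
rewrite linear_sum /= [hc d l Q]/lext mulr_sumr.
apply: eq_big_seq => b; rewrite mem_supp => /bQ bQ'.
rewrite linearZ /= hc_mon val_atD -scalerAl -scalerAr scalerA; congr (_ *: _).
have [ak|nak] := eqVneq (val_at d a) k.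
  rewrite ak (inj_eq (addrI k)); case: ifP => _; last by rewrite mulr0.
  by rewrite -exprD.
rewrite mul0r; case: eqP => // E; exfalso; move/eqP: nak; lia.
Qed.

Lemma hc1 d : hc d 0 1 = 1.
Proof. by rewrite -(mon0 A) hc_mon /val_at /= !mulr0 eqxx. Qed.

Lemma hcX d k P n : bnd d k P -> hc d (n%:Z * k) (P ^+ n) = hc d k P ^+ n.
Proof.
move=> bP; elim: n => [|n IHn]; first by rewrite mul0r !expr0 hc1.
by rewrite !exprS intS mulrDl mul1r hcM ?IHn //; apply: bndX.
Qed.

Lemma hc_lbr d k l P Q : bnd d k P -> bnd d l Q ->
  d.1%:~R *: hc d (k + l - d.1 - d.2) (lbr P Q) = wronsk k l (hc d k P) (hc d l Q).
Proof.
move=> bP bQ; rewrite lbrE (linear_sum (hc d _)) scaler_sumr /wronsk.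
rewrite [hc d k P]/lext [hc d l Q]/lext !linear_sum /= !mulr_suml !scaler_sumr -sumrB.
apply: eq_big_seq => a; rewrite mem_supp => /bP aP.
rewrite (linear_sum (hc d _)) !mulr_sumr !scaler_sumr -sumrB.
apply: eq_big_seq => b; rewrite mem_supp => /bQ bQ'.
rewrite !derivZ (linearZZ (hc d _)) /bmon (linearZZ (hc d _)) /= hc_mon.
rewrite -!scalerAl -!scalerAr !scalerA; move: (coef a P) (coef b Q) => c c'.
case: a b aP bQ' => [i j] [i' j']; rewrite /val_at /= => aP bQ'.
set v := d.1 * i + _ in aP *; set v' := d.1 * i' + _ in bQ' *.
have [/eqP|jj] := posnP (j + j').
  rewrite addn_eq0 => /andP[/eqP-> /eqP->].
  rewrite mulr0 mul0r subr0 !mulr0 scale0r !(fun_if (@deriv _)) !deriv0 !derivC.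
  by rewrite !if_same mulr0 mul0r !scaler0 subr0.
have -> : d.1 * (i + i' - 1) + d.2 * (j + j').-1%:Z = v + v' - d.1 - d.2.
  have -> : (j + j').-1%:Z = j%:Z + j'%:Z - 1 by lia.
  by rewrite /v /v'; ring.
have -> : (v + v' - d.1 - d.2 == k + l - d.1 - d.2) = (v == k) && (v' == l).
  by apply/eqP/andP => [E|[/eqP-> /eqP->]//]; split; apply/eqP; lia.
have [vk|_] := eqVneq v k; last by rewrite /= !deriv0 !mul0r !scaler0 subr0.
have [vl|_] := eqVneq v' l; last by rewrite /= !deriv0 !mulr0 !scaler0 subr0.
rewrite /= !derivXn.
have -> : 'X^j * ('X^(j'.-1) *+ j') = j'%:R *: 'X^((j + j').-1) :> {poly K}.
  case: j' {vl v' bQ'} jj => [|j'] jj; first by rewrite mulr0n mulr0 scale0r.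
  by rewrite mulrnAr -exprD addnS scaler_nat.
have -> : ('X^(j.-1) *+ j)%R * 'X^j' = j%:R *: 'X^((j + j').-1) :> {poly K}.
  case: j {vk v aP} jj => [|j] jj; first by rewrite mulr0n mul0r scale0r.
  by rewrite mulrnAl -exprD addSn scaler_nat.
rewrite !scalerA -scalerBl; congr (_ *: _).
by rewrite -vk -vl /v /v' !(intrD, intrM, intrB) -!pmulrn; ring.
Qed.

Lemma coef_hc d k P a : d.1 != 0 -> val_at d a = k -> (hc d k P)`_(a.2) = coef a P.
Proof.
move=> d0 ak; rewrite [hc d k P]/lext coef_sum [in RHS](supp_sum P) cf_sum.
apply: eq_bigr => b _; rewrite coefZ cfZ cf_mon; congr (_ * _).
have [->|ne] := eqVneq b a; first by rewrite ak eqxx coefXn eqxx.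
case: eqP => [bk|]; last by rewrite coef0.
rewrite coefXn; case: eqP => // E; case/negP: ne; apply/eqP.
case: a b ak bk E => [i j] [i' j'] /= ak bk E; rewrite {}E in ak *; congr pair.
by move: bk; rewrite -ak /val_at /= => /addIr /(mulfI d0).
Qed.

Lemma hc_coef d k P j : (hc d k P)`_j != 0 ->
  exists a, [/\ coef a P != 0, val_at d a = k & a.2 = j].
Proof.
rewrite [hc d k P]/lext coef_sum => nz.
have /hasP[a aP] : has (fun a =>
    (coef a P *: (if val_at d a == k then 'X^(a.2) else 0))`_j != 0) (supp P).
  by apply: contraR nz => /hasPn nz; rewrite big_seq big1 // => a /nz; rewrite negbK => /eqP.
rewrite coefZ mulf_eq0 negb_or.
have [ak|_] := eqVneq (val_at d a) k; last by rewrite coef0 eqxx andbF.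
rewrite coefXn; have [->|_] := eqVneq j a.2; last by rewrite eqxx andbF.
by case/andP=> ca _; exists a.
Qed.

Lemma bnd_pred d k P : d.1 != 0 -> bnd d k P -> hc d k P = 0 -> bnd d (k - 1) P.
Proof.
move=> d0 bP h0 a aP; have := bP a aP; rewrite le_eqVlt => /predU1P[ak|]; last by lia.
by rewrite -(coef_hc _ d0 ak) h0 coef0 eqxx in aP.
Qed.

Lemma top_exists d P : d.1 != 0 -> P != 0 -> exists k, bnd d k P /\ hc d k P != 0.
Proof.
move=> d0 P0.
have s0 : supp P != [::].
  by apply: contraNneq P0 => s0; rewrite [P]supp_sum s0 big_nil.
have [a aP /allP amax] := seq_argmin (fun a => - val_at d a) s0.
exists (val_at d a); split.
  by move=> b; rewrite -mem_supp => /amax; rewrite lerN2.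
apply: contraTneq aP => h0; rewrite mem_supp negbK.
by rewrite -(coef_hc P d0 (erefl (val_at d a))) h0 coef0.
Qed.

Lemma hc_top d k l P : bnd d k P -> bnd d l P -> hc d k P != 0 -> hc d l P = 0 -> k < l.
Proof.
move=> bk bl hk hl; rewrite ltNge; apply/negP; rewrite le_eqVlt => /predU1P[E|lk].
  by rewrite -E hl eqxx in hk.
by rewrite (hc_out bl lk) eqxx in hk.
Qed.

End Grading.

Section Chain.
Variables (K : fieldType) (K0 : [pchar K] =i pred0) (A : laurentAlg K).
Implicit Types (P Q T D E : A) (d : int * int).

(* Starting from [T = Q], one subtracts suitable multiples of powers of [P]
   from powers of [T] until the leading forms of [P] and [T] stop commuting;
   the defect [a + tau - rho - sigma - delta - eps] decreases at each step. *)
Lemma chain d (a : nat) (delta : int) P D (d0 : K) : d.1 != 0 -> (0 < a)%N ->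
  bnd d a%:Z P -> hc d a%:Z P != 0 -> bnd d delta D -> hc d delta D = d0%:P ->
  d0 != 0 -> forall n T E tau eps, bnd d tau T -> hc d tau T != 0 ->
  bnd d eps E -> hc d eps E != 0 -> lbr P T = D * E ->
  wronsk a%:Z eps (hc d a%:Z P) (hc d eps E) = 0 ->
  a%:Z + tau - d.1 - d.2 - delta - eps < n%:Z ->
  exists t e tau' eps', [/\ e != 0, wronsk a%:Z tau' (hc d a%:Z P) t = (d.1%:~R * d0) *: e,
    wronsk a%:Z eps' (hc d a%:Z P) e = 0 & tau' - eps' = delta + d.1 + d.2 - a%:Z].
Proof.
move=> rho0 a0 bP p0 bD hD d00; set p := hc d a%:Z P in p0 *.
elim=> [|n IHn] T E tau eps bT t0 bE e0 PT We lt_n.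
  have lt : a%:Z + tau - d.1 - d.2 < delta + eps by lia.
  have /eqP := hc_out (bnd_lbr bP bT) lt.
  by rewrite PT hcM // hD mulf_eq0 polyC_eq0 (negPf d00) (negPf e0).
have hPT := hc_lbr bP bT; rewrite -/p PT in hPT.
have bDE := bndM bD bE; have hDE := hcM bD bE; rewrite hD in hDE.
have le_def : delta + eps <= a%:Z + tau - d.1 - d.2.
  rewrite leNgt; apply/negP => /(hc_out (bnd_lbr bP bT)) /eqP.
  by rewrite PT hDE mulf_eq0 polyC_eq0 (negPf d00) (negPf e0).
move: le_def; rewrite le_eqVlt => /predU1P[def0|def1].
  exists (hc d tau T), (hc d eps E), tau, eps; split=> //; last by lia.
  by rewrite -hPT -def0 hDE mul_polyC scalerA.
rewrite (hc_out bDE def1) scaler0 in hPT.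
pose N1 := absz (Num.max 0 (- tau)); pose N2 := absz (Num.max 0 tau).
have NE : N2%:Z = N1%:Z + tau by rewrite /N1 /N2; lia.
have [c tE] := wronsk_power K0 a0 p0 (esym hPT) NE.
pose T' := T ^+ a * P ^+ N1 - c *: P ^+ N2.
pose E' := a%:R *: (T ^+ a.-1 * P ^+ N1 * E).
have lev : a%:Z * tau + N1%:Z * a%:Z = N2%:Z * a%:Z by rewrite NE; ring.
have bT' : bnd d (N2%:Z * a%:Z) T'.
  apply: bndB; last by apply: bndZ; apply: bndX.
  by rewrite -lev; apply: bndM; apply: bndX.
have hT' : hc d (N2%:Z * a%:Z) T' = 0.
  rewrite /T' linearB linearZ /= (hcX _ bP) -{1}lev hcM ?hcX ?tE ?subrr //.
    exact: bndX.
  exact: bndX.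
have PT' : lbr P T' = D * E'.
  rewrite /T' linearB linearZ /= lbrM !lbrXr lbrPP !mulr0 addr0 scaler0 subr0 PT.
  rewrite /E' scaler_nat -(mulr_natl (T ^+ a.-1 * P ^+ N1 * E)).
  by move: (a%:R) (T ^+ a.-1) (P ^+ N1) => *; ring.
pose eps' := a.-1%:Z * tau + N1%:Z * a%:Z + eps.
have bE0 : bnd d (a.-1%:Z * tau + N1%:Z * a%:Z) (T ^+ a.-1 * P ^+ N1).
  by apply: bndM; apply: bndX.
have bE' : bnd d eps' E' by apply: bndZ; apply: bndM.
have hE' : hc d eps' E' = a%:R *: (hc d tau T ^+ a.-1 * p ^+ N1 * hc d eps E).
  rewrite linearZ /= (hcM bE0 bE) hcM ?hcX //; exact: bndX.
have hE'0 : hc d eps' E' != 0.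
  by rewrite hE' scaler_eq0 natK_eq0 // !mulf_eq0 !expf_eq0 (negPf t0) (negPf p0)
    (negPf e0) !andbF !orbF -lt0n.
have T'0 : T' != 0.
  apply: contraTneq (hE'0) => T'0; have := hcM bD bE'.
  rewrite -PT' T'0 linear0 linear0 hD => /esym/eqP.
  by rewrite mulf_eq0 polyC_eq0 (negPf d00) /= => /eqP->; rewrite eqxx.
have [k [bk hk]] := top_exists rho0 T'0.
have lt_k := hc_top bk bT' hk hT'.
apply: (IHn T' E' k eps') => //.
  rewrite hE' wronskZ; apply/eqP; rewrite scaler_eq0; apply/orP; right; apply/eqP.
  apply: wronskM => //; rewrite [a.-1%:Z * _]mulrC [N1%:Z * _]mulrC.
  by apply: wronskM; apply: wronskX; rewrite // wronsk_self.
have aE : a.-1%:Z = a%:Z - 1 by lia.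
by move: lt_n lt_k; rewrite -lev /eps' aE; lia.
Qed.

End Chain.

Lemma size_corner (K : fieldType) (f : {poly K}) l : f`_l != 0 ->
  (forall i, (l < i)%N -> f`_i = 0) -> size f = l.+1.
Proof.
move=> fl hi; apply/eqP; rewrite eqn_leq; apply/andP; split.
  by apply/leq_sizeP=> i; apply: hi.
by rewrite ltnNge; apply: contra fl => le; rewrite nth_default.
Qed.

Lemma monomial_of_low (K : fieldType) (r : {poly K}) D : size r = D.+1 ->
  (forall i, (i < D)%N -> r`_i = 0) -> r = lead_coef r *: 'X^D.
Proof.
move=> sr lo; apply/polyP=> i; rewrite coefZ coefXn; case: ltngtP => [/lo->|lt_i|->].
- by rewrite mulr0.
- by rewrite mulr0 nth_default // sr.
- by rewrite mulr1 lead_coefE sr.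
Qed.

Section Edges.
Variables (K : closedFieldType) (K0 : [pchar K] =i pred0) (A : laurentAlg K).
Implicit Types (P Q J : A).

Lemma hc_pattern (rho : nat) (sig k : int) P i j : coprimez rho%:Z sig ->
  (hc (rho%:Z, sig) k P)`_i != 0 -> (hc (rho%:Z, sig) k P)`_j != 0 ->
  i = j %[mod rho].
Proof.
move=> cop /hc_coef[[a1 a2] [_ + <-]] /hc_coef[[b1 b2] [_ + <-]]; rewrite /val_at /=.
move=> <- E; apply/eqP.
have dvd : (rho%:Z %| a2%:Z - b2%:Z)%Z.
  rewrite -(Gauss_dvdzr _ cop); apply/dvdzP; exists (b1 - a1).
  move: E => /eqP; rewrite -subr_eq0 => /eqP E; apply/eqP.
  by rewrite -subr_eq0; apply/eqP; rewrite -[RHS]oppr0 -E; ring.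
by move: dvd; rewrite -eqz_mod_dvd !modz_nat eqz_nat.
Qed.

Section Edge.
Variables (rho D m n v : nat) (sig delta : int) (P Q J : A).
Let d := (rho%:Z, sig).
Let p := hc d (m * v)%N%:Z P.
Let q := hc d (n * v)%N%:Z Q.
Hypotheses (rho0 : (0 < rho)%N) (cop : coprimez rho%:Z sig).
Hypotheses (m0 : (0 < m)%N) (n0 : (0 < n)%N) (copmn : coprime m n) (v0 : (0 < v)%N).
Hypotheses (PQ : lbr P Q = J) (bJ : bnd d delta J).
Hypotheses (bP : bnd d (m * v)%N%:Z P) (bQ : bnd d (n * v)%N%:Z Q).
Hypotheses (sp : size p = (D * m).+1) (sq : size q = (D * n).+1).
Hypothesis lt_delta : delta < ((m + n) * v)%N%:Z - rho%:Z - sig.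

Lemma edge_power : exists (r : {poly K}) (c c' : K),
  [/\ c != 0, c' != 0, size r = D.+1, p = c *: r ^+ m /\ q = c' *: r ^+ n &
      forall i, r`_i != 0 -> i = D %[mod rho]].
Proof.
have p0 : p != 0 by rewrite -size_poly_gt0 sp.
have q0 : q != 0 by rewrite -size_poly_gt0 sq.
have W : wronsk (m * v)%N%:Z (n * v)%N%:Z p q = 0.
  rewrite -hc_lbr // PQ (hc_out bJ) ?scaler0 //=.
  by move: lt_delta; rewrite mulnDl PoszD.
have {}W : wronsk m%:Z n%:Z p q = 0.
  have vK : v%:R != 0 :> K by rewrite (natK_eq0 K0) -lt0n.
  apply: (scalerI vK); rewrite scaler0 -W /wronsk !PoszM !intrM -!pmulrn scalerBr.
  by rewrite !scalerA ![v%:R * _]mulrC.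
have [r [c [c' [c0 c'0 pE qE]]]] := common_power K0 m0 n0 copmn p0 q0 W.
exists r, c, c'; split=> //.
  have r0 : r != 0.
    by apply: contraNneq p0 => r0; rewrite pE r0 expr0n gtn_eqF // scaler0.
  move: (size_exp r m); rewrite -(size_scale _ c0) -pE sp /= => /eqP.
  by rewrite eqn_pmul2r // => /eqP ->; rewrite -sizeS.
have r0 : r != 0.
  by apply: contraNneq p0 => r0; rewrite pE r0 expr0n gtn_eqF // scaler0.
have [z zP] := prim_root_exists K0 rho0.
have top (f : {poly K}) l : size f = l.+1 -> f`_l != 0.
  by move=> sf; rewrite -[l]/(l.+1.-1) -sf -/(lead_coef f) lead_coef_eq0 -size_poly_gt0 sf.
apply: (common_power_pattern m0 n0 copmn c0 c'0 r0 zP) => i.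
  by rewrite -pE => /hc_pattern; apply=> //; apply: top.
by rewrite -qE => /hc_pattern; apply=> //; apply: top.
Qed.

Variables (j0 : K).
Hypotheses (hJ : hc d delta J = j0%:P) (j00 : j0 != 0).

Lemma edge_ode r (c : K) : c != 0 -> p = c *: r ^+ m ->
  exists tau eps t e, [/\ e != 0, wronsk v%:Z tau r t = e, wronsk v%:Z eps r e = 0 &
    tau - eps = delta + rho%:Z + sig - v%:Z].
Proof.
move=> c0 pE.
have p0 : p != 0 by rewrite -size_poly_gt0 sp.
have q0 : q != 0 by rewrite -size_poly_gt0 sq.
have r0 : r != 0.
  by apply: contraNneq p0 => r0; rewrite pE r0 expr0n gtn_eqF // scaler0.
have rho1 : d.1 != 0 by rewrite /d /= eqz_nat -lt0n.
have mv0 : (0 < m * v)%N by rewrite muln_gt0 m0.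
have [|||||||t [e [tau [eps [e0 We W0 w]]]]] :=
  @chain _ K0 A d (m * v)%N delta P J j0 rho1 mv0 bP p0 bJ hJ j00
  (absz ((m * v)%N%:Z + (n * v)%N%:Z - rho%:Z - sig - delta)%R).+1 Q 1 (n * v)%N%:Z 0.
- exact: bQ.
- exact: q0.
- exact: bnd1.
- by rewrite hc1 oner_eq0.
- by rewrite mulr1.
- by rewrite hc1 /wronsk derivC mulr0 scale0r scaler0 subrr.
- by rewrite /d /=; lia.
have ka0 : d.1%:~R * j0 != 0 by rewrite mulf_neq0 ?(intK_eq0 K0).
rewrite -/p pE PoszM in We W0.
have [e1 e10 [We1 W01]] := wronsk_reduce K0 m0 c0 ka0 r0 e0 We W0.
exists tau, (eps - m.-1%:Z * v%:Z), t, e1; split=> //.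
have -> : m.-1%:Z = m%:Z - 1 by lia.
have -> : tau = eps + (delta + d.1 + d.2 - (m * v)%N%:Z) by rewrite -w; ring.
by rewrite PoszM /d /=; ring.
Qed.

End Edge.

Lemma quartic_edge (rho m n v : nat) (sig : int) P Q J (j0 : K) :
  let d := (rho%:Z, sig) in
  coprimez rho%:Z sig -> (0 < m)%N -> (0 < n)%N -> coprime m n ->
  - 3 * rho%:Z < sig -> sig < - 2 * rho%:Z -> v%:Z = 12 * rho%:Z + 4 * sig ->
  lbr P Q = J -> bnd d 0 J -> hc d 0 J = j0%:P -> j0 != 0 ->
  bnd d (m * v)%N%:Z P -> bnd d (n * v)%N%:Z Q ->
  size (hc d (m * v)%N%:Z P) = (4 * m).+1 ->
  size (hc d (n * v)%N%:Z Q) = (4 * n).+1 ->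
  exists c c' : K, hc d (m * v)%N%:Z P = c *: 'X^(4 * m) /\
    hc d (n * v)%N%:Z Q = c' *: 'X^(4 * n).
Proof.
move=> d cop m0 n0 copmn lo hi vE PQ bJ hJ j00 bP bQ sp sq.
have rho0 : (0 < rho)%N by lia.
have v0 : (0 < v)%N by lia.
have lt : 0 < ((m + n) * v)%N%:Z - rho%:Z - sig by lia.
have [r [c [c' [c0 c'0 sr [pE qE] pat]]]] :=
  edge_power rho0 cop m0 n0 copmn v0 PQ bJ bP bQ sp sq lt.
have [tau [eps [t [e [e0 We W0 w]]]]] :=
  edge_ode rho0 cop m0 n0 copmn v0 PQ bJ bP bQ sp sq lt hJ j00 c0 pE.
pose s := - 2 * rho%:Z - sig.
have vE' : v%:Z = 4 * (rho%:Z - s) by rewrite vE /s; ring.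
have rE : r = lead_coef r *: 'X^4.
  apply: monomial_of_low => //; rewrite vE' in We W0.
  apply: (quartic_corner K0 _ _ _ sr pat e0 We W0).
  - by rewrite /s; lia.
  - by rewrite /s; lia.
  - have -> : s = - (2 * rho%:Z + sig) by rewrite /s; ring.
    by rewrite /coprimez gcdzN gcdzMDl.
  - by rewrite w vE /s; ring.
exists (c * lead_coef r ^+ m), (c' * lead_coef r ^+ n).
by rewrite pE qE rE lead_coefZ lead_coefXn mulr1 !exprZn !scalerA -!exprM.
Qed.

Lemma cubic_edge (rho m n v : nat) (sig : int) P Q J (j0 : K) :
  let d := (rho%:Z, sig) in
  coprimez rho%:Z sig -> (0 < m)%N -> (0 < n)%N -> coprime m n ->
  (2 < m + n)%N -> 0 <= sig -> sig < rho%:Z -> v%:Z = rho%:Z + 3 * sig ->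
  lbr P Q = J -> bnd d rho%:Z J -> hc d rho%:Z J = j0%:P -> j0 != 0 ->
  bnd d (m * v)%N%:Z P -> bnd d (n * v)%N%:Z Q ->
  size (hc d (m * v)%N%:Z P) = (3 * m).+1 ->
  size (hc d (n * v)%N%:Z Q) = (3 * n).+1 ->
  exists c c' al : K, [/\ hc d (m * v)%N%:Z P = c *: ('X - al%:P) ^+ (3 * m),
    hc d (n * v)%N%:Z Q = c' *: ('X - al%:P) ^+ (3 * n) & (1 < rho)%N -> al = 0].
Proof.
move=> d cop m0 n0 copmn mn2 lo hi vE PQ bJ hJ j00 bP bQ sp sq.
have rho0 : (0 < rho)%N by lia.
have v0 : (0 < v)%N by lia.
have lt : rho%:Z < ((m + n) * v)%N%:Z - rho%:Z - sig by nia.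
have [r [c [c' [c0 c'0 sr [pE qE] pat]]]] :=
  edge_power rho0 cop m0 n0 copmn v0 PQ bJ bP bQ sp sq lt.
have [tau [eps [t [e [e0 We W0 w]]]]] :=
  edge_ode rho0 cop m0 n0 copmn v0 PQ bJ bP bQ sp sq lt hJ j00 c0 pE.
rewrite vE in We W0.
have [|al rE al0] := cubic_corner K0 lo hi cop sr pat e0 We W0.
  by rewrite w vE; ring.
exists (c * lead_coef r ^+ m), (c' * lead_coef r ^+ n), al; split=> //.
  by rewrite pE {1}rE exprZn scalerA -exprM.
by rewrite qE {1}rE exprZn scalerA -exprM.
Qed.

Lemma linear_edge (rho m n v : nat) (sig delta : int) P Q J :
  let d := (rho%:Z, sig) in
  coprimez rho%:Z sig -> (0 < rho)%N -> (0 < m)%N -> (0 < n)%N -> coprime m n ->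
  (0 < v)%N -> lbr P Q = J -> bnd d delta J ->
  delta < ((m + n) * v)%N%:Z - rho%:Z - sig ->
  bnd d (m * v)%N%:Z P -> bnd d (n * v)%N%:Z Q ->
  size (hc d (m * v)%N%:Z P) = m.+1 -> size (hc d (n * v)%N%:Z Q) = n.+1 ->
  exists c c' al : K, [/\ hc d (m * v)%N%:Z P = c *: ('X - al%:P) ^+ m,
    hc d (n * v)%N%:Z Q = c' *: ('X - al%:P) ^+ n & (1 < rho)%N -> al = 0].
Proof.
move=> d cop rho0 m0 n0 copmn v0 PQ bJ lt bP bQ sp sq.
rewrite -[m in m.+1]mul1n in sp; rewrite -[n in n.+1]mul1n in sq.
have [r [c [c' [c0 c'0 sr [pE qE] pat]]]] :=
  edge_power rho0 cop m0 n0 copmn v0 PQ bJ bP bQ sp sq lt.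
have l0 : r`_1 != 0.
  have : lead_coef r != 0 by rewrite lead_coef_eq0 -size_poly_gt0 sr.
  by rewrite lead_coefE sr.
have rE : r = r`_1 *: ('X - (- (r`_0 / r`_1))%:P).
  apply/polyP=> -[|[|i]]; rewrite coefZ coefB coefX coefC /=.
  - by rewrite sub0r opprK mulrC divfK.
  - by rewrite subr0 mulr1.
  - by rewrite subr0 mulr0 nth_default // sr.
exists (c * r`_1 ^+ m), (c' * r`_1 ^+ n), (- (r`_0 / r`_1)); split.
- by rewrite pE {1}rE exprZn scalerA.
- by rewrite qE {1}rE exprZn scalerA.
move=> rho1; suff -> : r`_0 = 0 by rewrite mul0r oppr0.
apply/eqP; apply: contraT => /pat /eqP.
by rewrite mod0n modn_small.
Qed.

End Edges.

Lemma max_slope (S : seq (int * int)) : S != [::] -> (forall s, s \in S -> 0 < s.2) ->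
  exists (rho : nat) (sig : int), [/\ (0 < rho)%N, coprimez rho%:Z sig,
    forall s, s \in S -> rho%:Z * s.1 <= sig * s.2 &
    exists2 s, s \in S & rho%:Z * s.1 = sig * s.2].
Proof.
move=> S0 pos.
have {S0} [s0 s0S smax] : exists2 s, s \in S &
    forall s', s' \in S -> s.2 * s'.1 <= s.1 * s'.2.
  elim: S S0 pos => // s S IHS _ pos; have sp := pos s (mem_head _ _).
  have [->|S0] := eqVneq S [::].
    by exists s; rewrite ?mem_head // => s'; rewrite inE => /eqP->; rewrite mulrC.
  have [|s1 s1S max1] := IHS S0; first by move=> s' s'S; apply: pos; rewrite inE s'S orbT.
  have s1p : 0 < s1.2 by apply: pos; rewrite inE s1S orbT.
  have [le|lt] := leP (s1.2 * s.1) (s1.1 * s.2).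
    exists s1; first by rewrite inE s1S orbT.
    by move=> s'; rewrite inE => /predU1P[->|/max1].
  exists s; first by rewrite mem_head.
  move=> s'; rewrite inE => /predU1P[->|s'S]; first by rewrite mulrC.
  have s'p : 0 < s'.2 by apply: pos; rewrite inE s'S orbT.
  have := max1 _ s'S; rewrite -(ler_pM2l s1p) => le.
  rewrite -(ler_pM2l s1p); apply: le_trans (_ : s.2 * (s1.1 * s'.2) <= _).
    by rewrite mulrCA ler_pM2l // -(ler_pM2l s1p).
  by rewrite !mulrA ler_pM2r // ltW // [s.2 * _]mulrC.
have s0p := pos _ s0S; pose g := gcdz s0.1 s0.2.
have g0 : 0 < g by rewrite /g /gcdz ltz_nat gcdn_gt0 !absz_gt0 (gt_eqF s0p) orbT.
have [x xE] : exists x, s0.1 = x * g by apply/dvdzP; apply: dvdz_gcdl.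
have [y yE] : exists y, s0.2 = y * g by apply/dvdzP; apply: dvdz_gcdr.
have y0 : 0 < y by rewrite yE pmulr_lgt0 in s0p.
exists (absz y), x; have yN : (absz y)%:Z = y by lia.
rewrite yN; split.
- by lia.
- rewrite /coprimez -(inj_eq (mulIf (lt0r_neq0 g0))) mul1r gcdzC.
  have -> : gcdz x y * g = gcdz (x * g) (y * g) by rewrite -mulz_gcdl gtz0_abs.
  by rewrite -xE -yE.
- move=> s /smax; rewrite xE yE mulrAC [x * g * _]mulrAC ler_pM2r //.
- by exists s0; rewrite // xE yE; ring.
Qed.

Section Walk.
Variables (K : fieldType) (A : laurentAlg K).
Implicit Types (P Q : A).

Definition corner_at (d : int * int) (i0 : int) (j0 : nat) P :=
  bnd d (val_at d (i0, j0)) P /\ size (hc d (val_at d (i0, j0)) P) = j0.+1.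

Definition base_at (mu i0 : int) (j0 : nat) P :=
  [/\ bnd (1, mu) (val_at (1, mu) (i0, j0)) P,
      (hc (1, mu) (val_at (1, mu) (i0, j0)) P)`_j0 != 0 &
      forall i, (i < j0)%N -> (hc (1, mu) (val_at (1, mu) (i0, j0)) P)`_i = 0].

Lemma base_coef mu i0 j0 P : base_at mu i0 j0 P -> coef (i0, j0) P != 0.
Proof. by case=> _ + _; rewrite (@coef_hc _ A (1, mu) _ P (i0, j0)) ?oner_eq0. Qed.

Lemma base_strict mu i0 j0 P a : base_at mu i0 j0 P -> coef a P != 0 ->
  (a.2 < j0)%N -> val_at (1, mu) a < val_at (1, mu) (i0, j0).
Proof.
case=> bP _ lo aP lt; rewrite lt_neqAle bP // andbT; apply/negP=> /eqP E.
by rewrite -(@coef_hc _ A (1, mu) _ P a (oner_neq0 _) E) lo ?eqxx in aP.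
Qed.

Lemma corner_of_slopes mu i0 j0 P (rho : nat) sig : base_at mu i0 j0 P ->
  (0 < rho)%N -> sig < mu * rho%:Z ->
  (forall a, coef a P != 0 -> (a.2 < j0)%N ->
     rho%:Z * (a.1 - i0) <= sig * (j0%:Z - a.2%:Z)) ->
  corner_at (rho%:Z, sig) i0 j0 P.
Proof.
move=> bs rho0 lt sl; have [bP _ _] := bs.
have hi a : coef a P != 0 -> (j0 < a.2)%N ->
    val_at (rho%:Z, sig) a < val_at (rho%:Z, sig) (i0, j0).
  by move=> /bP; case: a => [i j]; rewrite /val_at /= => aP lt_j; nia.
have rho1 : (rho%:Z, sig).1 != 0 by rewrite /= eqz_nat -lt0n.
split.
  move=> a aP; have := sl a aP; have := hi a aP; have := bP a aP.
  case: a {aP} => [i j]; rewrite /val_at /= => b hi' lo'.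
  have [/lo'|lt_j|E] := ltngtP j j0; first by lia.
    by rewrite ltW // hi'.
  by subst j; nia.
apply: size_corner.
  by rewrite (@coef_hc _ A _ _ P (i0, j0)) // (base_coef bs).
move=> i lt_i; apply/eqP; apply: contraT => /hc_coef[a [aP av aE]].
by have := hi a aP; rewrite aE av ltxx => /(_ lt_i).
Qed.

(* Lowering the slope from [mu], a leading form can only change at an edge
   starting at the corner; such an edge of maximal slope is excluded by the last
   hypothesis. *)
Lemma walk_step mu i0 j0 i1 j1 P Q (rho0 : nat) sig0 :
  base_at mu i0 j0 P -> base_at mu i1 j1 Q -> (0 < rho0)%N -> sig0 < mu * rho0%:Z ->
  (forall (rho : nat) sig, (0 < rho)%N -> coprimez rho%:Z sig ->
     sig0 * rho%:Z < sig * rho0%:Z -> sig < mu * rho%:Z ->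
     corner_at (rho%:Z, sig) i0 j0 P -> corner_at (rho%:Z, sig) i1 j1 Q ->
     exists c c' : K, hc (rho%:Z, sig) (val_at (rho%:Z, sig) (i0, j0)) P = c *: 'X^j0 /\
       hc (rho%:Z, sig) (val_at (rho%:Z, sig) (i1, j1)) Q = c' *: 'X^j1) ->
  corner_at (rho0%:Z, sig0) i0 j0 P /\ corner_at (rho0%:Z, sig0) i1 j1 Q.
Proof.
move=> bP bQ rho00 sig0_mu edge.
pose pts (R : A) i j := [seq (a.1 - i, j%:Z - a.2%:Z) | a <- supp R & (a.2 < j)%N].
pose S := pts P i0 j0 ++ pts Q i1 j1.
have posS s : s \in S -> 0 < s.2.
  by rewrite mem_cat => /orP[] /mapP[a]; rewrite mem_filter => /andP[lt _] -> /=; lia.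
have ltS s : s \in S -> s.1 < mu * s.2.
  rewrite mem_cat => /orP[] /mapP[a]; rewrite mem_filter mem_supp => /andP[lt aR] -> /=.
    by have := base_strict bP aR lt; rewrite /val_at /=; lia.
  by have := base_strict bQ aR lt; rewrite /val_at /=; lia.
have inP a : coef a P != 0 -> (a.2 < j0)%N -> (a.1 - i0, j0%:Z - a.2%:Z) \in S.
  move=> aP lt; rewrite mem_cat; apply/orP; left; apply/mapP; exists a => //.
  by rewrite mem_filter lt mem_supp.
have inQ a : coef a Q != 0 -> (a.2 < j1)%N -> (a.1 - i1, j1%:Z - a.2%:Z) \in S.
  move=> aP lt; rewrite mem_cat; apply/orP; right; apply/mapP; exists a => //.
  by rewrite mem_filter lt mem_supp.
have final : (forall s, s \in S -> rho0%:Z * s.1 <= sig0 * s.2) ->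
    corner_at (rho0%:Z, sig0) i0 j0 P /\ corner_at (rho0%:Z, sig0) i1 j1 Q.
  move=> sl; split.
    apply: (corner_of_slopes bP rho00 sig0_mu) => a aP lt.
    by apply: (sl (_, _) (inP a aP lt)).
  apply: (corner_of_slopes bQ rho00 sig0_mu) => a aP lt.
  by apply: (sl (_, _) (inQ a aP lt)).
have [S0|S0] := eqVneq S [::]; first by apply: final => s; rewrite S0.
have [rho [sig [rho_gt0 cop sl [s sS sE]]]] := max_slope S0 posS.
have rhoZ : 0 < rho%:Z by rewrite ltz_nat.
have [le|lt] := leP (sig * rho0%:Z) (sig0 * rho%:Z).
  apply: final => s' s'S; rewrite -(ler_pM2l rhoZ).
  apply: le_trans (_ : rho0%:Z * (sig * s'.2) <= _).
    by rewrite mulrCA ler_pM2l ?ltz_nat // sl.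
  by rewrite !mulrA ler_pM2r ?posS // mulrC [rho%:Z * _]mulrC.
have lt_mu : sig < mu * rho%:Z.
  rewrite -(ltr_pM2r (posS _ sS)) -sE -mulrA mulrCA ltr_pM2l ?ltz_nat //.
  exact: ltS.
have cP : corner_at (rho%:Z, sig) i0 j0 P.
  by apply: (corner_of_slopes bP) => // a aP lt'; apply: (sl (_, _) (inP a aP lt')).
have cQ : corner_at (rho%:Z, sig) i1 j1 Q.
  by apply: (corner_of_slopes bQ) => // a aP lt'; apply: (sl (_, _) (inQ a aP lt')).
have rho1 : (rho%:Z, sig).1 != 0 by rewrite /= eqz_nat -lt0n.
have [c [c' [hP hQ]]] := edge _ _ rho_gt0 cop lt lt_mu cP cQ.
exfalso; move: sS; rewrite mem_cat => /orP[] /mapP[a];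
  rewrite mem_filter mem_supp => /andP[lt_a aR] E; move: sE; rewrite E /= => sE.
  have av : val_at (rho%:Z, sig) a = val_at (rho%:Z, sig) (i0, j0).
    by rewrite /val_at /=; lia.
  by move: aR; rewrite -(coef_hc _ rho1 av) hP coefZ coefXn ltn_eqF ?mulr0 ?eqxx.
have av : val_at (rho%:Z, sig) a = val_at (rho%:Z, sig) (i1, j1).
  by rewrite /val_at /=; lia.
by move: aR; rewrite -(coef_hc _ rho1 av) hQ coefZ coefXn ltn_eqF ?mulr0 ?eqxx.
Qed.

End Walk.

(** * Automorphisms *)

Section Morphisms.
Variables (K : fieldType) (A : laurentAlg K).
Implicit Types (P Q q : A) (a b : int * nat) (d : int * int).
Local Notation mon := (mon A).

Definition yfree q := forall a, coef a q != 0 -> a.2 = 0%N.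

Definition sh q : A -> A := lext (fun a => mon (a.1, 0%N) * (mon (0, 1%N) + q) ^+ a.2).
HB.instance Definition _ q := GRing.Linear.on (sh q).

(* The involution x -> x^-1, y -> x^3 y. *)
Definition psi : A -> A := lext (fun a => mon (3 * a.2%:Z - a.1, a.2)).
HB.instance Definition _ := GRing.Linear.on psi.

(* The exchange of [x] and [y] on K[x, y]; on a negative power of [x] the value
   is junk. *)
Definition swp : A -> A := lext (fun a => mon (a.2%:Z, absz a.1)).
HB.instance Definition _ := GRing.Linear.on swp.

Lemma sh_mon q a : sh q (mon a) = mon (a.1, 0%N) * (mon (0, 1%N) + q) ^+ a.2.
Proof. exact: lext_mon. Qed.

Lemma psi_mon a : psi (mon a) = mon (3 * a.2%:Z - a.1, a.2).
Proof. exact: lext_mon. Qed.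

Lemma swp_mon a : swp (mon a) = mon (a.2%:Z, absz a.1).
Proof. exact: lext_mon. Qed.

Lemma monX a n : mon a ^+ n = mon (a.1 * n%:Z, (a.2 * n)%N).
Proof.
elim: n => [|n IHn]; first by rewrite expr0 mulr0 muln0 (mon0 A).
by rewrite exprS IHn monD; congr (mon (_, _)); rewrite /=; [ring | exact: esym (mulnS _ _)].
Qed.

Lemma sh_monoid q : monoid_morphism (sh q).
Proof.
split; first by rewrite -(mon0 A) sh_mon expr0 mulr1.
move=> P Q; apply: lextM => -[i j] [i' j'] /=; rewrite exprD.
have -> : mon (i + i', 0%N) = mon (i, 0%N) * mon (i', 0%N) by rewrite monD.
by rewrite mulrACA.
Qed.
HB.instance Definition _ q := GRing.isMonoidMorphism.Build A A (sh q) (sh_monoid q).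

Lemma psi_monoid : monoid_morphism psi.
Proof.
split; first by rewrite -(mon0 A) psi_mon.
move=> P Q; apply: lextM => -[i j] [i' j'] /=; rewrite monD.
by congr (mon (_, _)); rewrite /= PoszD; ring.
Qed.
HB.instance Definition _ := GRing.isMonoidMorphism.Build A A psi psi_monoid.

Lemma psiK : involutive psi.
Proof.
move=> P; have := @linear_eq_mon _ A A (psi \o psi) idfun; apply=> a /=.
by rewrite !psi_mon; congr (mon _); case: a => i j /=; congr pair; ring.
Qed.

Lemma yfreeD p q : yfree p -> yfree q -> yfree (p + q).
Proof.
move=> fp fq a; rewrite cfD; have [a0|/fp//] := eqVneq (coef a p) 0.
by rewrite a0 add0r => /fq.
Qed.

Lemma yfreeZ c q : yfree q -> yfree (c *: q).
Proof. by move=> fq a; rewrite cfZ mulf_eq0 negb_or => /andP[_ /fq]. Qed.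

Lemma yfree_mon i : yfree (mon (i, 0%N)).
Proof. by move=> a; rewrite cf_mon; case: (eqVneq (i, 0%N) a) => [<-|]; rewrite ?eqxx. Qed.

Lemma sh_yfree q p : yfree p -> sh q p = p.
Proof.
move=> fp; rewrite [RHS]supp_sum; apply: (@eq_lext _ _ _ _ mon) => -[i j] /fp /= j0.
by rewrite j0 expr0 mulr1.
Qed.

Lemma sh_y q : sh q (mon (0, 1%N)) = mon (0, 1%N) + q.
Proof. by rewrite sh_mon expr1 (mon0 A) mul1r. Qed.

Lemma sh_x q i : sh q (mon (i, 0%N)) = mon (i, 0%N).
Proof. exact/sh_yfree/yfree_mon. Qed.

Lemma shD q q' P : yfree q' -> sh q (sh q' P) = sh (q + q') P.
Proof.
move=> fq'; have := @linear_eq_mon _ A A (sh q \o sh q') (sh (q + q')); apply=> a /=.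
by rewrite !sh_mon rmorphM rmorphXn rmorphD /= sh_x sh_y (sh_yfree _ fq') addrA.
Qed.

Lemma sh0 P : sh 0 P = P.
Proof.
have := @linear_eq_mon _ A A (sh 0) idfun; apply=> -[i j] /=.
by rewrite sh_mon addr0 monX monD; congr (mon (_, _)); rewrite /= ?mul0r ?addr0 // mul1n add0r.
Qed.

Lemma sh_bij q : yfree q -> bijective (sh q).
Proof.
move=> fq; have fNq : yfree (- q) by rewrite -scaleN1r; apply: yfreeZ.
by exists (sh (- q)) => P; rewrite shD // ?addNr ?addrN sh0.
Qed.

Lemma sh_bnd d q k P : bnd d k P -> bnd d d.2 q -> bnd d k (sh q P).
Proof.
move=> bP bq; apply: bnd_lext => -[i j] /bP aP.
have -> : k = d.1 * i + j%:Z * d.2 + (k - (d.1 * i + j%:Z * d.2)) by ring.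
apply: bndW (_ : d.1 * i + j%:Z * d.2 <= _) _.
  by move: aP; rewrite /val_at /=; lia.
apply: bndM; first by apply: bnd_mon; rewrite /val_at /= mulr0 addr0.
apply: bndX; apply: bndD => //; apply: bnd_mon.
by rewrite /val_at /= mulr0 add0r mulr1.
Qed.

Lemma sh_hc d q (al : K) k P : bnd d k P -> bnd d d.2 q -> hc d d.2 q = al%:P ->
  hc d k (sh q P) = hc d k P \Po ('X + al%:P).
Proof.
move=> bP bq hq; rewrite [sh q P]/lext (linear_sum (hc d k)) [hc d k P]/lext linear_sum.
apply: eq_big_seq => -[i j]; rewrite mem_supp => /bP aP.
rewrite (linearZZ (hc d k)) /= linearZ /=; congr (_ *: _).
have vE : val_at d (i, j) = d.1 * i + j%:Z * d.2 by rewrite /val_at /= [d.2 * _]mulrC.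
have by1 : bnd d d.2 (mon (0, 1%N)).
  by apply: bnd_mon; rewrite /val_at /= mulr0 add0r mulr1.
have bx : bnd d (d.1 * i) (mon (i, 0%N)).
  by apply: bnd_mon; rewrite /val_at /= mulr0 addr0.
have byq := @bndX _ _ _ _ _ j (bndD by1 bq).
have [vk|nvk] := eqVneq (val_at d (i, j)) k.
  rewrite -vk vE hcM // hcX; last exact: bndD.
  rewrite linearD /= hq !hc_mon /val_at /= !mulr0 addr0 add0r mulr1 !eqxx mul1r expr1.
  by rewrite rmorphXn /= comp_polyX.
rewrite comp_poly0 (hc_out (bndM bx byq)) // -vE lt_neqAle nvk.
exact: aP.
Qed.

Lemma sh_sub d q k P : bnd d k P -> bnd d (d.2 - 1) q -> bnd d (k - 1) (sh q P - P).
Proof.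
move=> bP bq.
have -> : sh q P - P = lext (fun a => mon (a.1, 0%N) *
    ((mon (0, 1%N) + q) ^+ a.2 - mon (0, 1%N) ^+ a.2)) P.
  rewrite [X in _ - X]supp_sum /sh /lext -sumrB; apply: eq_bigr => -[i j] _ /=.
  rewrite -scalerBr mulrBr monX monD; congr (_ *: (_ - mon (_, _))).
    by rewrite /= mul0r addr0.
  by rewrite /= mul1n.
apply: bnd_lext => -[i j] /bP aP /=.
have by1 : bnd d d.2 (mon (0, 1%N)).
  by apply: bnd_mon; rewrite /val_at /= mulr0 add0r mulr1.
have byq : bnd d d.2 (mon (0, 1%N) + q).
  by apply: bndD => //; apply: bndW bq; lia.
apply: bndW (_ : d.1 * i + (j%:Z * d.2 - 1) <= _) _.
  by move: aP; rewrite /val_at /=; lia.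
apply: bndM; first by apply: bnd_mon; rewrite /val_at /= mulr0 addr0.
elim: j {aP} => [|j IHj]; first by rewrite !expr0 subrr; apply: bnd0.
have -> : (mon (0, 1%N) + q) ^+ j.+1 - mon (0, 1%N) ^+ j.+1 =
   (mon (0, 1%N) + q) * ((mon (0, 1%N) + q) ^+ j - mon (0, 1%N) ^+ j)
   + q * mon (0, 1%N) ^+ j by rewrite !exprS; move: (_ ^+ j) (_ ^+ j) => *; ring.
have -> : j.+1%:Z * d.2 - 1 = d.2 + (j%:Z * d.2 - 1) by rewrite intS; ring.
apply: bndD; first exact: bndM.
have -> : d.2 + (j%:Z * d.2 - 1) = (d.2 - 1) + j%:Z * d.2 by ring.
by apply: bndM => //; apply: bndX.
Qed.

Lemma ldy_yfree q : yfree q -> ldy q = 0.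
Proof.
move=> fq; rewrite /ldy /lext big_seq big1 // => a; rewrite mem_supp => /fq ->.
by rewrite scale0r scaler0.
Qed.

Lemma ldy_sh q P : yfree q -> ldy (sh q P) = sh q (ldy P).
Proof.
move=> fq; have := @linear_eq_mon _ A A (@ldy K A \o sh q) (sh q \o @ldy K A); apply=> -[i j] /=.
rewrite [ldy (mon (i, j))]ldy_mon [sh q (_ *: _)]linearZ /= !sh_mon /=.
rewrite ldy_derivation (derivationX (@ldy_derivation K A)).
rewrite (ldy_yfree (@yfree_mon i)) mul0r add0r.
have -> : ldy (mon (0, 1%N) + q) = ldy (mon (0, 1%N)) + ldy q by exact: linearD.
rewrite (ldy_yfree fq) addr0 ldy_mon scale1r (mon0 A) mul1r scaler_nat -mulrnAr; congr (_ * _).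
by rewrite mulr_natl.
Qed.

Lemma ldx_sh q P : yfree q -> ldx (sh q P) = sh q (ldx P) + ldx q * sh q (ldy P).
Proof.
move=> fq; pose g : A -> A := fun P => sh q (ldx P) + ldx q * sh q (ldy P).
have gl : linear g.
  move=> c S T; rewrite /g.
  have -> : ldx (c *: S + T) = c *: ldx S + ldx T by exact: linearP.
  have -> : ldy (c *: S + T) = c *: ldy S + ldy T by exact: linearP.
  have shl U V : sh q (c *: U + V) = c *: sh q U + sh q V by exact: linearP.
  by rewrite !shl mulrDr -scalerAr scalerDr addrACA.
pose gL : {linear A -> A} := HB.pack g (GRing.isLinear.Build K A A *:%R g gl).
have := @linear_eq_mon _ A A (@ldx K A \o sh q) gL; apply=> -[i j] /=; rewrite /g.
rewrite sh_mon ldx_derivation (derivationX (@ldx_derivation K A)) !ldx_mon ldy_mon /=.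
have shZ c U : sh q (c *: U) = c *: sh q U by exact: linearZ.
rewrite !shZ !sh_mon /=.
have -> : ldx (mon (0, 1%N) + q) = ldx q.
  rewrite (_ : ldx _ = ldx (mon (0, 1%N)) + ldx q); last exact: linearD.
  by rewrite ldx_mon scale0r add0r.
rewrite -scalerAl; congr (_ + _); rewrite -!scalerAr -mulr_algl scaler_nat.
by move: (_ ^+ j.-1) => *; rewrite -[1 *+ j]/(j%:R); ring.
Qed.

Lemma lbr_sh q P Q : yfree q -> lbr (sh q P) (sh q Q) = sh q (lbr P Q).
Proof.
move=> fq; rewrite /lbr !ldx_sh // !ldy_sh // rmorphB !rmorphM /=.
by move: (ldx q) (sh q (ldx P)) (sh q (ldy P)) (sh q (ldx Q)) (sh q (ldy Q)) => *; ring.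
Qed.

Lemma lbr_suml (I : eqType) (r : seq I) (F : I -> A) Q :
  lbr (\sum_(i <- r) F i) Q = \sum_(i <- r) lbr (F i) Q.
Proof.
rewrite lbrC (linear_sum (lbr Q)) -sumrN; apply: eq_bigr => i _.
by rewrite [RHS]lbrC.
Qed.

Lemma lbr_transfer (g h : {linear A -> A}) P Q :
  (forall a b, coef a P != 0 -> coef b Q != 0 ->
     lbr (g (mon a)) (g (mon b)) = h (lbr (mon a) (mon b))) ->
  lbr (g P) (g Q) = h (lbr P Q).
Proof.
move=> gh; rewrite (lbrE P Q) (linear_sum h) (linear_lext g P) /lext lbr_suml.
apply: eq_big_seq => a; rewrite mem_supp => aP.
rewrite (linear_sum h) (linear_lext g Q) /lext (linear_sum (lbr _)).
apply: eq_big_seq => b; rewrite mem_supp => bQ.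
by rewrite /= lbrZl (linearZZ (lbr _)) /= gh // lbr_mon scalerA -(linearZZ h).
Qed.

Lemma lbr_psi P Q : lbr (psi P) (psi Q) = - mon (1, 0%N) * psi (lbr P Q).
Proof.
pose h : A -> A := fun T => - mon (1, 0%N) * psi T.
have hl : linear h.
  move=> c S T; rewrite /h; have -> : psi (c *: S + T) = c *: psi S + psi T by exact: linearP.
  by rewrite mulrDr -scalerAr.
pose hL : {linear A -> A} := HB.pack h (GRing.isLinear.Build K A A *:%R h hl).
apply: (@lbr_transfer psi hL) => -[i j] [i' j'] _ _; rewrite /= /h.
rewrite !psi_mon !lbr_mon /bmon /= linearZ /= psi_mon -scalerAr mulNr monD /=.
rewrite scalerN -scaleNr -mulrNz.
have [/eqP|jj] := posnP (j + j').
  by rewrite addn_eq0 => /andP[/eqP-> /eqP->]; rewrite !mulr0 !mul0r subrr oppr0 !scale0r.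
congr (_%:~R *: mon (_, _)); rewrite /= ?add0r //; first by ring.
have -> : (j + j').-1%:Z = j%:Z + j'%:Z - 1 by lia.
by ring.
Qed.

Lemma hc_psi d k P : hc d k (psi P) = hc (- d.1, 3 * d.1 + d.2) k P.
Proof.
have := @linear_eq_mon _ A {poly K} (hc d k \o psi) (hc (- d.1, 3 * d.1 + d.2) k).
apply=> -[i j] /=; rewrite psi_mon !hc_mon /val_at /=.
by congr (if _ == _ then _ else _); ring.
Qed.

Lemma coef_psi a P : coef a (psi P) = coef (3 * a.2%:Z - a.1, a.2) P.
Proof.
rewrite {1}[P]supp_sum linear_sum /= cf_sum [in RHS](supp_sum P) cf_sum.
apply: eq_bigr => b _; rewrite linearZ /= !cfZ psi_mon !cf_mon; congr (_ * _%:R).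
case: a b => [i j] [i' j'] /=; congr (nat_of_bool _); apply/eqP/eqP => -[E1 E2].
  by subst j'; congr pair; rewrite -E1; ring.
by subst j'; congr pair; rewrite E1; ring.
Qed.

Lemma bnd_psi d k P : bnd (- d.1, 3 * d.1 + d.2) k P -> bnd d k (psi P).
Proof.
move=> bP a; rewrite coef_psi => /bP; rewrite /val_at /=.
by congr (_ <= _); ring.
Qed.

Lemma psi_sh q P : psi (sh q P) = sh (mon (- 3%:Z, 0%N) * psi q) (psi P).
Proof.
set q' := _ * psi q.
have := @linear_eq_mon _ A A (psi \o sh q) (sh q' \o psi); apply=> -[i j] /=.
rewrite sh_mon rmorphM rmorphXn rmorphD /= !psi_mon sh_mon /=.
have -> : mon (3 * 0%N%:Z - i, 0%N) = mon (- i, 0%N) by congr (mon (_, _)); rewrite mulr0 sub0r.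
have -> : mon (3 * j%:Z - i, 0%N) = mon (- i, 0%N) * mon (3, 0%N) ^+ j.
  by rewrite monX monD; congr (mon (_, _)); rewrite /= addrC.
have E : mon (3, 0%N) * q' = psi q.
  rewrite /q' mulrA monD -[RHS]mul1r -(mon0 A); congr (mon _ * _).
rewrite -mulrA -exprMn mulrDr E monD; congr (_ * (mon _ + _) ^+ _).
Qed.

Definition lpoly P := bnd (-1, 0) 0 P.

Lemma lpolyP P a : lpoly P -> coef a P != 0 -> 0 <= a.1.
Proof. by move=> pP /pP; rewrite /val_at /= mul0r addr0 mulN1r oppr_le0. Qed.

Lemma lpolyM P Q : lpoly P -> lpoly Q -> lpoly (P * Q).
Proof. by move=> pP pQ; rewrite /lpoly -[X in bnd _ X]addr0; apply: bndM. Qed.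

Lemma coef_swp i j P : lpoly P -> coef (i%:Z, j) (swp P) = coef (j%:Z, i) P.
Proof.
move=> pP; rewrite {1}[P]supp_sum linear_sum /= cf_sum [in RHS](supp_sum P) cf_sum.
apply: eq_big_seq => -[i' j'] /=; rewrite mem_supp => /(lpolyP pP) /= i'0.
rewrite linearZ /= !cfZ swp_mon !cf_mon /=; congr (_ * _%:R); congr (nat_of_bool _).
case: i' i'0 => // i' _; apply/eqP/eqP => -[E1 E2]; by rewrite E1 E2.
Qed.

Lemma swp_lpoly P : lpoly (swp P).
Proof. by apply: bnd_lext => -[i j] _; apply: bnd_mon; rewrite /val_at /=; lia. Qed.

Lemma bnd_swp d k P : lpoly P -> bnd (d.2, d.1) k P -> bnd d k (swp P).
Proof.
move=> pP bP a aP; have := lpolyP (@swp_lpoly P) aP; move: aP.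
case: a => -[i|//] j aP _; have := aP; rewrite coef_swp // => /bP.
by rewrite /val_at /= addrC.
Qed.

Lemma lbr_swp P Q : lpoly P -> lpoly Q -> lbr (swp P) (swp Q) = - swp (lbr P Q).
Proof.
move=> pP pQ; pose h : A -> A := fun T => - swp T.
have hl : linear h.
  move=> c S T; rewrite /h; have -> : swp (c *: S + T) = c *: swp S + swp T by exact: linearP.
  by rewrite opprD scalerN.
pose hL : {linear A -> A} := HB.pack h (GRing.isLinear.Build K A A *:%R h hl).
apply: (@lbr_transfer swp hL) => -[i j] [i' j'] /(lpolyP pP) /= i0 /(lpolyP pQ) /= i'0.
case: i i0 => // i _; case: i' i'0 => // i' _; rewrite /h.
rewrite !swp_mon !lbr_mon /bmon /= linearZ /= swp_mon /= -scaleNr -mulrNz.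
have [/eqP|jj] := posnP (j + j').
  by rewrite addn_eq0 => /andP[/eqP-> /eqP->]; rewrite !mulr0 !mul0r subrr oppr0 !scale0r.
have [/eqP|ii] := posnP (i + i').
  by rewrite addn_eq0 => /andP[/eqP-> /eqP->]; rewrite !mulr0 !mul0r subrr oppr0 !scale0r.
by congr (_%:~R *: mon (_, _)); rewrite /=; try lia; ring.
Qed.

End Morphisms.

(** * The successive reductions *)

Section Monomials.
Variables (K : fieldType) (A : laurentAlg K).
Implicit Types (P : A).
Local Notation mon := (mon A).
Local Notation X_ i := (mon (i, 0%N)).
Local Notation Y_ := (mon (0, 1%N)).

Lemma base_monomial mu i0 j0 P (c : K) : c != 0 ->
  bnd (1, mu) (i0 + mu * j0%:Z) P -> hc (1, mu) (i0 + mu * j0%:Z) P = c *: 'X^j0 ->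
  base_at mu i0 j0 P.
Proof.
move=> c0 bP hP; have E : val_at (1, mu) (i0, j0) = i0 + mu * j0%:Z by rewrite /val_at /= mul1r.
rewrite /base_at E hP; split=> // [|i lt_i].
  by rewrite coefZ coefXn eqxx mulr1.
by rewrite coefZ coefXn ltn_eqF ?mulr0.
Qed.

Lemma bnd_X d k i (c : K) : d.1 * i <= k -> bnd d k (c *: X_ i).
Proof. by move=> le; apply/bndZ/bnd_mon; rewrite /val_at /= mulr0 addr0. Qed.

Lemma bnd_Y d k : d.2 <= k -> bnd d k Y_.
Proof. by move=> le; apply/bnd_mon; rewrite /val_at /= mulr0 add0r mulr1. Qed.

Lemma hc_X d k i (c : K) : hc d k (c *: X_ i) = if d.1 * i == k then c%:P else 0.
Proof.
rewrite linearZ /= hc_mon /val_at /= mulr0 addr0; case: ifP => _; last by rewrite scaler0.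
by rewrite alg_polyC.
Qed.

Lemma hc_Y d : hc d d.2 Y_ = 'X.
Proof. by rewrite hc_mon /val_at /= mulr0 add0r mulr1 eqxx expr1. Qed.

Lemma comp_XsubC (al : K) k : ('X - al%:P) ^+ k \Po ('X + al%:P) = 'X^k.
Proof. by rewrite rmorphXn rmorphB /= comp_polyX comp_polyC addrK. Qed.

End Monomials.

Section Stages.
Variables (K : closedFieldType) (K0 : [pchar K] =i pred0) (A : laurentAlg K).
Variables (m n : nat).
Hypotheses (m1 : (1 < m)%N) (n1 : (1 < n)%N) (copmn : coprime m n).
Implicit Types (P Q J q : A).
Local Notation mon := (mon A).
Local Notation X_ i := (mon (i, 0%N)).
Local Notation Y_ := (mon (0, 1%N)).

Let m0 : (0 < m)%N := ltnW m1.
Let n0 : (0 < n)%N := ltnW n1.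

(* After the shear the corner is [(12m, 4m)]; Newton polygon edges of slope
   between -3 and -2 starting there are excluded by [quartic_edge]. *)
Lemma quartic_stage P Q (c l cP cQ : K) : c != 0 -> cP != 0 -> cQ != 0 ->
  lbr P Q = c *: 1 ->
  bnd (1, - 2) (4 * m)%N%:Z P -> bnd (1, - 2) (4 * n)%N%:Z Q ->
  hc (1, - 2) (4 * m)%N%:Z P = cP *: ('X - l%:P) ^+ (4 * m) ->
  hc (1, - 2) (4 * n)%N%:Z Q = cQ *: ('X - l%:P) ^+ (4 * n) ->
  bnd (1, - 3) 0 (sh (l *: X_ (- 2)) P) /\ bnd (1, - 3) 0 (sh (l *: X_ (- 2)) Q).
Proof.
move=> c0 cP0 cQ0 PQ bP bQ hP hQ; set q := l *: X_ (- 2).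
have fq : yfree q by apply/yfreeZ/yfree_mon.
have bq : bnd (1, - 2) (- 2) q by apply: bnd_X.
have hq : hc (1, - 2) (- 2) q = l%:P by rewrite hc_X.
have base (R : A) (k : nat) (cR : K) : cR != 0 -> bnd (1, - 2) (4 * k)%N%:Z R ->
    hc (1, - 2) (4 * k)%N%:Z R = cR *: ('X - l%:P) ^+ (4 * k) ->
    base_at (- 2) (12 * k)%N%:Z (4 * k) (sh q R).
  move=> cR0 bR hR; have E : (12 * k)%N%:Z + - 2 * (4 * k)%N%:Z = (4 * k)%N%:Z.
    by rewrite !PoszM; ring.
  apply: (base_monomial cR0); rewrite E; first exact: sh_bnd.
  by rewrite (sh_hc bR bq hq) hR linearZ /= comp_XsubC.
have [] := @walk_step _ A (- 2) _ _ _ _ _ _ 1 (- 3) (base P m cP cP0 bP hP)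
    (base Q n cQ cQ0 bQ hQ) isT isT; last first.
  have E k : val_at (1, - 3) ((12 * k)%N%:Z, (4 * k)%N) = 0.
    by rewrite /val_at /= !PoszM; ring.
  by rewrite /corner_at !E => -[b1 _] [b2 _].
move=> rho sig rho0 cop lo hi; rewrite !mulr1 in lo.
have [v vE] : exists v : nat, v%:Z = 12 * rho%:Z + 4 * sig.
  by exists (absz (12 * rho%:Z + 4 * sig)); lia.
have E k : val_at (rho%:Z, sig) ((12 * k)%N%:Z, (4 * k)%N) = (k * v)%N%:Z.
  by rewrite /val_at /= !PoszM vE; ring.
rewrite /corner_at !E => -[b1 s1] [b2 s2].
have J1 : lbr (sh q P) (sh q Q) = c *: 1.
  by rewrite lbr_sh // PQ linearZ /= rmorph1.
apply: (quartic_edge K0 cop m0 n0 copmn lo hi vE J1 _ _ c0 b1 b2 s1 s2).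
  by apply: bndZ; apply: bnd1.
by rewrite linearZ /= hc1 alg_polyC.
Qed.

Lemma cubic_stage P Q (c l cP cQ : K) : c != 0 -> l != 0 -> cP != 0 -> cQ != 0 ->
  lbr P Q = c *: X_ 1 ->
  bnd (1, 1) (4 * m)%N%:Z P -> bnd (1, 1) (4 * n)%N%:Z Q ->
  hc (1, 1) (4 * m)%N%:Z P = cP *: ('X * ('X - l%:P) ^+ 3) ^+ m ->
  hc (1, 1) (4 * n)%N%:Z Q = cQ *: ('X * ('X - l%:P) ^+ 3) ^+ n ->
  exists (al dP dQ : K), let q := al *: X_ 0 + l *: X_ 1 in
    [/\ bnd (1, 0) m%:Z (sh q P), bnd (1, 0) n%:Z (sh q Q),
        hc (1, 0) m%:Z (sh q P) = dP *: 'X^(3 * m) &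
        hc (1, 0) n%:Z (sh q Q) = dQ *: 'X^(3 * n)].
Proof.
move=> c0 l0 cP0 cQ0 PQ bP bQ hP hQ; set q := l *: X_ 1.
have fq : yfree q by apply/yfreeZ/yfree_mon.
have bq : bnd (1, 1) 1 q by apply: bnd_X.
have hq : hc (1, 1) 1 q = l%:P by rewrite hc_X.
have base (R : A) (k : nat) (cR : K) : cR != 0 -> bnd (1, 1) (4 * k)%N%:Z R ->
    hc (1, 1) (4 * k)%N%:Z R = cR *: ('X * ('X - l%:P) ^+ 3) ^+ k ->
    base_at 1 k%:Z (3 * k) (sh q R).
  move=> cR0 bR hR; have E : val_at (1, 1) (k%:Z, (3 * k)%N) = (4 * k)%N%:Z.
    by rewrite /val_at /= !PoszM; ring.
  have hE : hc (1, 1) (4 * k)%N%:Z (sh q R) = cR *: ('X + l%:P) ^+ k * 'X^(3 * k).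
    rewrite (sh_hc bR bq hq) hR linearZ /= rmorphXn rmorphM /= comp_polyX comp_XsubC.
    by rewrite exprMn -scalerAl -exprM.
  rewrite /base_at E hE; split; first exact: sh_bnd.
    rewrite coefMXn ltnn subnn coefZ -horner_coef0 horner_exp hornerD hornerX hornerC.
    by rewrite add0r mulf_neq0 ?expf_neq0.
  by move=> i lt_i; rewrite coefMXn lt_i.
have J1 : lbr (sh q P) (sh q Q) = c *: X_ 1 by rewrite lbr_sh // PQ linearZ /= sh_x.
have mn2 : (2 < m + n)%N by lia.
have edge (rho : nat) sig : (0 < rho)%N -> coprimez rho%:Z sig -> 0 <= sig -> sig < rho%:Z ->
    corner_at (rho%:Z, sig) m%:Z (3 * m) (sh q P) ->
    corner_at (rho%:Z, sig) n%:Z (3 * n) (sh q Q) ->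
    exists cp cq al : K,
     [/\ hc (rho%:Z, sig) (val_at (rho%:Z, sig) (m%:Z, (3 * m)%N)) (sh q P) =
           cp *: ('X - al%:P) ^+ (3 * m),
         hc (rho%:Z, sig) (val_at (rho%:Z, sig) (n%:Z, (3 * n)%N)) (sh q Q) =
           cq *: ('X - al%:P) ^+ (3 * n)
       & (1 < rho)%N -> al = 0].
  move=> rho0 cop lo hi; have [v vE] : exists v : nat, v%:Z = rho%:Z + 3 * sig.
    by exists (absz (rho%:Z + 3 * sig)); lia.
  have E k : val_at (rho%:Z, sig) (k%:Z, (3 * k)%N) = (k * v)%N%:Z.
    by rewrite /val_at /= !PoszM vE; ring.
  rewrite /corner_at !E => -[b1 s1] [b2 s2].
  apply: (cubic_edge K0 cop m0 n0 copmn mn2 lo hi vE J1 _ _ c0 b1 b2 s1 s2).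
    by apply: bnd_X; rewrite mulr1.
  by rewrite hc_X mulr1 eqxx.
have [] := @walk_step _ A 1 _ _ _ _ _ _ 1 0 (base P m cP cP0 bP hP)
    (base Q n cQ cQ0 bQ hQ) isT isT.
  move=> rho sig rho0 cop lo hi c1 c2; rewrite mul0r mulr1 mul1r in lo hi.
  have [cp [cq [al [hp hq' al0]]]] := edge rho sig rho0 cop (ltW lo) hi c1 c2.
  exists cp, cq; rewrite hp hq' al0 ?subr0 //.
  by lia.
move=> cP1 cQ1; have [cp [cq [al [hp hq' _]]]] := edge 1%N 0 isT isT isT isT cP1 cQ1.
have E k : val_at (1, 0) (k%:Z, (3 * k)%N) = k%:Z by rewrite /val_at /= mul1r mul0r addr0.
move: cP1 cQ1 hp hq'; rewrite /corner_at !E => -[b1 _] [b2 _] hp hq'.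
exists al, cp, cq => /=.
have b0 : bnd (1, 0) 0 (al *: X_ 0) by apply: bnd_X.
have h0 : hc (1, 0) 0 (al *: X_ 0) = al%:P by rewrite hc_X.
rewrite -!shD //; split.
- exact: sh_bnd.
- exact: sh_bnd.
- by rewrite (@sh_hc _ A (1, 0) _ _ _ _ b1 b0 h0) hp linearZ /= comp_XsubC.
- by rewrite (@sh_hc _ A (1, 0) _ _ _ _ b2 b0 h0) hq' linearZ /= comp_XsubC.
Qed.

Lemma linear_stage_step (s : int) P Q g (c cP cQ : K) : - 3 < s -> s <= 1 -> cP != 0 -> cQ != 0 ->
  lbr P Q = c *: (Y_ + g) -> bnd (1, 0) 1 g -> yfree g ->
  bnd (1, s) ((3 + s) * m%:Z) P -> bnd (1, s) ((3 + s) * n%:Z) Q ->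
  hc (1, s) ((3 + s) * m%:Z) P = cP *: 'X^m ->
  hc (1, s) ((3 + s) * n%:Z) Q = cQ *: 'X^n ->
  bnd (1, s - 1) ((3 + (s - 1)) * m%:Z) P /\ bnd (1, s - 1) ((3 + (s - 1)) * n%:Z) Q /\
  (- 3 < s - 1 -> exists dP dQ al : K, [/\ dP != 0, dQ != 0,
     hc (1, s - 1) ((3 + (s - 1)) * m%:Z) P = dP *: ('X - al%:P) ^+ m &
     hc (1, s - 1) ((3 + (s - 1)) * n%:Z) Q = dQ *: ('X - al%:P) ^+ n]).
Proof.
move=> s3 s1 cP0 cQ0 PQ bg fg bP bQ hP hQ.
have E (rho : nat) sig k :
    val_at (rho%:Z, sig) ((3 * k)%N%:Z, k) = (3 * rho%:Z + sig) * k%:Z.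
  by rewrite /val_at /= PoszM; ring.
have base (R : A) (k : nat) (cR : K) : cR != 0 -> bnd (1, s) ((3 + s) * k%:Z) R ->
    hc (1, s) ((3 + s) * k%:Z) R = cR *: 'X^k -> base_at s (3 * k)%N%:Z k R.
  move=> cR0 bR hR; have E' : (3 * k)%N%:Z + s * k%:Z = (3 + s) * k%:Z.
    by rewrite PoszM; ring.
  by apply: (base_monomial cR0); rewrite E'.
have edge (rho : nat) sig : (0 < rho)%N -> coprimez rho%:Z sig -> - 3 * rho%:Z < sig ->
    sig < rho%:Z -> corner_at (rho%:Z, sig) (3 * m)%N%:Z m P ->
    corner_at (rho%:Z, sig) (3 * n)%N%:Z n Q ->
    exists cp cq al : K,
     [/\ hc (rho%:Z, sig) (val_at (rho%:Z, sig) ((3 * m)%N%:Z, m)) P = cp *: ('X - al%:P) ^+ m,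
         hc (rho%:Z, sig) (val_at (rho%:Z, sig) ((3 * n)%N%:Z, n)) Q = cq *: ('X - al%:P) ^+ n
       & (1 < rho)%N -> al = 0].
  move=> rho0 cop lo hi; have [v vE] : exists v : nat, v%:Z = 3 * rho%:Z + sig.
    by exists (absz (3 * rho%:Z + sig)); lia.
  have v0 : (0 < v)%N by lia.
  have E' k : val_at (rho%:Z, sig) ((3 * k)%N%:Z, k) = (k * v)%N%:Z.
    by rewrite E PoszM vE mulrC.
  rewrite /corner_at !E' => -[b1 s1'] [b2 s2].
  apply: (linear_edge K0 cop rho0 m0 n0 copmn v0 PQ _ _ b1 b2 s1' s2 (delta := rho%:Z)).
    apply: bndZ; apply: bndD; first by apply: bnd_Y; apply: ltW.
    move=> a aP; have := bg a aP; rewrite /val_at /= (fg a aP) !mulr0 !addr0 mul1r => a1.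
    by nia.
  have : (4 * v <= (m + n) * v)%N by rewrite leq_mul2r; lia.
  by lia.
have s1' : s - 1 < s * 1 by lia.
have [] := @walk_step _ A s _ _ _ _ _ _ 1 (s - 1) (base P m cP cP0 bP hP)
    (base Q n cQ cQ0 bQ hQ) isT s1'.
  move=> rho sig rho0 cop lo hi c1 c2; rewrite mulr1 in lo.
  have lo3 : - 3 * rho%:Z < sig by nia.
  have hi1 : sig < rho%:Z by nia.
  have [cp [cq [al [hp hq' al0]]]] := edge rho sig rho0 cop lo3 hi1 c1 c2.
  exists cp, cq; rewrite hp hq' al0 ?subr0 //.
  by nia.
move=> cP1 cQ1; have := cP1; have := cQ1; rewrite /corner_at !E mulr1 => -[b2 s2] [b1 s1''].
split=> //; split=> // s31.
have lo : - 3 * 1%N%:Z < s - 1 by lia.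
have hi : s - 1 < 1%N%:Z by lia.
have [cp [cq [al [hp hq' _]]]] := edge 1%N (s - 1) isT (coprime1n _) lo hi cP1 cQ1.
move: hp hq'; rewrite !E mulr1 => hp hq'.
exists cp, cq, al; split=> //.
  by apply: contra_eq_neq s1'' => cp0; rewrite hp cp0 scale0r size_poly0.
by apply: contra_eq_neq s2 => cp0; rewrite hq' cp0 scale0r size_poly0.
Qed.

Lemma linear_stage P Q (c l cP cQ : K) : cP != 0 -> cQ != 0 ->
  lbr P Q = c *: (Y_ + l *: X_ 1) ->
  bnd (1, 1) (4 * m%:Z) P -> bnd (1, 1) (4 * n%:Z) Q ->
  hc (1, 1) (4 * m%:Z) P = cP *: 'X^m -> hc (1, 1) (4 * n%:Z) Q = cQ *: 'X^n ->
  exists c0 c1 c2 : K, let q := c2 *: X_ (- 2) + (c1 *: X_ (- 1) + c0 *: X_ 0) in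
    bnd (1, - 3) 0 (sh q P) /\ bnd (1, - 3) 0 (sh q Q).
Proof.
move=> cP0 cQ0 PQ bP bQ hP hQ.
have step (s : int) (R S g : A) (cR cS : K) : - 2 < s -> s <= 1 -> cR != 0 -> cS != 0 ->
  lbr R S = c *: (Y_ + g) -> bnd (1, 0) 1 g -> yfree g ->
  bnd (1, s) ((3 + s) * m%:Z) R -> bnd (1, s) ((3 + s) * n%:Z) S ->
  hc (1, s) ((3 + s) * m%:Z) R = cR *: 'X^m ->
  hc (1, s) ((3 + s) * n%:Z) S = cS *: 'X^n ->
  exists al dR dS : K, let q := al *: X_ (s - 1) in
   [/\ dR != 0 /\ dS != 0, lbr (sh q R) (sh q S) = c *: (Y_ + (q + g)),
       bnd (1, 0) 1 (q + g) /\ yfree (q + g),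
       bnd (1, s - 1) ((3 + (s - 1)) * m%:Z) (sh q R) /\
       bnd (1, s - 1) ((3 + (s - 1)) * n%:Z) (sh q S) &
       hc (1, s - 1) ((3 + (s - 1)) * m%:Z) (sh q R) = dR *: 'X^m /\
       hc (1, s - 1) ((3 + (s - 1)) * n%:Z) (sh q S) = dS *: 'X^n].
  move=> s3 s1 cR0 cS0 RS bg fg bR bS hR hS.
  have s3' : - 3 < s by lia.
  have [bR1 [bS1 ex]] := linear_stage_step s3' s1 cR0 cS0 RS bg fg bR bS hR hS.
  have [|dR [dS [al [dR0 dS0 hR1 hS1]]]] := ex; first by lia.
  exists al, dR, dS => /=; set q := al *: _.
  have fq : yfree q by apply/yfreeZ/yfree_mon.
  have bq : bnd (1, s - 1) (s - 1) q by apply: bnd_X; rewrite mul1r.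
  have hq : hc (1, s - 1) (s - 1) q = al%:P by rewrite hc_X mul1r eqxx.
  split=> //.
  - by rewrite lbr_sh // RS linearZ /= linearD /= sh_y (sh_yfree _ fg) addrA.
  - split; last exact: yfreeD.
    by apply: bndD => //; apply: bnd_X; rewrite mul1r; lia.
  - by split; apply: sh_bnd.
  - split; first by rewrite (sh_hc bR1 bq hq) hR1 linearZ /= comp_XsubC.
    by rewrite (sh_hc bS1 bq hq) hS1 linearZ /= comp_XsubC.
have fl : yfree (l *: X_ 1) by apply/yfreeZ/yfree_mon.
have bl : bnd (1, 0) 1 (l *: X_ 1) by apply: bnd_X.
have [c0 [d0 [e0 /= [[d00 e00] J0 [bg0 fg0] [bP0 bQ0] [hP0 hQ0]]]]] :=
  step 1 P Q _ cP cQ isT isT cP0 cQ0 PQ bl fl bP bQ hP hQ.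
have [c1 [d1 [e1 /= [[d10 e10] J1 [bg1 fg1] [bP1 bQ1] [hP1 hQ1]]]]] :=
  step 0 _ _ _ d0 e0 isT isT d00 e00 J0 bg0 fg0 bP0 bQ0 hP0 hQ0.
have [c2 [d2 [e2 /= [[d20 e20] J2 [bg2 fg2] [bP2 bQ2] [hP2 hQ2]]]]] :=
  step (- 1) _ _ _ d1 e1 isT isT d10 e10 J1 bg1 fg1 bP1 bQ1 hP1 hQ1.
have [bP3 [bQ3 _]] :=
  @linear_stage_step (- 2) _ _ _ c d2 e2 isT isT d20 e20 J2 bg2 fg2 bP2 bQ2 hP2 hQ2.
exists c0, c1, c2 => /=.
move: bP3 bQ3; have -> k : (3 + (- 2 - 1)) * k%:Z = 0 :> int by rewrite mul0r.
have fc (e : K) i : yfree (e *: X_ i) by apply/yfreeZ/yfree_mon.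
have E (R : A) : sh (c2 *: X_ (- 2)) (sh (c1 *: X_ (- 1)) (sh (c0 *: X_ 0) R)) =
    sh (c2 *: X_ (- 2) + (c1 *: X_ (- 1) + c0 *: X_ 0)) R.
  by rewrite (shD (c1 *: _)) // shD //; apply: yfreeD.
by rewrite -!E.
Qed.

End Stages.

Section Swap.
Variables (K : fieldType) (A : laurentAlg K).
Implicit Types (P Q H : A).
Local Notation mon := (mon A).
Local Notation X_ i := (mon (i, 0%N)).
Local Notation Y_ := (mon (0, 1%N)).

Lemma swpM P Q : lpoly P -> lpoly Q -> swp (P * Q) = swp P * swp Q.
Proof.
move=> pP pQ; rewrite mulE (linear_sum (@swp K A)) [swp P](linear_lext) /lext mulr_suml.
apply: eq_big_seq => -[i j]; rewrite mem_supp => /(lpolyP pP) /= i0.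
rewrite (linear_sum (@swp K A)) [swp Q](linear_lext) /lext mulr_sumr.
apply: eq_big_seq => -[i' j']; rewrite mem_supp => /(lpolyP pQ) /= i'0.
rewrite (linearZZ (@swp K A)) /= !swp_mon -scalerAl -scalerAr scalerA monD /=.
by congr (_ *: mon (_, _)); rewrite /=; lia.
Qed.

Lemma lpoly_mon i j : lpoly (mon (i%:Z, j)).
Proof. by apply: bnd_mon; rewrite /val_at /=; lia. Qed.

Lemma lpolyX P k : lpoly P -> lpoly (P ^+ k).
Proof. by move=> pP; rewrite /lpoly -[X in bnd _ X](mulr0 k%:Z); apply: bndX. Qed.

Lemma swpX P k : lpoly P -> swp (P ^+ k) = swp P ^+ k.
Proof.
move=> pP; elim: k => [|k IHk]; first by rewrite !expr0 -(mon0 A) swp_mon.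
by rewrite !exprS swpM ?IHk //; apply: lpolyX.
Qed.

Lemma hc_swp d k P H : lpoly P -> lpoly H -> bnd (d.2, d.1) (k - 1) (P - H) ->
  hc d k (swp P) = hc d k (swp H).
Proof.
move=> pP pH b; have -> : swp P = swp (P - H) + swp H.
  by rewrite -[in LHS](subrK H P); exact: linearD.
have pPH : lpoly (P - H) by apply: bndB.
rewrite linearD /= (hc_out (bnd_swp pPH b)) ?add0r //.
by rewrite ltrBlDr ltrDl.
Qed.

Lemma swap_stage P (c d l : K) k : l != 0 -> lpoly P ->
  bnd (1, 0) k%:Z P -> hc (1, 0) k%:Z P = d *: 'X^(3 * k) ->
  bnd (1, 1) (4 * k%:Z) P ->
  hc (1, 1) (4 * k%:Z) P = c *: (('X + l%:P) * 'X^3) ^+ k ->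
  let R := sh (- l^-1 *: X_ 1) (swp P) in
  [/\ lpoly R, bnd (1, 1) (4 * k%:Z) R, hc (1, 1) (4 * k%:Z) R = (c * l ^+ k) *: 'X^k,
      bnd (0, 1) k%:Z R & forall i, coef (i, k) R != 0 -> i = (3 * k)%N%:Z].
Proof.
move=> l0 pP b10 h10 b11 h11 /=; set q := - l^-1 *: X_ 1; set R := sh q _.
have bq : bnd (1, 1) 1 q by apply: bnd_X.
have hq : hc (1, 1) 1 q = (- l^-1)%:P by rewrite hc_X.
have bS : bnd (0, 1) k%:Z (swp P) by apply: bnd_swp.
have bS1 : bnd (1, 1) (4 * k%:Z) (swp P) by apply: bnd_swp.
have bq0 : bnd (0, 1) 0 q by apply: bnd_X; rewrite mul0r.
pose H : A := c *: ((Y_ + l *: X_ 1) * mon (0, 3)) ^+ k.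
have b1 : bnd (1, 1) 1 (Y_ + l *: X_ 1) by apply: bndD; [apply: bnd_Y | apply: bnd_X].
have b3 : bnd (1, 1) 3 (mon (0, 3)) by apply: bnd_mon.
have pYX : lpoly (Y_ + l *: X_ 1).
  by apply: bndD; [apply: bnd_mon | apply/bndZ/bnd_mon].
have pY3 : lpoly (mon (0, 3)) by apply: bnd_mon.
have pYX3 : lpoly ((Y_ + l *: X_ 1) * mon (0, 3)) by apply: lpolyM.
have pH : lpoly H by apply/bndZ/lpolyX.
have bH : bnd (1, 1) (4 * k%:Z) H by rewrite mulrC; apply/bndZ/bndX/(bndM b1 b3).
have hH : hc (1, 1) (4 * k%:Z) H = hc (1, 1) (4 * k%:Z) P.
  rewrite h11 /H linearZ /= mulrC (hcX _ (bndM b1 b3)) (hcM b1 b3).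
  by rewrite linearD /= (@hc_Y _ A (1, 1)) hc_X /= hc_mon /=.
have bPH : bnd (1, 1) (4 * k%:Z - 1) (P - H).
  apply: bnd_pred => //; first exact: bndB.
  by rewrite linearB /= hH subrr.
split.
- by apply: sh_bnd; [apply: swp_lpoly | apply: bnd_X].
- exact: sh_bnd.
- rewrite (sh_hc bS1 bq hq) (@hc_swp (1, 1) _ _ _ pP pH bPH) /H linearZ /= swpX // swpM //.
  have -> : swp (Y_ + l *: X_ 1) = X_ 1 + l *: Y_.
    rewrite [LHS]linearD /=; congr (_ + _); first by rewrite swp_mon.
    by rewrite linearZ /= swp_mon.
  rewrite swp_mon /= linearZ /=.
  have b1' : bnd (1, 1) 1 (X_ 1 + l *: Y_).
    by apply: bndD; [apply: bnd_mon | apply/bndZ/bnd_Y].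
  have b3' : bnd (1, 1) 3 (X_ 3) by apply: bnd_mon.
  rewrite [4 * _]mulrC (hcX _ (bndM b1' b3')) (hcM b1' b3') linearD linearZ /=.
  rewrite !hc_mon /= !expr0 mulr1 linearZ /= hc_mon /= expr1 rmorphXn /=.
  have -> : (1 + l *: 'X) \Po ('X + (- l^-1)%:P) = l *: 'X.
    rewrite comp_polyD comp_polyZ comp_polyX -[1 : {poly K}]/(1%:P) comp_polyC scalerDr.
    by rewrite -(mul_polyC l (_%:P)) -polyCM mulrN divff // polyCN addrCA addrN addr0.
  by rewrite exprZn scalerA.
- by apply: sh_bnd => //; apply: bndW bq0.
move=> i; have sub : bnd (0, 1) (k%:Z - 1) (R - swp P) by apply: sh_sub; rewrite //= subrr.
have -> : coef (i, k) R = coef (i, k) (swp P).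
  apply/eqP; rewrite -subr_eq0 -cfB; apply: contraT => /sub.
  by rewrite /val_at /= mul0r add0r mul1r; lia.
move=> iP; have := lpolyP (@swp_lpoly _ _ P) iP; case: i iP => // i iP _.
move: iP; rewrite coef_swp // -(@coef_hc _ A (1, 0) k%:Z); last 2 first.
- exact: oner_neq0.
- by rewrite /val_at /= mul1r mul0r addr0.
by rewrite h10 coefZ coefXn /=; case: (eqVneq i (3 * k)%N) => [->//|]; rewrite mulr0 eqxx.
Qed.

End Swap.

Section Critical.
Variables (K : closedFieldType) (K0 : [pchar K] =i pred0) (A : laurentAlg K).
Implicit Types (P Q g R S q : A).
Local Notation mon := (mon A).
Local Notation X_ i := (mon (i, 0%N)).
Local Notation Y_ := (mon (0, 1%N)).

Lemma x_bound P : exists N : nat, forall a, coef a P != 0 -> a.1 < N%:Z.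
Proof.
exists (\sum_(a <- supp P) `|a.1|).+1%N => a; rewrite -mem_supp => aP.
rewrite (big_rem a) //=; move: (\sum_(_ <- _) _)%N => B; case: a {aP} => -[i|i] j /=; lia.
Qed.

Definition tail (c0 c1 c2 : K) : A := c2 *: X_ (- 1) + (c1 *: X_ (- 2) + c0 *: X_ (- 3)).

Lemma bnd_tail d (c0 c1 c2 : K) k : - d.1 <= k -> 0 <= d.1 -> bnd d k (tail c0 c1 c2).
Proof.
case: d => x y /= le x0; rewrite /tail.
by apply: bndD; [|apply: bndD]; apply: bnd_X => /=; lia.
Qed.

Lemma hc_tail_pos d (c0 c1 c2 : K) : 0 <= d.1 -> 0 < d.2 -> hc d d.2 (tail c0 c1 c2) = 0.
Proof.
by move=> d1 d2; apply: (hc_out (k := 0)) => //; apply: bnd_tail; rewrite // oppr_le0.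
Qed.

Lemma hc_sh_tail (rho sig k : int) R (c0 c1 c2 : K) : 0 <= rho -> 0 < sig ->
  bnd (rho, sig) k R -> hc (rho, sig) k (sh (tail c0 c1 c2) R) = hc (rho, sig) k R.
Proof.
move=> r0 s0 bR; rewrite (@sh_hc _ A (rho, sig) _ 0) //.
- by rewrite polyC0 addr0 comp_polyXr.
- by apply: bnd_tail; rewrite //=; lia.
- by rewrite polyC0; apply: hc_tail_pos.
Qed.

Lemma yfree_tail (c0 c1 c2 : K) : yfree (tail c0 c1 c2).
Proof. by apply: yfreeD; [|apply: yfreeD]; apply/yfreeZ/yfree_mon. Qed.

Lemma sh_tailK (c0 c1 c2 : K) R : sh (- tail c0 c1 c2) (sh (tail c0 c1 c2) R) = R.
Proof. by rewrite shD ?addNr ?sh0 //; apply: yfree_tail. Qed.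

Lemma bnd_sh_tail (rho sig k : int) R (c0 c1 c2 : K) : 0 <= rho -> - rho <= sig ->
  bnd (rho, sig) k (sh (tail c0 c1 c2) R) <-> bnd (rho, sig) k R.
Proof.
move=> r0 s0; split=> b; last first.
  by apply: sh_bnd => //; apply: bnd_tail.
rewrite -[R](sh_tailK c0 c1 c2); apply: sh_bnd => //; rewrite -scaleN1r; apply: bndZ.
exact: bnd_tail.
Qed.

Lemma row_base P k N : lpoly P -> bnd (0, 1) k%:Z P ->
  (forall i, coef (i, k) P != 0 -> i = 0) -> coef (0, k) P != 0 ->
  (forall a, coef a P != 0 -> a.1 < N%:Z) -> base_at N%:Z 0 k P.
Proof.
move=> pP b01 row top xN.
have v0 : val_at (1, N%:Z) (0, k) = N%:Z * k%:Z by rewrite /val_at /= mul1r add0r.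
have le a : coef a P != 0 -> (a.2 <= k)%N.
  by move=> /b01; rewrite /val_at /= mul0r add0r mul1r.
have lt a : coef a P != 0 -> (a.2 < k)%N -> val_at (1, N%:Z) a < N%:Z * k%:Z.
  by move=> /xN; case: a => i j; rewrite /val_at /= mul1r => lti ltj; nia.
rewrite /base_at v0; split.
- move=> a aP; have := le a aP; rewrite leq_eqVlt => /predU1P[E|/(lt a aP)/ltW//].
  case: a E aP => i j /= -> aP.
  by rewrite (row i) // v0.
- by rewrite (@coef_hc _ A (1, N%:Z) _ P (0, k)) // oner_eq0.
move=> i lti; apply/eqP; apply: contraT => /hc_coef[a [aP av ai]].
by have := lt a aP; rewrite ai av ltxx => /(_ lti).
Qed.

Lemma low_zero (rho sig v : int) R : 0 < rho -> 0 < v -> bnd (1, - 3) 0 R ->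
  (hc (rho, sig) v R)`_0 = 0.
Proof.
move=> r0 v0 bR; apply/eqP; apply: contraT => /hc_coef[[i j] [aR av /= j0]].
have := bR _ aR; move: av; rewrite /val_at /= j0 !mulr0 !addr0 mul1r => av i0.
by nia.
Qed.

Lemma mup0_coef (p : {poly K}) : p != 0 -> p`_0 = 0 -> (0 < mup 0 p)%N.
Proof. by move=> p0 pz; rewrite -XsubC_dvd // dvdp_XsubCl rootE horner_coef0 pz. Qed.

Lemma mup0_1 (p : {poly K}) : p != 0 -> mup 0 p = 1%N -> p`_1 != 0.
Proof.
move=> p0 E; have [q q0] := mup_dec 0 p0; rewrite E expr1 subr0 => ->.
by rewrite coefXM /= -horner_coef0.
Qed.

Lemma bnd_scale (c x y k : int) R : 0 < c -> bnd (c * x, c * y) (c * k) R ->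
  bnd (x, y) k R.
Proof.
move=> c0 bR a /bR; rewrite /val_at /= -!mulrA -mulrDr ler_pM2l //.
Qed.

Lemma wronsk_coef1 (a b : int) (p q : {poly K}) : p`_0 = 0 -> q`_0 = 0 ->
  (wronsk a b p q)`_1 = (a - b)%:~R * (p`_1 * q`_1).
Proof.
move=> p0 q0; rewrite /wronsk coefB !coefZ !coefM !big_ord_recl !big_ord0 /=.
by rewrite !coef_deriv /bump /= p0 q0 !mulr1n intrB; ring.
Qed.

Lemma critical_exponents (m n : nat) (a b : int) : (1 < n)%N -> (n < m)%N ->
  (m%:Z + n%:Z - 2) * a + 5 = 5 * m%:Z -> (m%:Z + n%:Z - 2) * b + 5 = 5 * n%:Z ->
  a <= 3 -> b <= 3 -> [/\ a = 3, b = 2, m = (3 * (m - n) + 1)%N & n = (2 * (m - n) + 1)%N].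
Proof.
move=> n1 nm Ea Eb a3 b3; have r0 : 0 < m%:Z + n%:Z - 2 by lia.
have ab : a + b = 5 by apply: (mulfI (lt0r_neq0 r0)); rewrite mulrDr; lia.
have ba : b < a by rewrite -(ltr_pM2l r0); lia.
have aE : a = 3 by lia.
have bE : b = 2 by lia.
by subst a b; split=> //; lia.
Qed.

(* In the direction proportional to [(m + n - 2, 5)] the bracket of the leading
   forms is [k x^4 y]; comparing the lowest exponents of [y] forces them to be 1
   in both leading forms, hence the exponents [(3, 1)] and [(2, 1)]. *)
Lemma critical_stage m n R S g (k c0 c1 c2 : K) : (1 < m)%N -> (n < m)%N ->
  (1 < n)%N -> coprime m n -> k != 0 ->
  bnd (1, - 3) 0 R -> bnd (1, - 3) 0 S ->
  bnd (0, 1) m%:Z R -> bnd (0, 1) n%:Z S ->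
  (forall i, coef (i, m) R != 0 -> i = 0) -> (forall i, coef (i, n) S != 0 -> i = 0) ->
  coef (0, m) R != 0 -> coef (0, n) S != 0 ->
  let P := sh (tail c0 c1 c2) R in let Q := sh (tail c0 c1 c2) S in
  lpoly P -> lpoly Q -> lbr P Q = k *: (mon (4, 1%N) + g) -> yfree g -> bnd (1, 0) 3 g ->
  exists j : nat, [/\ (0 < j)%N, m = (3 * j + 1)%N, n = (2 * j + 1)%N,
    bnd (j%:Z, 1) m%:Z R /\ bnd (j%:Z, 1) n%:Z S &
    coef (3, 1%N) R * coef (2, 1%N) S = k].
Proof.
move=> m1 nm n1 cop k0 bR bS yR yS rowR rowS topR topS P Q pP pQ PQ fg bg.
have m0 := ltnW m1; have n0 := ltnW n1.
have rowE (T : A) (j : nat) : bnd (0, 1) j%:Z T -> forall i,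
    coef (i, j) (sh (tail c0 c1 c2) T) = coef (i, j) T.
  move=> bT i; have sub : bnd (0, 1) (j%:Z - 1) (sh (tail c0 c1 c2) T - T).
    by apply: sh_sub; rewrite //= subrr; apply: bnd_tail; rewrite /= ?oppr0.
  apply/eqP; rewrite -subr_eq0 -cfB; apply: contraT => /sub.
  by rewrite /val_at /= mul0r add0r mul1r; lia.
have [N1 xP] := x_bound P; have [N2 xQ] := x_bound Q.
pose N := (N1 + N2 + 6)%N.
have bP : base_at N%:Z 0 m P.
  apply: row_base => //; first by apply/bnd_sh_tail; rewrite //= oppr0.
  - by move=> i; rewrite /P rowE //; apply: rowR.
  - by rewrite /P rowE.
  - by move=> a /xP; rewrite /N; lia.
have bQ : base_at N%:Z 0 n Q.
  apply: row_base => //; first by apply/bnd_sh_tail; rewrite //= oppr0.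
  - by move=> i; rewrite /Q rowE //; apply: rowS.
  - by rewrite /Q rowE.
  - by move=> a /xQ; rewrite /N; lia.
have bJ (rho sig : int) : 0 <= rho -> 0 <= sig ->
    bnd (rho, sig) (4 * rho + sig) (k *: (mon (4, 1%N) + g)).
  move=> r0 s0; apply: bndZ; apply: bndD; first by apply: bnd_mon; rewrite /val_at /=; lia.
  move=> a ag; have := bg a ag; rewrite /val_at /= (fg a ag) !mulr0 !addr0 mul1r.
  by move=> a3; nia.
have E rho sig j : val_at (rho, sig) (0, j) = sig * j%:Z by rewrite /val_at /= mulr0 add0r.
pose rho0 := (m + n - 2)%N.
have rho00 : (0 < rho0)%N by rewrite /rho0; lia.
have lt5 : 5 < N%:Z * rho0%:Z by rewrite /N /rho0; nia.
have [] := walk_step bP bQ rho00 lt5.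
  move=> rho sig rho_gt0 coprs lo hi; rewrite /corner_at !E => -[b1 s1] [b2 s2].
  have sig0 : 0 < sig by nia.
  have [v vE] : exists v : nat, sig = v%:Z by exists (absz sig); lia.
  have rs : (0 : int) <= rho%:Z by [].
  have v0 : (0 < v)%N by lia.
  have Ev j : sig * j%:Z = (j * v)%N%:Z by rewrite vE PoszM mulrC.
  rewrite !Ev in b1 s1 b2 s2 *.
  have lt : 4 * rho%:Z + sig < ((m + n) * v)%N%:Z - rho%:Z - sig.
    by move: lo; rewrite /rho0 vE; lia.
  have [cp [cq [al [hp hq _]]]] := linear_edge K0 coprs rho_gt0 m0 n0 cop v0 PQ
    (bJ _ _ rs (ltW sig0)) lt b1 b2 s1 s2.
  suff al0 : al = 0 by exists cp, cq; rewrite hp hq al0 subr0.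
  have bR1 : bnd (rho%:Z, sig) (m * v)%N%:Z R.
    by apply/(@bnd_sh_tail _ _ _ _ c0 c1 c2); rewrite //; lia.
  have rhoZ : 0 < rho%:Z by rewrite ltz_nat.
  have vm : 0 < (m * v)%N%:Z by rewrite ltz_nat muln_gt0 m0.
  have := low_zero sig rhoZ vm bR; rewrite -(hc_sh_tail c0 c1 c2 rs sig0 bR1) -/P hp.
  move/eqP; rewrite coefZ mulf_eq0 => /orP[/eqP cp0|].
    by move: s1; rewrite hp cp0 scale0r size_poly0.
  by rewrite -horner_coef0 horner_exp hornerXsubC expf_eq0 sub0r oppr_eq0 => /andP[_ /eqP].
rewrite /corner_at !E => -[b1 s1] [b2 s2].
have rs : (0 : int) <= rho0%:Z by [].
have rhoZ : 0 < rho0%:Z by rewrite ltz_nat.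
have bR1 : bnd (rho0%:Z, 5) (5 * m%:Z) R by apply/(@bnd_sh_tail _ _ _ _ c0 c1 c2); rewrite //; lia.
have bS1 : bnd (rho0%:Z, 5) (5 * n%:Z) S by apply/(@bnd_sh_tail _ _ _ _ c0 c1 c2); rewrite //; lia.
have hR := hc_sh_tail c0 c1 c2 rs (isT : 0 < 5 :> int) bR1.
have hS := hc_sh_tail c0 c1 c2 rs (isT : 0 < 5 :> int) bS1.
have W := hc_lbr b1 b2; rewrite PQ in W.
move: s1 s2 W; rewrite /P /Q hR hS => s1 s2 W.
set p := hc _ _ R in hR s1 W; set q := hc _ _ S in hS s2 W.
have p0 : p != 0 by rewrite -size_poly_gt0 s1.
have q0 : q != 0 by rewrite -size_poly_gt0 s2.
have pz : p`_0 = 0 by apply: low_zero => //; lia.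
have qz : q`_0 = 0 by apply: low_zero => //; lia.
have lev : 5 * m%:Z + 5 * n%:Z - rho0%:Z - 5 = 4 * rho0%:Z + 5.
  by rewrite /rho0; lia.
have hJ : hc (rho0%:Z, 5) (4 * rho0%:Z + 5) (k *: (mon (4, 1%N) + g)) = k *: 'X.
  rewrite linearZ /= linearD /= hc_mon /val_at /= mulr1 mulrC eqxx expr1.
  rewrite (hc_out (k := 3 * rho0%:Z)) ?addr0 //; last by lia.
  move=> a ag; have := bg a ag; rewrite /val_at /= (fg a ag) !mulr0 !addr0 mul1r.
  by move=> a3; nia.
rewrite /= lev hJ scalerA in W; set ka := _ * k in W.
have ka0 : ka != 0 by rewrite /ka mulf_neq0 // (intK_eq0 K0) gt_eqF.
have mupX : mup 0 (ka *: 'X) = 1%N.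
  by rewrite -mul_polyC mupMr ?rootC // -['X]subr0 (@mup_XsubCX _ 1) eqxx.
have Wn0 : wronsk (5 * m%:Z) (5 * n%:Z) p q != 0.
  by rewrite -W scaler_eq0 negb_or ka0 polyX_eq0.
have := @mup_wronsk _ K0 (5 * m%:Z) (5 * n%:Z) p q 0 p0 q0 Wn0.
rewrite -W mupX; have mp := mup0_coef p0 pz; have mq := mup0_coef q0 qz.
case: ifP => _; first by lia.
move=> mpq; have p1 : mup 0 p = 1%N by lia.
have q1 : mup 0 q = 1%N by lia.
have p10 := mup0_1 p0 p1; have q10 := mup0_1 q0 q1.
have [[a a2] [aR av /= aj]] := hc_coef p10; subst a2.
have [[b b2'] [bS' bv /= bj]] := hc_coef q10; subst b2'.
have a3 : a <= 3 by have := bR _ aR; rewrite /val_at /= mul1r mulr1 subr_le0.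
have b3 : b <= 3 by have := bS _ bS'; rewrite /val_at /= mul1r mulr1 subr_le0.
have rhoE : rho0%:Z = m%:Z + n%:Z - 2.
  by rewrite /rho0 -PoszD subzn //; clear -m1 n1; lia.
move: av bv; rewrite /val_at /= !mulr1 rhoE => av bv.
have [aE bE mE nE] := critical_exponents n1 nm av bv a3 b3.
subst a b; exists (m - n)%N.
have rho5 : rho0 = (5 * (m - n))%N by rewrite /rho0; clear -mE nE nm; lia.
have red (T : A) (j : nat) : bnd (rho0%:Z, 5) (5 * j%:Z) T -> bnd ((m - n)%N%:Z, 1) j%:Z T.
  by move=> bT; apply: (@bnd_scale 5); rewrite // mulr1 -PoszM -rho5.
split=> //; first by rewrite subn_gt0.
  by split; apply: red.
have := congr1 (fun f : {poly K} => f`_1) W.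
rewrite /= coefZ coefX mulr1 wronsk_coef1 //.
rewrite (@coef_hc _ A (rho0%:Z, 5) _ R (3, 1%N)) ?gt_eqF //; last first.
  by rewrite /val_at /= mulr1 rhoE.
rewrite (@coef_hc _ A (rho0%:Z, 5) _ S (2, 1%N)) ?gt_eqF //; last first.
  by rewrite /val_at /= mulr1 rhoE.
have -> : 5 * m%:Z - 5 * n%:Z = rho0%:Z by rewrite rho5 PoszM -subzn ?mulrBr // ltnW.
by move=> kE; apply: (@mulfI _ (rho0%:Z%:~R : K)); rewrite ?(intK_eq0 K0) ?gt_eqF.
Qed.

Lemma final_form (j a : nat) R (c0 c1 c2 : K) : (1 < a)%N -> (a < 4)%N ->
  bnd (1, - 3) 0 R -> bnd (j%:Z, 1) (j * a + 1)%N%:Z R -> (0 < j)%N ->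
  let P := sh (tail c0 c1 c2) R in
  [/\ bnd (1, - 1) (a%:Z - 1) P, bnd (j%:Z, 1) (j * a + 1)%N%:Z P &
      hc (1, - 1) (a%:Z - 1) P = coef (a%:Z, 1%N) R *: ('X + c2%:P)].
Proof.
move=> a1 a4 bR jR j0 P.
have pt i b : coef (i, b) R != 0 -> i - b%:Z < a%:Z - 1 \/ (i = a%:Z /\ b = 1%N).
  move=> cR; have := bR _ cR; have := jR _ cR; rewrite /val_at /= PoszD PoszM !mul1r.
  have [->|b0] := posnP b; first by move=> _ i0; left; lia.
  move=> le _; have ia : i <= a%:Z.
    by rewrite -(@ler_pM2l _ j%:Z) ?ltz_nat //; lia.
  by have [->|nb] := eqVneq b 1%N; lia.
have b11 : bnd (1, - 1) (a%:Z - 1) R.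
  by move=> -[i b] /pt; rewrite /val_at /= mul1r mulN1r => -[/ltW//|[-> ->]].
have h11 : hc (1, - 1) (a%:Z - 1) R = coef (a%:Z, 1%N) R *: 'X.
  apply/polyP=> i; rewrite coefZ coefX; have [->|ni] := eqVneq i 1%N.
    by rewrite mulr1 (@coef_hc _ A (1, - 1) _ R (a%:Z, 1%N)) ?oner_eq0 // /val_at /= mul1r.
  rewrite mulr0; apply/eqP; apply: contraT => /hc_coef[[x b] [cR cv /= bi]].
  by have := pt _ _ cR; move: cv; rewrite /val_at /= mul1r mulN1r; move/eqP: ni; lia.
split.
- by apply/bnd_sh_tail.
- by apply/bnd_sh_tail => //; lia.
rewrite (@sh_hc _ A (1, - 1) _ c2) //.
- by rewrite h11 linearZ /= comp_polyX.
- exact: bnd_tail.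
by rewrite /tail !linearD /= !hc_X /= !addr0.
Qed.

End Critical.

Section Binomials.
Variables (K : fieldType) (A : laurentAlg K).
Implicit Types (P Q g q : A).
Local Notation mon := (mon A).
Local Notation X_ i := (mon (i, 0%N)).
Local Notation Y_ := (mon (0, 1%N)).

Lemma hc_binomial (d : int * int) (k : int) a b (l : K) : val_at d a = k -> val_at d b = k ->
  hc d k (mon a - l *: mon b) = 'X^(a.2) - l *: 'X^(b.2).
Proof. by move=> ak bk; rewrite linearB linearZ /= !hc_mon ak bk eqxx. Qed.

Lemma bnd_binomial d (k : int) a b (l : K) : val_at d a = k -> val_at d b = k ->
  bnd d k (mon a - l *: mon b).
Proof. by move=> ak bk; apply: bndB; [|apply: bndZ]; apply: bnd_mon; rewrite ?ak ?bk. Qed.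

Lemma lpoly_binomial (i i' j j' : nat) (l : K) :
  lpoly (mon (i%:Z, j) - l *: mon (i'%:Z, j')).
Proof. by apply: bndB; [|apply: bndZ]; apply: lpoly_mon. Qed.

Lemma hc_swp_R1 P (c l : K) (k : nat) : lpoly P ->
  bnd (-2, 1) (k%:Z - 1) (P - c *: (Y_ * (mon (1, 2%N) - l *: X_ 0)) ^+ k) ->
  hc (1, -2) k%:Z (swp P) = c *: ('X - l%:P) ^+ k.
Proof.
move=> pP b; set H := _ *: _ in b.
have pB : lpoly (mon (1, 2%N) - l *: X_ 0) by apply: (@lpoly_binomial 1 0).
have pY : lpoly Y_ by apply: (@lpoly_mon _ _ 0).
have pH : lpoly H by apply/bndZ/lpolyX/lpolyM.
rewrite (@hc_swp _ _ (1, -2) _ _ _ pP pH b) /H linearZ /=.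
rewrite swpX ?swpM //; last exact: lpolyM.
have -> : swp (mon (1, 2%N) - l *: X_ 0) = mon (2, 1%N) - l *: X_ 0.
  by rewrite linearB linearZ /= !swp_mon.
have -> : swp Y_ = X_ 1 by rewrite swp_mon.
have bX : bnd (1, -2) 1 (X_ 1) by apply: bnd_mon.
have bB : bnd (1, -2) 0 (mon (2, 1%N) - l *: X_ 0) by apply: bnd_binomial.
rewrite linearZ /=; have := hcX k (bndM bX bB); rewrite addr0 mulr1 => ->.
have := hcM bX bB; rewrite addr0 => ->.
by rewrite hc_binomial // hc_mon /= mul1r expr1 expr0 alg_polyC.
Qed.

Lemma hc_swp_R0 P (c l : K) (k : nat) : lpoly P ->
  bnd (4, -1) (4 * k%:Z - 1) (P - c *: (X_ 1 * (mon (1, 4%N) - l *: X_ 0) ^+ 3) ^+ k) ->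
  hc (-1, 4) (4 * k%:Z) (swp P) = c *: ('X * ('X - l%:P) ^+ 3) ^+ k.
Proof.
move=> pP b; set H := _ *: _ in b.
have pB : lpoly (mon (1, 4%N) - l *: X_ 0) by apply: (@lpoly_binomial 1 0).
have pB3 := @lpolyX _ _ _ 3 pB.
have pX : lpoly (X_ 1) by apply: (@lpoly_mon _ _ 1).
have pH : lpoly H by apply/bndZ/lpolyX/lpolyM.
rewrite (@hc_swp _ _ (-1, 4) _ _ _ pP pH b) /H linearZ /=.
rewrite swpX; last exact: lpolyM.
rewrite (swpM pX pB3) (@swpX _ _ _ 3 pB).
have -> : swp (mon (1, 4%N) - l *: X_ 0) = mon (4, 1%N) - l *: X_ 0.
  by rewrite linearB linearZ /= !swp_mon.
have -> : swp (X_ 1) = Y_ by rewrite swp_mon.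
have bY : bnd (-1, 4) 4 Y_ by apply: bnd_mon.
have bB : bnd (-1, 4) 0 (mon (4, 1%N) - l *: X_ 0) by apply: bnd_binomial.
have bB3 := @bndX _ _ _ _ _ 3 bB; rewrite mulr0 in bB3.
rewrite linearZ /=; have := hcX k (bndM bY bB3); rewrite addr0 mulrC => ->.
have := hcM bY bB3; rewrite addr0 => ->.
have := @hcX _ _ _ _ _ 3 bB; rewrite mulr0 => ->.
by rewrite hc_binomial // hc_mon /= expr1 expr0 alg_polyC.
Qed.

End Binomials.

Section Reduction.
Variables (K : closedFieldType) (K0 : [pchar K] =i pred0) (A : laurentAlg K).
Implicit Types (P Q g q : A).
Local Notation mon := (mon A).
Local Notation X_ i := (mon (i, 0%N)).
Local Notation Y_ := (mon (0, 1%N)).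

Theorem reduction m n P0 Q0 (c l0 l1 lP lQ : K) :
  (1 < n)%N -> (n < m)%N -> coprime m n ->
  c != 0 -> l0 != 0 -> lP != 0 -> lQ != 0 ->
  lpoly P0 -> lpoly Q0 -> lbr P0 Q0 = c *: 1 ->
  bnd (-2, 1) (4 * m)%N%:Z P0 -> bnd (-2, 1) (4 * n)%N%:Z Q0 ->
  bnd (4, -1) (4 * m%:Z) P0 -> bnd (4, -1) (4 * n%:Z) Q0 ->
  bnd (-2, 1) ((4 * m)%N%:Z - 1) (P0 - lP *: (Y_ * (mon (1, 2%N) - l1 *: X_ 0)) ^+ (4 * m)) ->
  bnd (-2, 1) ((4 * n)%N%:Z - 1) (Q0 - lQ *: (Y_ * (mon (1, 2%N) - l1 *: X_ 0)) ^+ (4 * n)) ->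
  bnd (4, -1) (4 * m%:Z - 1) (P0 - lP *: (X_ 1 * (mon (1, 4%N) - l0 *: X_ 0) ^+ 3) ^+ m) ->
  bnd (4, -1) (4 * n%:Z - 1) (Q0 - lQ *: (X_ 1 * (mon (1, 4%N) - l0 *: X_ 0) ^+ 3) ^+ n) ->
  exists (j : nat) (q1 q2 q3 q4 : A) (r s mu0 mu1 mu2 mu3 : K),
  let P2 := sh q2 (psi (sh q1 (swp P0))) in let Q2 := sh q2 (psi (sh q1 (swp Q0))) in
  let P6 := r *: psi (sh q4 (sh q3 (swp P2))) in
  let Q6 := s *: psi (sh q4 (sh q3 (swp Q2))) in
  [/\ [/\ (0 < j)%N, m = (3 * j + 1)%N & n = (2 * j + 1)%N],
      [/\ yfree q1, yfree q2, yfree q3 & yfree q4],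
      [/\ r != 0, s != 0, mu0 != 0 & [/\ lpoly P2, lpoly Q2, lpoly P6 & lpoly Q6]],
      lbr P6 Q6 = mon (4, 1%N) + mu0 *: 1 + mu1 *: X_ 1 + mu2 *: X_ 2 + mu3 *: X_ 3 &
      [/\ bnd (1, - 1) 2 P6 /\ bnd (1, - 1) 1 Q6,
          hc (1, - 1) 2 P6 = 'X + mu3%:P /\ hc (1, - 1) 1 Q6 = 'X + mu3%:P,
          bnd (j%:Z, 1) m%:Z P6 /\ bnd (j%:Z, 1) n%:Z Q6 &
          coef (0, m) P6 != 0 /\ coef (0, n) Q6 != 0]].
Proof.
move=> n1 nm copmn c0 l00 lP0 lQ0 pP pQ PQ bP1 bQ1 bP0 bQ0 eP1 eQ1 eP0 eQ0.
have m1 : (1 < m)%N by apply: ltn_trans nm.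
have shZ q k (T : A) : sh q (k *: T) = k *: sh q T by exact: linearZZ.
have psiZ k (T : A) : psi (k *: T) = k *: psi T by exact: linearZZ.
have swpZ k (T : A) : swp (k *: T) = k *: swp T by exact: linearZZ.
have shDr q (S T : A) : sh q (S + T) = sh q S + sh q T by exact: linearD.
have psiD (S T : A) : psi (S + T) = psi S + psi T by exact: linearD.
pose q1 : A := l1 *: X_ (- 2).
have fX (l : K) i : yfree (l *: X_ i) by apply/yfreeZ/yfree_mon.
have fq1 : yfree q1 by apply: fX.
have hP1 := hc_swp_R1 pP eP1; have hQ1 := hc_swp_R1 pQ eQ1.
have bP1' := @bnd_swp _ _ (1, -2) _ _ pP bP1; have bQ1' := @bnd_swp _ _ (1, -2) _ _ pQ bQ1.
have PQs : lbr (swp P0) (swp Q0) = (- c) *: 1.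
  rewrite lbr_swp // PQ -(mon0 A) swpZ swp_mon scaleNr //.
have Nc0 : - c != 0 by rewrite oppr_eq0.
have [b3P b3Q] := quartic_stage K0 m1 n1 copmn Nc0 lP0 lQ0 PQs bP1' bQ1' hP1 hQ1.
rewrite -/q1 in b3P b3Q.
pose P1 := psi (sh q1 (swp P0)); pose Q1 := psi (sh q1 (swp Q0)).
have pP1 : lpoly P1 by apply: (@bnd_psi _ _ (-1, 0)).
have pQ1 : lpoly Q1 by apply: (@bnd_psi _ _ (-1, 0)).
have PQ1 : lbr P1 Q1 = c *: X_ 1.
  rewrite lbr_psi lbr_sh ?PQs // shZ rmorph1 psiZ.
  by rewrite rmorph1 -scalerAr mulr1 scaleNr scalerN opprK.
have bq1 : bnd (-1, 4) 4 q1 by apply: bnd_X.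
have hq1 : hc (-1, 4) 4 q1 = (0 : K)%:P by rewrite hc_X.
have low (R : A) (k : nat) (cR : K) : lpoly R -> bnd (4, -1) (4 * k%:Z) R ->
    bnd (4, -1) (4 * k%:Z - 1) (R - cR *: (X_ 1 * (mon (1, 4%N) - l0 *: X_ 0) ^+ 3) ^+ k) ->
    bnd (1, 1) (4 * k%:Z) (psi (sh q1 (swp R))) /\
    hc (1, 1) (4 * k%:Z) (psi (sh q1 (swp R))) = cR *: ('X * ('X - l0%:P) ^+ 3) ^+ k.
  move=> pR bR eR; have bS := @bnd_swp _ _ (-1, 4) _ _ pR bR.
  split; first by apply: (@bnd_psi _ _ (1, 1)); apply: sh_bnd.
  by rewrite hc_psi (sh_hc bS bq1 hq1) polyC0 addr0 comp_polyXr (hc_swp_R0 pR eR).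
have [b11P h11P] := low _ _ _ pP bP0 eP0; have [b11Q h11Q] := low _ _ _ pQ bQ0 eQ0.
have [al [dP [dQ /=]]] := cubic_stage K0 m1 n1 copmn c0 l00 lP0 lQ0 PQ1 b11P b11Q h11P h11Q.
set q2 := _ + _ => -[b10P b10Q h10P h10Q].
have fq2 : yfree q2 by apply: yfreeD.
have bq2 : bnd (1, 1) 1 q2 by apply: bndD; apply: bnd_X.
have hq2 : hc (1, 1) 1 q2 = l0%:P by rewrite linearD /= !hc_X /= add0r.
have pq2 : bnd (-1, 0) 0 q2 by apply: bndD; apply: bnd_X.
pose P2 := sh q2 P1; pose Q2 := sh q2 Q1.
have pP2 : lpoly P2 by apply: sh_bnd.
have pQ2 : lpoly Q2 by apply: sh_bnd.
have b2P : bnd (1, 1) (4 * m%:Z) P2 by apply: sh_bnd.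
have b2Q : bnd (1, 1) (4 * n%:Z) Q2 by apply: sh_bnd.
have h2 (R : A) (k : nat) (cR : K) : bnd (1, 1) (4 * k%:Z) R ->
    hc (1, 1) (4 * k%:Z) R = cR *: ('X * ('X - l0%:P) ^+ 3) ^+ k ->
    hc (1, 1) (4 * k%:Z) (sh q2 R) = cR *: (('X + l0%:P) * 'X^3) ^+ k.
  move=> bR hR; rewrite (sh_hc bR bq2 hq2) hR linearZ /= rmorphXn rmorphM /=.
  by rewrite comp_polyX comp_XsubC.
have h2P := h2 _ _ _ b11P h11P; have h2Q := h2 _ _ _ b11Q h11Q.
have := swap_stage l00 pP2 b10P h10P b2P h2P.
have := swap_stage l00 pQ2 b10Q h10Q b2Q h2Q.
set q3 := - l0^-1 *: X_ 1; set Q3 := sh q3 (swp Q2); set P3 := sh q3 (swp P2) => /=.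
move=> [pQ3 b3Q' h3Q yQ rQ] [pP3 b3P' h3P yP rP].
have fq3 : yfree q3 by apply: fX.
have PQ3 : lbr P3 Q3 = (- c) *: (Y_ + q3).
  rewrite lbr_sh // lbr_swp // lbr_sh // PQ1 shZ sh_x.
  by rewrite swpZ swp_mon -scaleNr shZ sh_y.
have cP0 : lP * l0 ^+ m != 0 by rewrite mulf_neq0 ?expf_neq0.
have cQ0 : lQ * l0 ^+ n != 0 by rewrite mulf_neq0 ?expf_neq0.
have [a0 [a1 [a2 /=]]] := linear_stage K0 m1 n1 copmn cP0 cQ0 PQ3 b3P' b3Q' h3P h3Q.
set q4 := _ + (_ + _) => -[b4P b4Q].
have fq4 : yfree q4 by apply: yfreeD => //; apply: yfreeD.
have tailE : mon (- 3%:Z, 0%N) * psi q4 = tail A a0 a1 a2.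
  rewrite /q4 2!psiD !psiZ !psi_mon.
  by rewrite !mulrDr -!scalerAr !monD.
pose R := psi P3; pose S := psi Q3.
pose P4 := psi (sh q4 P3); pose Q4 := psi (sh q4 Q3).
have P4E : P4 = sh (tail A a0 a1 a2) R by rewrite /P4 psi_sh tailE.
have Q4E : Q4 = sh (tail A a0 a1 a2) S by rewrite /Q4 psi_sh tailE.
pose g : A := a2 *: X_ 3 + (a1 *: X_ 2 + a0 *: X_ 1) + (- l0^-1) *: X_ 0.
have fg : yfree g by apply: yfreeD; [apply: yfreeD; [|apply: yfreeD]|]; apply: fX.
have bg : bnd (1, 0) 3 g.
  by apply: bndD; [apply: bndD; [|apply: bndD]|]; apply: bnd_X.
have PQ4 : lbr P4 Q4 = c *: (mon (4, 1%N) + g).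
  rewrite lbr_psi lbr_sh // PQ3 shZ psiZ.
  rewrite shDr sh_y (sh_yfree _ (@fX _ _)) 2!psiD.
  rewrite /q4 2!psiD /q3 !psiZ !psi_mon.
  rewrite mulNr -scalerAr scaleNr opprK !mulrDr -!scalerAr !monD /g.
  rewrite -!addrA.
  by congr (c *: (mon _ + (a2 *: mon _ + (a1 *: mon _ + (a0 *: mon _ + (- l0^-1) *: mon _))))).
have row (T : A) (k : nat) : (forall i, coef (i, k) T != 0 -> i = (3 * k)%N%:Z) ->
    forall i, coef (i, k) (psi T) != 0 -> i = 0.
  by move=> rT i; rewrite coef_psi /= => /rT; rewrite PoszM; lia.
have top (T : A) (k : nat) (cT : K) : cT != 0 -> hc (1, 1) (4 * k%:Z) T = cT *: 'X^k ->
    coef (0, k) (psi T) != 0.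
  move=> cT0 hT; rewrite coef_psi /= subr0 -(@coef_hc _ A (1, 1) (4 * k%:Z) T (3 * k%:Z, k)) //.
    by rewrite hT coefZ coefXn eqxx mulr1.
  by rewrite /val_at /= !mul1r -[X in _ + X]mul1r -mulrDl.
have bR : bnd (1, - 3) 0 R by apply: (@bnd_psi _ _ (1, - 3)).
have bS : bnd (1, - 3) 0 S by apply: (@bnd_psi _ _ (1, - 3)).
have yR : bnd (0, 1) m%:Z R by apply: (@bnd_psi _ _ (0, 1)).
have yS : bnd (0, 1) n%:Z S by apply: (@bnd_psi _ _ (0, 1)).
have tR := top _ _ _ cP0 h3P; have tS := top _ _ _ cQ0 h3Q.
have pP4 : lpoly P4 by apply: (@bnd_psi _ _ (-1, 0)).
have pQ4 : lpoly Q4 by apply: (@bnd_psi _ _ (-1, 0)).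
have [] := @critical_stage K K0 A m n R S g c a0 a1 a2 m1 nm n1 copmn c0 bR bS yR yS
  (row _ _ rP) (row _ _ rQ) tR tS; rewrite -?P4E -?Q4E //.
move=> j [j0 mE nE [jR jS] rs].
have r0 : coef (3, 1%N) R != 0 by apply: contraNneq c0 => E; rewrite -rs E mul0r.
have s0 : coef (2, 1%N) S != 0 by apply: contraNneq c0 => E; rewrite -rs E mulr0.
have jR' : bnd (j%:Z, 1) (j * 3 + 1)%N%:Z R by rewrite [(j * 3)%N]mulnC -mE.
have jS' : bnd (j%:Z, 1) (j * 2 + 1)%N%:Z S by rewrite [(j * 2)%N]mulnC -nE.
have [f1P f2P f3P] := final_form a0 a1 a2 (isT : 1 < 3)%N (isT : 3 < 4)%N bR jR' j0.
have [f1Q f2Q f3Q] := final_form a0 a1 a2 (isT : 1 < 2)%N (isT : 2 < 4)%N bS jS' j0.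
rewrite -P4E [(j * 3)%N]mulnC -mE in f1P f2P f3P.
rewrite -Q4E [(j * 2)%N]mulnC -nE in f1Q f2Q f3Q.
exists j, q1, q2, q3, q4, (coef (3, 1%N) R)^-1, (coef (2, 1%N) S)^-1, (- l0^-1), a0, a1, a2 => /=.
rewrite -/P1 -/Q1 -/P2 -/Q2 -/P3 -/Q3 -/P4 -/Q4.
have row4 (T : A) (k : nat) : bnd (0, 1) k%:Z T ->
    coef (0, k) (sh (tail A a0 a1 a2) T) = coef (0, k) T.
  move=> bT; have sub : bnd (0, 1) (k%:Z - 1) (sh (tail A a0 a1 a2) T - T).
    by apply: sh_sub; rewrite //= subrr; apply: bnd_tail; rewrite /= ?oppr0.
  apply/eqP; rewrite -subr_eq0 -cfB; apply: contraT => /sub.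
  by rewrite /val_at /= mul0r add0r mul1r lerBrDr gerDl.
split=> //.
- by split; rewrite ?invr_eq0 ?oppr_eq0 ?invr_eq0 //; split=> //; apply: bndZ.
- rewrite lbrZl (linearZZ (lbr _)) /= PQ4 !scalerA -rs.
  rewrite -invfM mulVf ?mulf_neq0 // scale1r.
  rewrite /g -(mon0 A); move: (mon _) (_ *: _) (_ *: _) (_ *: _) (_ *: _) => *.
  by ring.
split.
- by split; apply: bndZ.
- by rewrite !linearZ /= f3P f3Q !scalerA !mulVf ?scale1r.
- by split; apply: bndZ.
- by rewrite !cfZ !mulf_neq0 ?invr_eq0 // ?P4E ?Q4E row4.
Qed.

End Reduction.

(** * Transfer to the Laurent ring *)

Section Polynomials.
Variables (K : fieldType) (A : laurentAlg K).
Implicit Types (P Q : A) (p q : {mpoly K[2]}).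
Local Notation mon := (mon A).

Definition pemb p : A :=
  mmap (in_alg A) (fun i : 'I_2 => if i == ord0 then mon (1, 0%N) else mon (0, 1%N)) p.

Lemma pemb_linear : linear pemb.
Proof. by move=> c p q; rewrite /pemb mmapD mmapZ mulr_algl. Qed.
HB.instance Definition _ :=
  GRing.isLinear.Build K {mpoly K[2]} A *:%R pemb pemb_linear.

Lemma pembX (u : 'X_{1..2}) : pemb 'X_[u] = mon ((u ord0)%:Z, u ord_max).
Proof.
rewrite /pemb mmapX /mmap1 !big_ord_recl big_ord0 mulr1 /= !monX monD.
congr (mon (_, _)) => /=; first by rewrite mul0r addr0 mul1r.
by rewrite mul0n mul1n; suff -> : lift ord0 ord0 = ord_max :> 'I_2 by []; apply: val_inj.
Qed.

Lemma pemb_lpoly p : lpoly (pemb p).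
Proof.
rewrite [p]mpolyE linear_sum /=; apply: bnd_sum => u _.
by rewrite linearZ /= pembX; apply/bndZ/lpoly_mon.
Qed.

Lemma pemb_surj P : lpoly P -> exists p, pemb p = P.
Proof.
move=> pP; pose u (a : int * nat) := [multinom if i == ord0 then absz a.1 else a.2 | i < 2].
exists (\sum_(a <- supp P) coef a P *: 'X_[u a]).
rewrite linear_sum [RHS]supp_sum /=; apply: eq_big_seq => -[i j].
rewrite mem_supp => /(lpolyP pP) /= i0; rewrite linearZ /= pembX !mnmE /=.
by rewrite gez0_abs.
Qed.

Lemma pemb_msym p : pemb (msym (tperm ord0 ord_max) p) = swp (pemb p).
Proof.
elim/mpolyind: p => [|c u p _ _ IHp].
  by rewrite msym0 /pemb mmap0 [RHS](linear0 (@swp K A)).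
rewrite msymD msymZ msymX !pemb_linear IHp [RHS](linearP (@swp K A)) /= !pembX swp_mon.
by rewrite !mnmE tpermV tpermL tpermR.
Qed.

End Polynomials.

Section LaurentInstance.
Variable K : fieldType.

Lemma monom_add (a b : int * nat) : monom (1 : K) a * monom 1 b = monom 1 (a + b).
Proof. by have := lmul_monom (1 : K) 1 a b; rewrite mul1r. Qed.

Lemma lcoef_linear (c : K) (P Q : laurent K) a :
  lcoef a (c *: P + Q) = c * lcoef a P + lcoef a Q.
Proof. by rewrite lcoefD lcoefZ. Qed.

Lemma lcoef_monom1 a b : lcoef b (monom (1 : K) a) = (a == b)%:R.
Proof. exact: lcoef_monom. Qed.

Lemma laurent_sum (P : laurent K) :
  P = \sum_(a <- (Supp P : seq _)) lcoef a P *: monom 1 a.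
Proof.
by rewrite [LHS]laurentE; apply: eq_bigr => a _; rewrite monomZ mulr1.
Qed.

Definition laurent_alg : laurentAlg K :=
  @LaurentAlg K (laurent K) (monom 1) (@lcoef K) (fun P => Supp P)
    monom_add (erefl _) lcoef_linear lcoef_monom1
    (fun P => fset_uniq (Supp P)) (fun P a => mem_Supp a P) laurent_sum.

Lemma dx_ldx (P : laurent K) : dx P = @ldx K laurent_alg P.
Proof.
by apply: eq_bigr => a _; rewrite /= !monomZ mulr1.
Qed.

Lemma dy_ldy (P : laurent K) : dy P = @ldy K laurent_alg P.
Proof.
by apply: eq_bigr => a _; rewrite /= !monomZ mulr1.
Qed.

Lemma bracket_lbr (P Q : laurent K) : bracket P Q = @lbr K laurent_alg P Q.
Proof. by rewrite /bracket !dx_ldx !dy_ldy. Qed.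

Lemma op_shear (q P Q : laurent_alg) : yfree q ->
  operation (P : laurent K, Q : laurent K) (sh q P, sh q Q).
Proof.
move=> fq; pose f : {lrmorphism laurent_alg -> laurent_alg} := sh q.
exact: (@Op_autL1 K (f : {lrmorphism laurent K -> laurent K}) P Q (sh_bij fq)).
Qed.

Lemma op_psi (P Q : laurent_alg) :
  operation (P : laurent K, Q : laurent K) (psi P, psi Q).
Proof.
have b : bijective (@psi K laurent_alg) := inv_bij (@psiK K laurent_alg).
pose f : {lrmorphism laurent_alg -> laurent_alg} := @psi K laurent_alg.
exact: (@Op_autL1 K (f : {lrmorphism laurent K -> laurent K}) P Q b).
Qed.

Lemma op_swap (P Q : laurent_alg) : lpoly P -> lpoly Q ->
  operation (P : laurent K, Q : laurent K) (swp P, swp Q).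
Proof.
have transport (P1 Q1 P2 Q2 P1' Q1' P2' Q2' : laurent K) :
    operation (P1, Q1) (P2, Q2) ->
    P1 = P1' -> Q1 = Q1' -> P2 = P2' -> Q2 = Q2' -> operation (P1', Q1') (P2', Q2').
  by move=> o <- <- <- <-.
move=> pP pQ; have [p pE] := pemb_surj pP; have [q qE] := pemb_surj pQ.
pose s : 'S_2 := tperm ord0 ord_max.
have sK : involutive (@msym 2 K s) by move=> u; rewrite -msymMm tperm2 msym1m.
pose f : {lrmorphism {mpoly K[2]} -> {mpoly K[2]}} := msym s.
have pE' := congr1 (@swp K laurent_alg) pE; have qE' := congr1 (@swp K laurent_alg) qE.
exact: (transport _ _ _ _ _ _ _ _ (@Op_autL K f p q (inv_bij sK)) pE qE
  (etrans (pemb_msym laurent_alg p) pE') (etrans (pemb_msym laurent_alg q) qE')).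
Qed.

End LaurentInstance.

Section LeadingForms.
Variable K : fieldType.
Implicit Types (P H : laurent K) (d : int * int) (k : int) (a b : int * nat).

Lemma lcoefB a P H : lcoef a (P - H) = lcoef a P - lcoef a H.
Proof. by rewrite lcoefD -[- H]scaleN1r lcoefZ mulN1r. Qed.

Lemma vdeg_unique d k P a : lcoef a P != 0 -> val_at d a = k ->
  (forall b, lcoef b P != 0 -> val_at d b <= k) -> vdeg d P = k.
Proof.
move=> aP ak bP; have P0 : P != 0 by apply: contraNneq aP => ->; rewrite lcoef0.
have [[b + <-] max] := vdeg_spec d P0; rewrite mem_Supp => /bP bk.
by apply/le_anti; rewrite bk -ak max // mem_Supp.
Qed.

Lemma ell_lead d k P H a : (forall b, lcoef b H != 0 -> val_at d b = k) ->
  lcoef a H != 0 -> ell d P = H ->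
  (forall b, lcoef b P != 0 -> val_at d b <= k) /\
  (forall b, lcoef b (P - H) != 0 -> val_at d b <= k - 1).
Proof.
move=> homH aH E; have := aH; rewrite -E lcoef_ell.
have [av aP|] := eqVneq (val_at d a) (vdeg d P); last by rewrite eqxx.
have P0 : P != 0 by apply: contraNneq aP => ->; rewrite lcoef0.
have kv : vdeg d P = k by rewrite -av; apply: homH.
have le b : lcoef b P != 0 -> val_at d b <= k.
  by move=> bP; rewrite -kv; apply: (vdeg_spec d P0).2; rewrite mem_Supp.
split=> // b; rewrite lcoefB lcoef_ell kv.
have [_|nk] := eqVneq (val_at d b) k; first by rewrite subrr eqxx.
by rewrite subr0 => /le; rewrite le_eqVlt (negPf nk) /= => ?; lia.
Qed.

Lemma ell_of_lead d k P H a : lcoef a H != 0 -> 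
  (forall b, lcoef b H != 0 -> val_at d b = k) ->
  (forall b, lcoef b P != 0 -> val_at d b <= k) ->
  (forall b, val_at d b = k -> lcoef b P = lcoef b H) -> ell d P = H.
Proof.
move=> aH homH bP PH; have ak := homH _ aH.
have aP : lcoef a P != 0 by rewrite PH.
apply: laurentP => b; rewrite lcoef_ell (vdeg_unique aP ak bP).
have [/PH//|nk] := eqVneq (val_at d b) k.
by apply/esym/eqP; apply: contraT => /homH bk; rewrite bk eqxx in nk.
Qed.

Lemma mem_ell d k P a b : lcoef a P != 0 -> val_at d a = k ->
  (forall b, lcoef b P != 0 -> val_at d b <= k) ->
  (b \in Supp (ell d P)) = (lcoef b P != 0) && (val_at d b == k).
Proof.
by move=> aP ak bP; rewrite mem_Supp_ell mem_Supp (vdeg_unique aP ak bP).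
Qed.

Lemma ell_singleton d P a : lcoef a P != 0 ->
  (forall b, lcoef b P != 0 -> b != a -> val_at d b < val_at d a) -> ~~ Dir P d.
Proof.
move=> aP lt; have le b : lcoef b P != 0 -> val_at d b <= val_at d a.
  by have [->//|ba bP] := eqVneq b a; apply/ltW/lt.
rewrite /Dir negb_and -leqNgt; apply/orP; right.
suff -> : Supp (ell d P) = [fset a]%fset by rewrite cardfs1.
apply/fsetP=> b; rewrite (mem_ell _ aP (erefl _) le) inE.
have [->|ba] := eqVneq b a; first by rewrite aP eqxx.
by apply/negP=> /andP[bP /eqP E]; have := lt _ bP ba; rewrite E ltxx.
Qed.

Lemma st_unique d P a : a \in Supp (ell d P) ->
  (forall b, b \in Supp (ell d P) -> b != a ->
     cross d (int2 a) < cross d (int2 b)) -> st d P = a.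
Proof.
move=> aS lt; have le b : b \in Supp (ell d P) -> cross d (int2 a) <= cross d (int2 b).
  by have [->//|ba bP] := eqVneq b a; apply/ltW/lt.
have [|sS /allP smin] := andP (@head_filter _ (0, 0%N)
  (fun a => all (fun b => cross d (int2 a) <= cross d (int2 b)) (Supp (ell d P)))
  (Supp (ell d P)) _); first by exists a => //; apply/allP.
apply/eqP; apply: contraT => sa; have := lt _ sS sa.
by rewrite ltNge smin.
Qed.

Lemma en_unique d P a : a \in Supp (ell d P) ->
  (forall b, b \in Supp (ell d P) -> b != a ->
     cross d (int2 b) < cross d (int2 a)) -> en d P = a.
Proof.
move=> aS lt; have le b : b \in Supp (ell d P) -> cross d (int2 b) <= cross d (int2 a).
  by have [->//|ba bP] := eqVneq b a; apply/ltW/lt.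
have [|sS /allP smax] := andP (@head_filter _ (0, 0%N)
  (fun a => all (fun b => cross d (int2 b) <= cross d (int2 a)) (Supp (ell d P)))
  (Supp (ell d P)) _); first by exists a => //; apply/allP.
apply/eqP; apply: contraT => sa; have := lt _ sS sa.
by rewrite ltNge smax.
Qed.

Section Corner.
Variables (j a : nat) (P : laurent K).
Hypotheses (j0 : (0 < j)%N) (a1 : (0 < a)%N).
Hypothesis pt : forall (i : int) (b : nat), lcoef (i, b) P != 0 ->
  [/\ 0 <= i, j%:Z * i + b%:Z <= j%:Z * a%:Z + 1 & i - b%:Z <= a%:Z - 1].
Hypotheses (c1 : lcoef (a%:Z, 1%N) P != 0) (c0 : lcoef (0, (j * a + 1)%N) P != 0).

Lemma corner_above (r s : int) : 0 < r + s -> j%:Z * s < r -> ~~ Dir P (r, s).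
Proof.
move=> rs0 rs; apply: (ell_singleton c1) => -[i b] /pt[_ X0 Y0] ne; rewrite /val_at /=.
rewrite -(@ltr_pM2l _ (j%:Z + 1)) ?addr_gt0 // -subr_gt0.
have -> : (j%:Z + 1) * (r * a%:Z + s * 1%N%:Z) - (j%:Z + 1) * (r * i + s * b%:Z) =
    (r + s) * (j%:Z * a%:Z + 1 - (j%:Z * i + b%:Z)) +
    (r - j%:Z * s) * (a%:Z - 1 - (i - b%:Z)) by ring.
rewrite -subr_ge0 in X0; rewrite -subr_ge0 in Y0; rewrite -subr_gt0 in rs.
have t1 := mulr_ge0 (ltW rs0) X0; have t2 := mulr_ge0 (ltW rs) Y0.
rewrite lt_neqAle addr_ge0 // andbT eq_sym paddr_eq0 // !mulf_eq0 (gt_eqF rs0) (gt_eqF rs) /=.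
apply: contra ne => /andP[/eqP X /eqP Y].
have : (j%:Z + 1) * (a%:Z - i) =
  (j%:Z * a%:Z + 1 - (j%:Z * i + b%:Z)) + (a%:Z - 1 - (i - b%:Z)) by ring.
rewrite X Y addr0; move/eqP; rewrite mulf_eq0 gt_eqF ?addr_gt0 //= subr_eq0 => /eqP ai.
by apply/eqP; congr pair; lia.
Qed.

Lemma corner_below (r s : int) : 0 < r + s -> r < j%:Z * s -> ~~ Dir P (r, s).
Proof.
move=> rs0 rs; have s0 : 0 < s.
  rewrite ltNge; apply/negP => s0; have : (j%:Z - 1) * s <= 0.
    by rewrite mulr_ge0_le0 // subr_ge0.
  by rewrite mulrBl mul1r; lia.
apply: (ell_singleton c0) => -[i b] /pt[i0 X0 _] ne; rewrite /val_at /=.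
rewrite -subr_gt0 PoszD PoszM.
have -> : r * 0 + s * (j%:Z * a%:Z + 1%N%:Z) - (r * i + s * b%:Z) =
    s * (j%:Z * a%:Z + 1 - (j%:Z * i + b%:Z)) + (j%:Z * s - r) * i by ring.
rewrite -subr_ge0 in X0; rewrite -subr_gt0 in rs.
have t1 := mulr_ge0 (ltW s0) X0; have t2 := mulr_ge0 (ltW rs) i0.
rewrite lt_neqAle addr_ge0 // andbT eq_sym paddr_eq0 // !mulf_eq0 (gt_eqF s0) (gt_eqF rs) /=.
apply: contra ne => /andP[/eqP X /eqP Y]; move: X; rewrite Y mulr0 add0r => /eqP.
by rewrite subr_eq0 -PoszM -PoszD eqz_nat => /eqP->.
Qed.

Lemma mem_ell_corner i (b : nat) : ((i, b) \in Supp (ell (j%:Z, 1) P)) =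
  (lcoef (i, b) P != 0) && (j%:Z * i + b%:Z == j%:Z * a%:Z + 1).
Proof.
rewrite (@mem_ell _ (j%:Z * a%:Z + 1) _ _ _ c1) /val_at /= ?mul1r //.
by move=> [i' b'] /pt[_ + _] /=; rewrite mul1r.
Qed.

Lemma st_corner : st (j%:Z, 1) P = (a%:Z, 1%N).
Proof.
apply: st_unique; first by rewrite mem_ell_corner c1 /=.
move=> [i b]; rewrite mem_ell_corner => /andP[cP /eqP E] ne; have [i0 _ Y0] := pt cP.
rewrite /cross /= !mul1r mulr1.
have ia : i < a%:Z.
  rewrite lt_neqAle; apply/andP; split.
    by apply: contra ne => /eqP ia; rewrite ia in E *; apply/eqP; congr pair; lia.
  by rewrite -(@ler_pM2l _ (j%:Z + 1)) ?addr_gt0 //; lia.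
have -> : b%:Z = j%:Z * (a%:Z - i) + 1 by rewrite mulrBr; lia.
have : 0 <= j%:Z * (j%:Z * (a%:Z - i)) by rewrite !mulr_ge0 // subr_ge0 ltW.
by rewrite !mulrDr mulr1; lia.
Qed.

Lemma en_corner : en (j%:Z, 1) P = (0, (j * a + 1)%N).
Proof.
apply: en_unique.
  by rewrite mem_ell_corner c0 /= mulr0 add0r PoszD PoszM.
move=> [i b]; rewrite mem_ell_corner => /andP[cP /eqP E] ne; have [i0 _ Y0] := pt cP.
rewrite /cross /= !mul1r subr0.
have ip : 0 < i.
  rewrite lt_neqAle i0 andbT; apply: contra ne => /eqP i00; subst i.
  by apply/eqP; congr pair; move: E; rewrite mulr0 add0r -PoszM -PoszD => -[].
have -> : b%:Z = (j * a + 1)%N%:Z - j%:Z * i by rewrite PoszD PoszM; lia.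
have : 0 <= j%:Z * (j%:Z * i) by rewrite !mulr_ge0.
by rewrite mulrBr; lia.
Qed.

Lemma corner_Dir : [predI Dir P & dirs_gt0] =i pred1 (j%:Z, 1).
Proof.
move=> [r s]; rewrite !inE; have [[-> ->]|nd] := eqVneq (r, s) (j%:Z, 1).
  apply/andP; split; last first.
    by apply/andP; split; [rewrite /dirs /= coprimezE coprimen1|rewrite addr_gt0].
  apply/andP; split; first by rewrite /dirs /= coprimezE coprimen1.
  have ne : (a%:Z, 1%N) != (0, (j * a + 1)%N) by apply: contraTneq a1 => -[->].
  have := cardfs2 (a%:Z, 1%N) (0, (j * a + 1)%N); rewrite ne => <-.
  apply: fsubset_leq_card.
  by apply/fsubsetP=> b; rewrite !inE => /orP[] /eqP->; rewrite mem_ell_corner ?c1 ?c0 /=;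
    rewrite ?eqxx // mulr0 add0r PoszD PoszM.
apply/negbTE; apply: contra nd => /andP[D /andP[drs /= rs0]].
case: (ltgtP r (j%:Z * s)) => rs.
- by have := corner_below rs0 rs; rewrite [X in ~~ X]D.
- by have := corner_above rs0 rs; rewrite [X in ~~ X]D.
move: drs; rewrite /dirs /= rs coprimezE abszM coprimeMl {2}/coprime gcdnn => /andP[_ /eqP s1].
have s2 : s = 1.
  have : 0 < (j%:Z + 1) * s by rewrite mulrDl mul1r -rs.
  by rewrite pmulr_rgt0 ?addr_gt0 //; lia.
by rewrite s2 mulr1.
Qed.

End Corner.
End LeadingForms.

Section Forms.
Variables (K : fieldType) (A : laurentAlg K).
Implicit Types (P W : A).
Local Notation mon := (mon A).
Local Notation X_ i := (mon (i, 0%N)).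
Local Notation Y_ := (mon (0, 1%N)).

Definition pure d k P := forall a, coef a P != 0 -> val_at d a = k.

Lemma bnd_pure d k P : bnd d k P -> bnd (- d.1, - d.2) (- k) P -> pure d k P.
Proof.
move=> b1 b2 a aP; apply/le_anti; rewrite b1 //= -lerN2.
by have := b2 a aP; rewrite /val_at /= !mulNr -opprD.
Qed.

Lemma pure_power d k W (c : K) n : d.1 != 0 -> c != 0 ->
  bnd d k W -> bnd (- d.1, - d.2) (- k) W -> hc d k W != 0 ->
  pure d (n%:Z * k) (c *: W ^+ n) /\ exists a, coef a (c *: W ^+ n) != 0.
Proof.
move=> d0 c0 b1 b2 h; split.
  apply: bnd_pure; first exact/bndZ/bndX.
  by rewrite -mulrN; apply/bndZ/bndX.
have : lead_coef (hc d (n%:Z * k) (c *: W ^+ n)) != 0.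
  by rewrite lead_coef_eq0 linearZ /= (hcX n b1) scaler_eq0 negb_or c0 expf_neq0.
by rewrite lead_coefE => /hc_coef[a [aW _ _]]; exists a.
Qed.

Definition form0 (l : K) : A := X_ 1 * (mon (1, 4%N) - l *: X_ 0) ^+ 3.
Definition form1 (l : K) : A := Y_ * (mon (1, 2%N) - l *: X_ 0).

Lemma form0E l : X_ 1 * (X_ 1 * Y_ ^+ 4 - l%:A) ^+ 3 = form0 l.
Proof. by rewrite /form0 monX monD -(mon0 A). Qed.

Lemma form1E l : Y_ * (X_ 1 * Y_ ^+ 2 - l%:A) = form1 l.
Proof. by rewrite /form1 monX monD -(mon0 A). Qed.

Lemma form0_power (l c : K) n : c != 0 ->
  pure (4, -1) (n%:Z * 4) (c *: form0 l ^+ n) /\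
  exists a, coef a (c *: form0 l ^+ n) != 0.
Proof.
move=> c0; have b1 : bnd (4, -1) 0 (mon (1, 4%N) - l *: X_ 0) by apply: bnd_binomial.
have b2 : bnd (-4, 1) 0 (mon (1, 4%N) - l *: X_ 0) by apply: bnd_binomial.
have b13 := @bndX _ _ _ _ _ 3 b1; have b23 := @bndX _ _ _ _ _ 3 b2.
have x1 : bnd (4, -1) 4 (X_ 1) by apply: bnd_mon.
have x2 : bnd (-4, 1) (-4) (X_ 1) by apply: bnd_mon.
apply: pure_power => //.
- by rewrite -[X in bnd _ X]addr0; apply: bndM.
- by rewrite -[X in bnd _ X]addr0; apply: bndM.
have := hcM x1 b13; rewrite /form0 mulr0 addr0 => ->.
have := @hcX _ _ _ _ _ 3 b1; rewrite mulr0 => ->.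
rewrite hc_binomial // hc_mon /= ?expr0 ?mul1r alg_polyC expf_neq0 //.
by rewrite monic_neq0 // monicXnsubC.
Qed.

Lemma form1_power (l c : K) n : c != 0 ->
  pure (-2, 1) (n%:Z * 1) (c *: form1 l ^+ n) /\
  exists a, coef a (c *: form1 l ^+ n) != 0.
Proof.
move=> c0; have b1 : bnd (-2, 1) 0 (mon (1, 2%N) - l *: X_ 0) by apply: bnd_binomial.
have b2 : bnd (2, -1) 0 (mon (1, 2%N) - l *: X_ 0) by apply: bnd_binomial.
have y1 : bnd (-2, 1) 1 Y_ by apply: bnd_mon.
have y2 : bnd (2, -1) (-1) Y_ by apply: bnd_mon.
apply: pure_power => //.
- by rewrite -[X in bnd _ X]addr0; apply: bndM.
- by rewrite -[X in bnd _ X]addr0; apply: bndM.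
have := hcM y1 b1; rewrite /form1 addr0 => ->.
rewrite hc_binomial // hc_mon /= ?expr1 ?expr0 alg_polyC mulf_neq0 ?polyX_eq0 //.
by rewrite monic_neq0 // monicXnsubC.
Qed.

Lemma final_bracketE (mu0 mu1 mu2 mu3 : K) :
  mon (4, 1%N) + mu0 *: 1 + mu1 *: X_ 1 + mu2 *: X_ 2 + mu3 *: X_ 3 =
  X_ 1 ^+ 4 * Y_ + mu0%:A + mu1 *: X_ 1 + mu2 *: X_ 1 ^+ 2 + mu3 *: X_ 1 ^+ 3.
Proof. by rewrite !monX monD. Qed.

Lemma final_form_coef (a : nat) (mu : K) P :
  bnd (1, -1) (a%:Z - 1) P -> hc (1, -1) (a%:Z - 1) P = 'X + mu%:P ->
  let H := mon (a%:Z, 1%N) + mu *: X_ (a%:Z - 1) in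
  [/\ pure (1, -1) (a%:Z - 1) H, coef (a%:Z, 1%N) H != 0,
      forall b, val_at (1, -1) b = a%:Z - 1 -> coef b P = coef b H &
      coef (a%:Z, 1%N) P != 0].
Proof.
move=> bP hP H.
have bH : bnd (1, -1) (a%:Z - 1) H.
  by apply: bndD; [|apply: bndZ]; apply: bnd_mon; rewrite /val_at /= mul1r ?mulr0 ?addr0.
have bH' : bnd (-1, 1) (- (a%:Z - 1)) H.
  apply: bndD; [|apply: bndZ]; apply: bnd_mon; rewrite /val_at /=; lia.
have hH : hc (1, -1) (a%:Z - 1) H = 'X + mu%:P.
  rewrite linearD linearZ /= !hc_mon /val_at /= !mul1r mulr0 addr0 mulN1r !eqxx.
  by rewrite expr1 expr0 alg_polyC.
have aH : coef (a%:Z, 1%N) H = 1.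
  rewrite -(@coef_hc _ A (1, -1) (a%:Z - 1) H (a%:Z, 1%N)) //; last first.
    by rewrite /val_at /= mul1r.
  by rewrite hH coefD coefX coefC /= addr0.
have PH b : val_at (1, -1) b = a%:Z - 1 -> coef b P = coef b H.
  by move=> bk; rewrite -(@coef_hc _ A (1, -1) _ P b _ bk) // hP -hH coef_hc.
split=> //; first exact: bnd_pure.
- by rewrite aH oner_eq0.
by rewrite PH ?aH ?oner_eq0 // /val_at /= mul1r.
Qed.

Lemma final_formE3 (mu : K) : mon (3%N%:Z, 1%N) + mu *: X_ (3%N%:Z - 1) =
  X_ 1 ^+ 3 * Y_ + mu *: X_ 1 ^+ 2.
Proof. by rewrite !monX monD. Qed.

Lemma final_formE2 (mu : K) : mon (2%N%:Z, 1%N) + mu *: X_ (2%N%:Z - 1) =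
  X_ 1 ^+ 2 * Y_ + mu *: X_ 1.
Proof. by rewrite !monX monD. Qed.

End Forms.

Section Assembly.
Variable K : closedFieldType.
Local Notation A := (laurent_alg K).
Local Notation x := (Lx K).
Local Notation y := (Ly K).

Lemma lead_form0 (P : A) (l c : K) n : c != 0 ->
  ell (4, -1) (P : laurent K) = c *: (x * (x * y ^+ 4 - l%:A) ^+ 3) ^+ n ->
  bnd (4, -1) (4 * n%:Z) P /\ bnd (4, -1) (4 * n%:Z - 1) (P - c *: form0 A l ^+ n).
Proof.
move=> c0 E; have [hom [a aH]] := form0_power A l n c0.
have E' := etrans E (congr1 (fun W : A => c *: W ^+ n) (form0E A l)).
by rewrite [4 * _]mulrC; apply: (ell_lead hom aH E').
Qed.

Lemma lead_form1 (P : A) (l c : K) n : c != 0 ->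
  ell (-2, 1) (P : laurent K) = c *: (y * (x * y ^+ 2 - l%:A)) ^+ n ->
  bnd (-2, 1) n%:Z P /\ bnd (-2, 1) (n%:Z - 1) (P - c *: form1 A l ^+ n).
Proof.
move=> c0 E; have [hom [a aH]] := form1_power A l n c0.
have E' := etrans E (congr1 (fun W : A => c *: W ^+ n) (form1E A l)).
by rewrite mulr1 in hom; apply: (ell_lead hom aH E').
Qed.

Lemma chain_operations (P Q q1 q2 q3 q4 : A) (r s : K) :
  let P2 := sh q2 (psi (sh q1 (swp P))) in let Q2 := sh q2 (psi (sh q1 (swp Q))) in
  lpoly P -> lpoly Q -> lpoly P2 -> lpoly Q2 ->
  yfree q1 -> yfree q2 -> yfree q3 -> yfree q4 -> r != 0 -> s != 0 ->
  operations (P : laurent K, Q : laurent K)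
    (r *: psi (sh q4 (sh q3 (swp P2))), s *: psi (sh q4 (sh q3 (swp Q2)))).
Proof.
move=> P2 Q2 pP pQ pP2 pQ2 f1 f2 f3 f4 r0 s0.
have o1 := rt_step _ _ _ _ (op_swap pP pQ).
have o2 := rt_step _ _ _ _ (op_shear (swp P) (swp Q) f1).
have o3 := rt_step _ _ _ _ (op_psi (sh q1 (swp P)) (sh q1 (swp Q))).
have o4 := rt_step _ _ _ _ (op_shear (psi (sh q1 (swp P))) (psi (sh q1 (swp Q))) f2).
have o5 := rt_step _ _ _ _ (op_swap pP2 pQ2).
have o6 := rt_step _ _ _ _ (op_shear (swp P2) (swp Q2) f3).
have o7 := rt_step _ _ _ _ (op_shear (sh q3 (swp P2)) (sh q3 (swp Q2)) f4).
have o8 := rt_step _ _ _ _ (op_psi (sh q4 (sh q3 (swp P2))) (sh q4 (sh q3 (swp Q2)))).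
have o9 := rt_step _ _ _ _ (@Op_scale K r s (psi (sh q4 (sh q3 (swp P2))))
  (psi (sh q4 (sh q3 (swp Q2)))) r0 s0).
exact: (rt_trans _ _ _ _ _ o1 (rt_trans _ _ _ _ _ o2 (rt_trans _ _ _ _ _ o3
  (rt_trans _ _ _ _ _ o4 (rt_trans _ _ _ _ _ o5 (rt_trans _ _ _ _ _ o6
  (rt_trans _ _ _ _ _ o7 (rt_trans _ _ _ _ _ o8 o9)))))))).
Qed.

Lemma final_shape (j a : nat) (mu : K) (P : A) : (0 < j)%N -> (0 < a)%N -> lpoly P ->
  bnd (1, -1) (a%:Z - 1) P -> hc (1, -1) (a%:Z - 1) P = 'X + mu%:P ->
  bnd (j%:Z, 1) (j * a + 1)%N%:Z P -> coef (0, (j * a + 1)%N) P != 0 ->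
  [/\ ell (1, -1) (P : laurent K) = (mon A (a%:Z, 1%N) + mu *: mon A (a%:Z - 1, 0%N) : A),
      [predI Dir (P : laurent K) & dirs_gt0] =i pred1 (j%:Z, 1),
      st (j%:Z, 1) (P : laurent K) = (a%:Z, 1%N) &
      en (j%:Z, 1) (P : laurent K) = (0, (j * a + 1)%N)].
Proof.
move=> j0 a0 pP b1 h1 bj c0; have [hom aH PH c1] := final_form_coef b1 h1.
have pt (i : int) (b : nat) : lcoef (i, b) (P : laurent K) != 0 ->
    [/\ 0 <= i, j%:Z * i + b%:Z <= j%:Z * a%:Z + 1 & i - b%:Z <= a%:Z - 1].
  move=> cP; split; first exact: (lpolyP pP cP).
    by have := bj _ cP; rewrite /val_at /= mul1r PoszD PoszM.
  by have := b1 _ cP; rewrite /val_at /= mul1r mulN1r.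
split.
- exact: (@ell_of_lead K _ _ P _ _ aH hom b1 PH).
- exact: (@corner_Dir K j a P j0 a0 pt c1 c0).
- exact: (@st_corner K j a P j0 a0 pt c1 c0).
- exact: (@en_corner K j a P j0 a0 pt c1 c0).
Qed.

Theorem ordered_case (K0 : [pchar K] =i pred0) (m n : nat) (P Q : {mpoly K[2]})
    (l0 l1 lP lQ : K) : (1 < n)%N -> (n < m)%N -> coprime m n ->
  nonzero_const (bracket (emb P) (emb Q)) ->
  l0 != 0 -> lP != 0 -> lQ != 0 ->
  ell (4, -1) (emb P) = lP *: (x * (x * y ^+ 4 - l0%:A) ^+ 3) ^+ m ->
  ell (4, -1) (emb Q) = lQ *: (x * (x * y ^+ 4 - l0%:A) ^+ 3) ^+ n ->
  ell (-2, 1) (emb P) = lP *: (y * (x * y ^+ 2 - l1%:A)) ^+ (4 * m) ->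
  ell (-2, 1) (emb Q) = lQ *: (y * (x * y ^+ 2 - l1%:A)) ^+ (4 * n) ->
  exists j : nat,
    [/\ (0 < j)%N, m = (3 * j + 1)%N, n = (2 * j + 1)%N &
    exists (P6 Q6 : {mpoly K[2]}) (mu0 mu1 mu2 mu3 : K),
      [/\ operations (emb P, emb Q) (emb P6, emb Q6),
          mu0 != 0,
          bracket (emb P6) (emb Q6) =
            x ^+ 4 * y + mu0%:A + mu1 *: x + mu2 *: x ^+ 2 + mu3 *: x ^+ 3,
          ell (1, -1) (emb P6) = x ^+ 3 * y + mu3 *: x ^+ 2 /\
          ell (1, -1) (emb Q6) = x ^+ 2 * y + mu3 *: x &
      [/\ [predI Dir (emb P6) & dirs_gt0] =i pred1 (j%:Z, 1),
          [predI Dir (emb Q6) & dirs_gt0] =i pred1 (j%:Z, 1),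
          st (j%:Z, 1) (emb P6) = (3, 1%N) /\ st (j%:Z, 1) (emb Q6) = (2, 1%N),
          en (j%:Z, 1) (emb P6) = (0, m) &
          en (j%:Z, 1) (emb Q6) = (0, n)]]].
Proof.
move=> n1 nm cop [c c0 br] l00 lP0 lQ0 eP0 eQ0 eP1 eQ1.
have [bP0 dP0] := @lead_form0 (pemb A P) _ _ _ lP0 eP0.
have [bQ0 dQ0] := @lead_form0 (pemb A Q) _ _ _ lQ0 eQ0.
have [bP1 dP1] := @lead_form1 (pemb A P) _ _ _ lP0 eP1.
have [bQ1 dQ1] := @lead_form1 (pemb A Q) _ _ _ lQ0 eQ1.
have brA := etrans (esym (bracket_lbr (emb P) (emb Q))) br.
have [j [q1 [q2 [q3 [q4 [r [s [mu0 [mu1 [mu2 [mu3 /=]]]]]]]]]]] :=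
  @reduction K K0 A m n (pemb A P) (pemb A Q) c l0 l1 lP lQ n1 nm cop c0 l00 lP0 lQ0
    (@pemb_lpoly K A P) (@pemb_lpoly K A Q) brA bP1 bQ1 bP0 bQ0 dP1 dQ1 dP0 dQ0.
move=> [[j0 mE nE] [f1 f2 f3 f4] [r0 s0 mu00 [pP2 pQ2]]].
have := chain_operations (@pemb_lpoly K A P) (@pemb_lpoly K A Q) pP2 pQ2 f1 f2 f3 f4 r0 s0.
move: (r *: _) (s *: _) => P6 Q6 ops pP6 pQ6 br6 [[b1P b1Q] [h1P h1Q] [bjP bjQ] [c0P c0Q]].
have [p pE] := pemb_surj pP6; have [q qE] := pemb_surj pQ6; subst P6 Q6.
have mE' : m = (j * 3 + 1)%N by rewrite mulnC.
have nE' : n = (j * 2 + 1)%N by rewrite mulnC.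
rewrite mE' in bjP c0P; rewrite nE' in bjQ c0Q.
have [e1 d1 s1 t1] := @final_shape j 3 mu3 _ j0 isT pP6 b1P h1P bjP c0P.
have [e2 d2 s2 t2] := @final_shape j 2 mu3 _ j0 isT pQ6 b1Q h1Q bjQ c0Q.
exists j; split; [exact: j0 | exact: mE | exact: nE |].
exists p, q, mu0, mu1, mu2, mu3; split.
- exact: ops.
- exact: mu00.
- exact: etrans (bracket_lbr (emb p) (emb q)) (etrans br6 (final_bracketE A mu0 mu1 mu2 mu3)).
- have E1 := etrans e1 (final_formE3 A mu3).
  have E2 := etrans e2 (final_formE2 A mu3).
  exact: (conj E1 E2).
split; [exact: d1 | exact: d2 | by split; [exact: s1 | exact: s2] | |].
- by rewrite mE'; exact: t1.
- by rewrite nE'; exact: t2.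
Qed.

End Assembly.

Theorem theorem8p12 (K : closedFieldType) (charK0 : [pchar K] =i pred0)
    (B16 : JCbound K = Some 16%N)
    (m n : nat) (P Q : {mpoly K[2]})
    (stdPQ : standard_pair m n (emb P) (emb Q))
    (minPQ : minimal_pair P Q)
    (lambda0 lambda1 lambdaP lambdaQ : K)
    (nz_lambda0 : lambda0 != 0) (nz_lambda1 : lambda1 != 0)
    (nz_lambdaP : lambdaP != 0) (nz_lambdaQ : lambdaQ != 0)
    (x := Lx K) (y := Ly K)
    (R0 := x * (x * y ^+ 4 - lambda0%:A) ^+ 3)
    (R1 := y * (x * y ^+ 2 - lambda1%:A))
    (DirP : Dir (emb P) =i [:: (4, -1); (-2, 1); (-1, 0); (0, -1)])
    (DirQ : Dir (emb Q) =i [:: (4, -1); (-2, 1); (-1, 0); (0, -1)])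
    (ellP0 : ell (4, -1) (emb P) = lambdaP *: R0 ^+ m)
    (ellQ0 : ell (4, -1) (emb Q) = lambdaQ *: R0 ^+ n)
    (ellP1 : ell (-2, 1) (emb P) = lambdaP *: R1 ^+ (4 * m))
    (ellQ1 : ell (-2, 1) (emb Q) = lambdaQ *: R1 ^+ (4 * n))
    (F : laurent K)
    (homF : homogeneous (4, -1) F) (degF : vdeg (4, -1) F = 3)
    (brF : bracket F (ell (4, -1) (emb P)) = ell (4, -1) (emb P))
    (enF : en (4, -1) F = (3, 9%N)) :
  let: (m', n', P', Q') :=
    if (n < m)%N then (m, n, P, Q) else (n, m, Q, P) in
  exists j : nat,
    [/\ (0 < j)%N, m' = (3 * j + 1)%N, n' = (2 * j + 1)%N &
    exists (P6 Q6 : {mpoly K[2]}) (mu0 mu1 mu2 mu3 : K),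
      [/\ operations (emb P', emb Q') (emb P6, emb Q6),
          mu0 != 0,
          bracket (emb P6) (emb Q6) =
            x ^+ 4 * y + mu0%:A + mu1 *: x + mu2 *: x ^+ 2 + mu3 *: x ^+ 3,
          ell (1, -1) (emb P6) = x ^+ 3 * y + mu3 *: x ^+ 2 /\
          ell (1, -1) (emb Q6) = x ^+ 2 * y + mu3 *: x &
      [/\ [predI Dir (emb P6) & dirs_gt0] =i pred1 (j%:Z, 1),
          [predI Dir (emb Q6) & dirs_gt0] =i pred1 (j%:Z, 1),
          st (j%:Z, 1) (emb P6) = (3, 1%N) /\ st (j%:Z, 1) (emb Q6) = (2, 1%N),
          en (j%:Z, 1) (emb P6) = (0, m') &
          en (j%:Z, 1) (emb Q6) = (0, n')]]].
Proof.
case: stdPQ => [[m1 n1 cop] [PQ _ _ _ _]].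
case: ifP => [nm|]; first exact: (@ordered_case K charK0 m n P Q lambda0 lambda1
  lambdaP lambdaQ n1 nm cop PQ nz_lambda0 nz_lambdaP nz_lambdaQ ellP0 ellQ0 ellP1 ellQ1).
move=> /negbT; rewrite -leqNgt leq_eqVlt => /predU1P[E|mn].
  by move: cop; rewrite E /coprime gcdnn => /eqP n_1; rewrite n_1 in n1.
have QP : nonzero_const (bracket (emb Q) (emb P)).
  have [c c0 E] := PQ; exists (- c); first by rewrite oppr_eq0.
  have L := @lbrC K (laurent_alg K) (emb Q) (emb P).
  have E' := etrans (esym (bracket_lbr (emb P) (emb Q))) E.
  exact: (etrans (bracket_lbr (emb Q) (emb P))
    (etrans L (etrans (congr1 -%R E') (esym (scaleNr c (1 : laurent K)))))).
rewrite coprime_sym in cop.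
exact: (@ordered_case K charK0 n m Q P lambda0 lambda1 lambdaQ lambdaP m1 mn cop QP
  nz_lambda0 nz_lambdaQ nz_lambdaP ellQ0 ellP0 ellQ1 ellP1).
Qed.
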